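(* Let $n\ge2$ and let $c$ be a Coxeter element of the Coxeter group $W$ of type $\tilde A_{n-1}$, with associated sets $X,\Xi\subset\mathbb Z$. The monoid $M(P_c)$ equipped with the divisibility order has a lattice structure (and is then a quasi-Garside monoid) if and only if one of the two sets $\Xi$ or $X$ consists of a single element modulo $n$.
   Context: A permutation $w$ of $\mathbb Z$ is $n$-periodic if $w(x+n)=w(x)+n$ for all $x$; its shift is $\frac1n\sum_{x=1}^n(w(x)-x)$. $W$, the Coxeter group of type $\tilde A_{n-1}$, is identified with the group of $n$-periodic permutations of shift $0$ (product = composition, $(ww')(x)=w(w'(x))$). For integers $a_1,\dots,a_m$ pairwise distinct mod $n$ and $h\in\mathbb Z$, $(a_1,\dots,a_m)_{[h]}$ is the $n$-periodic permutation sending $a_i+kn\mapsto a_{i+1}+kn$ for $i<m$, $a_m+kn\mapsto a_1+(h+k)n$, and fixing all other integers; the index is omitted if $h=0$. The Coxeter generators are $s_i=(i,i+1)$, $i=1,\dots,n$; the set $R$ of reflections consists of the $(a,b)$ with $a\not\equiv b \pmod n$. $l_R(w)$ is the least number of factors in an expression of $w\in W$ as a product of reflections. $v$ divides $w$ if $w=vv'$ with $l_R(w)=l_R(v)+l_R(v')$ (equivalently $w=v''v$ with $l_R(w)=l_R(v'')+l_R(v)$). A Coxeter element is a product of $s_1,\dots,s_n$ in some order, each occurring once; every such $c$ can be written $c=(a_1,\dots,a_s)_{[1]}(\alpha_t,\dots,\alpha_1)_{[-1]}$ where $\{1,\dots,n\}=\{a_1<\dots<a_s\}\sqcup\{\alpha_1<\dots<\alpha_t\}$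 with $s,t\ge1$. Put $X=\{a_1,\dots,a_s\}+n\mathbb Z$, $\Xi=\{\alpha_1,\dots,\alpha_t\}+n\mathbb Z$. $P_c$ is the set of divisors of $c$, and $M(P_c)$ is the monoid generated by a set $\{\underline w\mid w\in P_c\}$ in bijection with $P_c$, with relations $\underline w.\underline{w'}=\underline{ww'}$ whenever $w,w',ww'\in P_c$ and $l_R(ww')=l_R(w)+l_R(w')$. A monoid $M$ is quasi-Garside if: (i) for every $m\in M$ the number of factors (different from $1$) in a product equal to $m$ is bounded; (ii) $M$ is left and right cancellative; (iii) left divisibility and right divisibility give two lattice structures on $M$; (iv) there is $\Delta\in M$ whose set of left divisors equals its set of right divisors and generates $M$. A lattice structure for divisibility on $M(P_c)$ is meant in the sense of (iii). *)

(* Defs.v *)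
From HB Require Import structures.
From mathcomp Require Import all_boot all_order all_algebra.
From mathcomp Require Import generic_quotient boolp classical_sets.

Set Implicit Arguments.
Unset Strict Implicit.
Unset Printing Implicit Defensive.
Import Order.TTheory GRing.Theory Num.Theory.
Local Open Scope ring_scope.

Definition periodic (n : nat) (w : int -> int) : Prop :=
  forall x : int, w (x + n%:Z) = w x + n%:Z.

Definition shift (n : nat) (w : int -> int) : rat :=
  (\sum_(1 <= i < n.+1) (w i%:Z - i%:Z))%:~R / n%:R.

Definition is_affine_perm (n : nat) (w : int -> int) : Prop :=
  [/\ bijective w, periodic n w & shift n w = 0].

(* The Coxeter group W of type affine A_{n-1}. *)
Record affine_perm (n : nat) := AffinePerm {
  affine_fun :> int -> int;
  affine_funP : `[< is_affine_perm n affine_fun >] }.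

HB.instance Definition _ (n : nat) := [isSub for @affine_fun n].
HB.instance Definition _ (n : nat) := [Choice of affine_perm n by <:].

Lemma affine_permP (n : nat) (u v : affine_perm n) : u =1 v -> u = v.
Proof. by move=> uv; apply/val_inj/funext. Qed.

Lemma periodicMz (n : nat) (w : int -> int) (x k : int) :
  periodic n w -> w (x + k * n%:Z) = w x + k * n%:Z.
Proof.
move=> wP; have pos (y : int) (m : nat) : w (y + m%:Z * n%:Z) = w y + m%:Z * n%:Z.
  elim: m => [|m IH]; first by rewrite !mul0r !addr0.
  by rewrite -addn1 PoszD mulrDl mul1r !addrA wP IH.
case: (intP k) => [|m|m]; [exact: (pos x 0%N) | exact: pos |].
by rewrite -[in RHS](subrK (m.+1%:Z * n%:Z) x) pos mulNr addrK.
Qed.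

Lemma periodic_mod (n : nat) (w : int -> int) (x y : int) :
    injective w -> periodic n w ->
  (w x == w y %[mod n%:Z])%Z -> (x == y %[mod n%:Z])%Z.
Proof.
move=> wI wP; rewrite !eqz_mod_dvd => /dvdzP[q /eqP]; rewrite subr_eq addrC.
by rewrite -periodicMz // => /eqP/wI->; rewrite addrC addKr dvdz_mull.
Qed.

Lemma sum_periodic (n : nat) (w f : int -> int) :
    injective w -> periodic n w -> (forall x, f (x + n%:Z) = f x) ->
  \sum_(1 <= i < n.+1) f (w i%:Z) = \sum_(1 <= i < n.+1) f i%:Z.
Proof.
case: n => [|n] wI wP fP; first by rewrite !big_geq.
set N := n.+1 in wP fP *.
have fM (x k : int) : f (x + k * N%:Z) = f x.
  have gP : periodic N (fun x => f x + x) by move=> y; rewrite fP addrA.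
  by apply: (addIr (x + k * N%:Z)); rewrite (periodicMz x k gP) addrA.
rewrite !big_add1 /= !big_mkord.
have sP (i : nat) : (`|((w i.+1%:Z - 1) %% N%:Z)%Z|%N < N)%N.
  by rewrite -ltz_nat gez0_abs ?modz_ge0 ?ltz_pmod.
pose s (i : 'I_N) : 'I_N := Ordinal (sP i).
have sE (i : 'I_N) : (s i)%:Z = ((w i.+1%:Z - 1) %% N%:Z)%Z.
  by rewrite /= gez0_abs ?modz_ge0.
have sI : injective s.
  move=> i j /(congr1 (fun k : 'I_N => k%:Z)); rewrite !sE => /eqP.
  rewrite eqz_modDr => /(periodic_mod wI wP).
  rewrite -[i.+1]addn1 -[j.+1]addn1 !PoszD eqz_modDr !modz_nat eqz_nat !modn_small //.
  by move=> /eqP/val_inj.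
rewrite [RHS](reindex_inj sI); apply: eq_bigr => i _ /=.
have -> : (s i).+1%:Z = (s i)%:Z + 1 by rewrite -PoszD addn1.
rewrite sE -[LHS](fM _ (- ((w i.+1%:Z - 1) %/ N%:Z)%Z)) mulNr.
by rewrite /modz addrAC subrK.
Qed.

Lemma shift_comp (n : nat) (v w : int -> int) :
    periodic n v -> injective w -> periodic n w ->
  shift n (v \o w) = shift n v + shift n w.
Proof.
move=> vP wI wP; rewrite /shift -mulrDl -intrD; congr (_%:~R / _).
rewrite -(sum_periodic (f := fun x => v x - x) wI wP).
  by rewrite -big_split /=; apply: eq_bigr => i _; rewrite addrA subrK.
by move=> x; rewrite vP opprD addrACA subrr addr0.
Qed.

Lemma shift_id (n : nat) : shift n idfun = 0.
Proof. by rewrite /shift big1 ?mul0r // => i _; rewrite subrr. Qed.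

Lemma periodic_can (n : nat) (v w : int -> int) :
  cancel w v -> cancel v w -> periodic n w -> periodic n v.
Proof. by move=> wK vK wP x; rewrite -[in LHS](vK x) -wP wK. Qed.

Lemma is_affine_id (n : nat) : is_affine_perm n idfun.
Proof. by split=> //; [exists idfun | exact: shift_id]. Qed.

Lemma is_affine_comp (n : nat) (v w : int -> int) :
  is_affine_perm n v -> is_affine_perm n w -> is_affine_perm n (v \o w).
Proof.
move=> [vB vP v0] [wB wP w0]; split; first exact: bij_comp.
  by move=> x /=; rewrite wP vP.
by rewrite shift_comp ?v0 ?w0 ?addr0 //; exact: bij_inj.
Qed.

Lemma affine_inv_ex (n : nat) (w : affine_perm n) :
  exists v : affine_perm n, cancel w v /\ cancel v w.
Proof.
case: w => w /= wW; case/asboolP: (wW) => -[v wK vK] wP w0.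
have vW : `[< is_affine_perm n v >].
  have vP := periodic_can wK vK wP.
  apply/asboolP; split=> //; first by exists w.
  have wv : w \o v = idfun by apply: funext.
  by rewrite -(shift_id n) -wv shift_comp ?w0 ?add0r //; exact: can_inj vK.
by exists (AffinePerm vW).
Qed.

Definition affine_one (n : nat) : affine_perm n :=
  AffinePerm (asboolT (is_affine_id n)).

Definition affine_mul (n : nat) (v w : affine_perm n) : affine_perm n :=
  AffinePerm (asboolT (is_affine_comp (asboolW (affine_funP v))
                                      (asboolW (affine_funP w)))).

Definition affine_inv (n : nat) (w : affine_perm n) : affine_perm n :=
  projT1 (cid (affine_inv_ex w)).

Lemma affine_invK (n : nat) (w : affine_perm n) :
  cancel w (affine_inv w) /\ cancel (affine_inv w) w.
Proof. exact: (projT2 (cid (affine_inv_ex w))). Qed.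

Lemma affine_mulA (n : nat) : associative (@affine_mul n).
Proof. by move=> u v w; apply: affine_permP. Qed.

Lemma affine_mul1g (n : nat) : left_id (@affine_one n) (@affine_mul n).
Proof. by move=> w; apply: affine_permP. Qed.

Lemma affine_mulg1 (n : nat) : right_id (@affine_one n) (@affine_mul n).
Proof. by move=> w; apply: affine_permP. Qed.

Lemma affine_mulVg (n : nat) :
  left_inverse (@affine_one n) (@affine_inv n) (@affine_mul n).
Proof. by move=> w; apply: affine_permP; case: (affine_invK w). Qed.

Lemma affine_mulgV (n : nat) :
  right_inverse (@affine_one n) (@affine_inv n) (@affine_mul n).
Proof. by move=> w; apply: affine_permP; case: (affine_invK w). Qed.

HB.instance Definition _ (n : nat) := isGroup.Build (affine_perm n)
  (@affine_mulA n) (@affine_mul1g n) (@affine_mulg1 n)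
  (@affine_mulVg n) (@affine_mulgV n).

(* The periodic permutation (a_1, ..., a_m)_[h], for a = [:: a_1; ...; a_m]
   with entries distinct mod n: an integer x = a_i + k n is sent to
   a_{i+1} + k n = a_{i+1} + (x - a_i) if i < m, and to
   a_1 + (h + k) n = a_1 + h n + (x - a_m) if i = m. *)
Definition pcycle (n : nat) (h : int) (a : seq int) (x : int) : int :=
  let i := find (fun b => (x == b %[mod n%:Z])%Z) a in
  if (i < size a)%N then
    if (i.+1 < size a)%N then nth 0 a i.+1 + (x - nth 0 a i)
    else nth 0 a 0 + h * n%:Z + (x - nth 0 a i)
  else x.

Lemma is_affine_pcycle2 (n : nat) (a b : int) :
  (a != b %[mod n%:Z])%Z -> is_affine_perm n (pcycle n 0 [:: a; b]).
Proof.
move=> ab; set t := pcycle _ _ _.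
have tE x : t x = if (x == a %[mod n%:Z])%Z then b + (x - a)
            else if (x == b %[mod n%:Z])%Z then a + (x - b) else x.
  rewrite /t /pcycle /= mul0r addr0; case: (x == a %[mod n%:Z])%Z => //=.
  by case: (x == b %[mod n%:Z])%Z.
have shE c d x : (x == c %[mod n%:Z])%Z -> (d + (x - c) == d %[mod n%:Z])%Z.
  by rewrite !eqz_mod_dvd addrAC subrr add0r.
have ba : (b == a %[mod n%:Z])%Z = false by rewrite eq_sym (negbTE ab).
have tK : involutive t.
  move=> x; rewrite [t x]tE; case: ifPn => [xa|xNa].
    rewrite tE (eqP (shE a b x xa)) ba eqxx.
    by rewrite addrAC subrr add0r addrC subrK.
  case: ifPn => [xb|xNb]; last by rewrite tE (negbTE xNa) (negbTE xNb).
  rewrite tE (eqP (shE b a x xb)) eqxx.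
  by rewrite addrAC subrr add0r addrC subrK.
have tP : periodic n t.
  by move=> x; rewrite !tE modzDr; do 2?case: ifP => _ //; rewrite addrAC !addrA.
split=> //; first exact: inv_bij.
have t2 : shift n t + shift n t = 0.
  rewrite -shift_comp //; last exact: inv_inj.
  by rewrite -[RHS](shift_id n); congr shift; apply: funext.
by apply/eqP; have /eqP := t2; rewrite -mulr2n mulrn_eq0.
Qed.

Local Open Scope group_scope.

Lemma affine_permM (n : nat) (v w : affine_perm n) (x : int) :
  (v * w) x = v (w x).
Proof. by []. Qed.

(* The element (a, b) of W; the default value 1 is only taken when a and b are
   congruent mod n. *)
Definition refl (n : nat) (a b : int) : affine_perm n :=
  insubd (1 : affine_perm n) (pcycle n 0 [:: a; b]).

Lemma reflE (n : nat) (a b : int) :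
  (a != b %[mod n%:Z])%Z -> refl n a b = pcycle n 0 [:: a; b] :> (int -> int).
Proof. by move=> ab; apply: insubdK; apply/asboolP/is_affine_pcycle2. Qed.

Definition is_reflection (n : nat) (w : affine_perm n) : Prop :=
  exists a b : int, (a != b %[mod n%:Z])%Z /\ w = refl n a b.

Definition reflection_product (n : nat) (w : affine_perm n) (k : nat) : Prop :=
  exists s : seq (affine_perm n),
    [/\ size s = k, forall t, t \in s -> is_reflection t
      & w = \prod_(t <- s) t].

(* For n > 0 every element of W is a product of reflections, so the default
   value 0 is not taken. *)
Definition lR (n : nat) (w : affine_perm n) : nat :=
  if pselect (exists k, `[< reflection_product w k >]) is left wP
  then ex_minn wP else 0%N.

Definition divides (n : nat) (v w : affine_perm n) : Prop :=
  exists v' : affine_perm n, w = v * v' /\ lR w = (lR v + lR v')%N.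

Definition coxeter_element (n : nat) (c : affine_perm n) : Prop :=
  exists2 p : seq nat, perm_eq p (iota 1 n)
    & c = \prod_(i <- p) refl n i%:Z i.+1%:Z.

Definition residue_set (n : nat) (a : seq int) : set int :=
  [set x | exists2 b, b \in a & (x == b %[mod n%:Z])%Z].

(* X and Xi are the subsets of the integers attached to the decomposition
   c = (a_1, ..., a_s)_[1] (alpha_t, ..., alpha_1)_[-1]. *)
Definition associated_sets (n : nat) (c : affine_perm n) (X Xi : set int) :
    Prop :=
  exists a alpha : seq int,
    [/\ sorted <%R a /\ sorted <%R alpha,
        perm_eq (a ++ alpha) [seq i%:Z | i <- iota 1 n],
        (1 <= size a)%N /\ (1 <= size alpha)%N,
        c =1 pcycle n 1 a \o pcycle n (-1) (rev alpha)
      & X = residue_set n a /\ Xi = residue_set n alpha].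

Definition single_mod (n : nat) (E : set int) : Prop :=
  exists2 x, E x & forall y, E y -> (y == x %[mod n%:Z])%Z.

Inductive pres_cong (T : Type) (r : seq T -> seq T -> Prop) :
    seq T -> seq T -> Prop :=
| PresRel (l l' u v : seq T) : r u v -> pres_cong r (l ++ u ++ l') (l ++ v ++ l')
| PresRefl (u : seq T) : pres_cong r u u
| PresSym (u v : seq T) : pres_cong r u v -> pres_cong r v u
| PresTrans (u v w : seq T) :
    pres_cong r u v -> pres_cong r v w -> pres_cong r u w.

Definition pres_eq (T : Type) (r : seq T -> seq T -> Prop) : rel (seq T) :=
  fun u v => `[< pres_cong r u v >].

Lemma pres_eq_refl (T : Type) (r : seq T -> seq T -> Prop) :
  reflexive (pres_eq r).
Proof. by move=> u; apply/asboolP/PresRefl. Qed.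

Lemma pres_eq_sym (T : Type) (r : seq T -> seq T -> Prop) :
  symmetric (pres_eq r).
Proof. by move=> u v; apply/asboolP/asboolP => /PresSym. Qed.

Lemma pres_eq_trans (T : Type) (r : seq T -> seq T -> Prop) :
  transitive (pres_eq r).
Proof.
by move=> v u w /asboolP uv /asboolP vw; apply/asboolP; exact: PresTrans uv vw.
Qed.

Canonical pres_equiv (T : Type) (r : seq T -> seq T -> Prop) :=
  EquivRel (pres_eq r) (pres_eq_refl r) (@pres_eq_sym T r) (@pres_eq_trans T r).

(* The monoid with generators T and relations u = v whenever r u v. *)
Definition presented (T : choiceType) (r : seq T -> seq T -> Prop) : Type :=
  {eq_quot (pres_eq r)}%qT.

HB.instance Definition _ (T : choiceType) (r : seq T -> seq T -> Prop) :=
  Choice.on (presented r).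
HB.instance Definition _ (T : choiceType) (r : seq T -> seq T -> Prop) :=
  EqQuotient.on (presented r).

Definition pres_class (T : choiceType) (r : seq T -> seq T -> Prop) (u : seq T)
  : presented r := \pi_(presented r)%qT u.

Definition pres_one (T : choiceType) (r : seq T -> seq T -> Prop) :
  presented r := pres_class r [::].

Definition pres_mul (T : choiceType) (r : seq T -> seq T -> Prop)
  (x y : presented r) : presented r :=
  pres_class r (repr x ++ repr y).

Lemma pres_classP (T : choiceType) (r : seq T -> seq T -> Prop) (u v : seq T) :
  pres_class r u = pres_class r v <-> pres_cong r u v.
Proof.
by split=> [/eqmodP/asboolP //|uv]; apply/eqmodP/asboolP.
Qed.

Lemma pres_class_repr (T : choiceType) (r : seq T -> seq T -> Prop)
  (x : presented r) : pres_class r (repr x) = x.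
Proof. exact: reprK. Qed.

Lemma pres_cong_ctx (T : Type) (r : seq T -> seq T -> Prop) (l l' u v : seq T) :
  pres_cong r u v -> pres_cong r (l ++ u ++ l') (l ++ v ++ l').
Proof.
elim=> {u v} [k k' u v ruv|u|u v _|u v w _ uv _].
- by have := PresRel (l ++ k) (k' ++ l') ruv; rewrite -!catA.
- exact: PresRefl.
- exact: PresSym.
- exact: PresTrans.
Qed.

Lemma pres_class_cat (T : choiceType) (r : seq T -> seq T -> Prop)
  (u v : seq T) : pres_class r (u ++ v) = pres_mul (pres_class r u) (pres_class r v).
Proof.
have cr w : pres_cong r w (repr (pres_class r w)).
  by apply/pres_classP; rewrite pres_class_repr.
apply/pres_classP; apply: (PresTrans (v := repr (pres_class r u) ++ v)).
  exact: (pres_cong_ctx [::] v (cr u)).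
by have := pres_cong_ctx (repr (pres_class r u)) [::] (cr v); rewrite !cats0.
Qed.

Lemma pres_mulA (T : choiceType) (r : seq T -> seq T -> Prop) :
  associative (@pres_mul T r).
Proof.
move=> x y z; rewrite -(pres_class_repr x) -(pres_class_repr y).
by rewrite -(pres_class_repr z) -!pres_class_cat catA.
Qed.

Lemma pres_mul1 (T : choiceType) (r : seq T -> seq T -> Prop) :
  left_id (@pres_one T r) (@pres_mul T r).
Proof.
by move=> x; rewrite -(pres_class_repr x) /pres_one -pres_class_cat.
Qed.

Lemma pres_mulr1 (T : choiceType) (r : seq T -> seq T -> Prop) :
  right_id (@pres_one T r) (@pres_mul T r).
Proof.
by move=> x; rewrite -(pres_class_repr x) /pres_one -pres_class_cat cats0.
Qed.

HB.instance Definition _ (T : choiceType) (r : seq T -> seq T -> Prop) :=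
  isMonoid.Build (presented r) (@pres_mulA T r) (@pres_mul1 T r)
    (@pres_mulr1 T r).

(* The set P_c of divisors of c. *)
Definition divisor (n : nat) (c : affine_perm n) : choiceType :=
  {v : affine_perm n | `[< divides v c >]}.

(* The generator attached to the identity is the unit of M(P_c); without the
   relation DualOne it would be an idempotent different from the empty word. *)
Inductive dual_rel (n : nat) (c : affine_perm n) :
    seq (divisor c) -> seq (divisor c) -> Prop :=
| DualOne (u : divisor c) : val u = 1 -> dual_rel [:: u] [::]
| DualMul (u v w : divisor c) :
    val w = val u * val v -> lR (val w) = (lR (val u) + lR (val v))%N ->
    dual_rel [:: u; v] [:: w].

Definition dual_monoid (n : nat) (c : affine_perm n) : monoidType :=
  presented (@dual_rel n c).

Definition ldiv (M : monoidType) (x y : M) : Prop := exists z : M, y = x * z.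

Definition rdiv (M : monoidType) (x y : M) : Prop := exists z : M, y = z * x.

Definition is_meet (T : Type) (le : T -> T -> Prop) (x y z : T) : Prop :=
  forall t, le t z <-> le t x /\ le t y.

Definition is_join (T : Type) (le : T -> T -> Prop) (x y z : T) : Prop :=
  forall t, le z t <-> le x t /\ le y t.

Definition is_lattice (T : Type) (le : T -> T -> Prop) : Prop :=
  [/\ forall x, le x x,
      forall x y z, le x y -> le y z -> le x z,
      forall x y, le x y -> le y x -> x = y,
      forall x y, exists z, is_meet le x y z
    & forall x y, exists z, is_join le x y z].

Definition divisibility_lattices (M : monoidType) : Prop :=
  is_lattice (@ldiv M) /\ is_lattice (@rdiv M).

Definition bounded_factorizations (M : monoidType) : Prop :=
  forall m : M, exists N : nat, forall s : seq M,
    1 \notin s -> \prod_(x <- s) x = m -> (size s <= N)%N.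

Definition cancellative (M : monoidType) : Prop :=
  (forall x y z : M, x * y = x * z -> y = z) /\
  (forall x y z : M, y * x = z * x -> y = z).

Definition generates (M : monoidType) (E : set M) : Prop :=
  forall m : M, exists2 s : seq M,
    (forall x, x \in s -> E x) & m = \prod_(x <- s) x.

Definition has_garside_element (M : monoidType) : Prop :=
  exists2 Delta : M, (forall x, ldiv x Delta <-> rdiv x Delta)
    & generates [set x | ldiv x Delta].

Definition quasi_garside (M : monoidType) : Prop :=
  [/\ bounded_factorizations M, cancellative M, divisibility_lattices M
    & has_garside_element M].

(* Main.v *)
Require Import Defs.
From mathcomp Require Import all_boot all_order all_algebra.
From mathcomp Require Import boolp classical_sets.
From mathcomp Require Import algC.
From mathcomp Require Import zify ring lra.

(* Let W act on the functions f : Z -> C with f(x + n) = q f(x), where |q| = 1 and q is not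
   a root of unity. This is a unitary action in which reflections have rank 1, so the
   reflection length is at least the codimension rho of the fixed space, and c, having no
   fixed vector, has length n. Elements v below c for rho are determined by their fixed
   spaces, v <= w being equivalent to Fix(w) <= Fix(v) (Brady and Watt).

   When Xi is a single class, lR = rho below c. An upper bound of two reflections is then
   described by equalities f(p) = f(p') valid on its fixed space; for crossing reflections
   further equalities are forced because (x, y) c preserves an explicit finite set, and the
   resulting set of equalities is always the fixed space of a product of reflections. Hence
   two reflections have a join, all joins exist in P_c, and Garside's argument gives lcms
   and cancellation in M(P_c). The case where X is a single class follows by passing to
   the inverse of c.

   When neither set is a single class, (a, c(a)) and (c(a), a + n) have the two upper bounds
   (a, c(a))_[1] (z_i)_[-1], with z_1, z_2 two classes in Xi, and no join. Joins in M(P_c)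
   of elements of P_c would be joins in P_c. *)

Set Implicit Arguments.
Unset Strict Implicit.
Unset Printing Implicit Defensive.
Import Order.TTheory GRing.Theory Num.Theory.
Local Open Scope ring_scope.

(** * The twisted permutation representation *)

Section UnitCircle.

(** An infinite orbit of v contains some x and x + k n with k nonzero, so a function with f(x + n) =
    q f(x) that is constant on orbits vanishes there: infinite orbits are seen as common zeros of
    the fixed functions.

    The obstacle is that [rho] can be smaller than [lR]: a translation with shifts 1, 1, -2 on three
    classes has [rho] equal to 3, but its reflection length is even. Linear algebra controls [rho]
    only, so equality below c has to be established before joins can be compared.

    The tool for this and for the forced equalities is not linear. Being fixed is constancy along
    orbits, so a fixed function may be cut off pointwise, for instance along the set where it is
    proportional to another one, and remains fixed.

    The constant comes from 3^2 + 4^2 = 5^2: it has modulus 1, and its rational coordinates reduce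
    the question about roots of unity to a congruence. *)

Definition q0 : algC := (3%:R + 'i * 4%:R) / 5%:R.

Lemma q0_unitary : q0 * q0^* = 1.
Proof.
have i2 : 'i * 'i = -1 :> algC by rewrite -expr2 sqrCi.
rewrite /q0 rmorphM /= fmorphV rmorphD rmorphM /= conjCi !conjC_nat.
have -> : (3%:R + 'i * 4%:R) / 5%:R * ((3%:R + - 'i * 4%:R) / 5%:R) =
   (9%:R - ('i * 'i) * 16%:R) / 25%:R :> algC by field.
by rewrite i2; field.
Qed.

(* (3 + 4i)^k is congruent to 3 + 4i modulo 5, hence never equal to 5^k. *)
Lemma q0_exp (k : nat) : exists a b : int,
  q0 ^+ k.+1 * 5%:R ^+ k.+1 = (5 * a + 3)%:~R + 'i * (5 * b + 4)%:~R.
Proof.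
have i2 : 'i * 'i = -1 :> algC by rewrite -expr2 sqrCi.
elim: k => [|k [a [b IH]]].
  by exists 0, 0; rewrite !expr1 /q0 !mulr0 !add0r; field.
exists (3 * a - 4 * b - 2), (4 * a + 3 * b + 4).
rewrite [in LHS]exprS [5%:R ^+ _ in LHS]exprS mulrACA IH /q0 divfK ?pnatr_eq0 //.
rewrite !(intrD, intrM, intrB).
by ring: i2.
Qed.

Lemma q0_inf (k : int) : q0 ^ k = 1 -> k = 0.
Proof.
have pos (m : nat) : q0 ^+ m.+1 = 1 -> False.
  move=> qm; have [a [b]] := q0_exp m; rewrite qm mul1r -natrX.
  move/(congr1 (fun z => 'Im z)); rewrite Im_rect ?Creal_Im //; last first.
  - exact: Rreal_int.
  - exact: Rreal_int.
  rewrite (Creal_ImP _ _) ?rpred_nat // => /esym/eqP; rewrite intr_eq0; lia.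
case: (intP k) => [//|m|m].
  by rewrite -exprnP => /pos.
rewrite -exprnN => /eqP; rewrite invr_eq1 => /eqP/pos //.
Qed.
End UnitCircle.

Lemma unit_circle_inf : {q : algC | q * q^* = 1 & forall k : int, q ^ k = 1 -> k = 0}.
Proof. by exists q0; [exact: q0_unitary | exact: q0_inf]. Qed.

(* Any number of modulus 1 that is not a root of unity would do. *)
Definition q : algC := s2val unit_circle_inf.

Lemma q_unitary : q * q^* = 1. Proof. exact: (s2valP unit_circle_inf). Qed.
Lemma q_inf (k : int) : q ^ k = 1 -> k = 0.
Proof. exact: (s2valP' unit_circle_inf). Qed.

Lemma q_neq0 : q != 0.
Proof. by apply/eqP => q0; have := q_unitary; rewrite q0 mul0r => /esym/eqP; rewrite oner_eq0. Qed.

Lemma qX_neq0 (k : int) : q ^ k != 0.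
Proof. by rewrite expfz_neq0 // q_neq0. Qed.

Lemma qXD (k l : int) : q ^ (k + l) = q ^ k * q ^ l.
Proof. by rewrite expfzDr // q_neq0. Qed.

Lemma qX_inj (k l : int) : q ^ k = q ^ l -> k = l.
Proof.
move=> kl; apply/eqP; rewrite -subr_eq0; apply/eqP/q_inf.
by rewrite qXD kl -qXD subrr.
Qed.

Lemma qX_fix (k : int) (x : algC) : x = q ^ k * x -> k != 0 -> x = 0.
Proof.
move=> xE k0; apply/eqP; apply: contraNT k0 => x0; apply/eqP/q_inf.
by apply: (mulIf x0); rewrite mul1r.
Qed.

Lemma qX_conj (k : int) : (q ^ k)^* = q ^ (- k).
Proof.
have -> : (q ^ k)^* = (q^* ) ^ k by rewrite rmorphXz // unitfE q_neq0.
have -> : q^* = q^-1.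
  by apply: (mulfI q_neq0); rewrite q_unitary divff ?q_neq0.
by rewrite exprz_inv.
Qed.

Definition adjmx (m n : nat) (A : 'M[algC]_(m, n)) : 'M[algC]_(n, m) :=
  map_mx (@Num.conj algC) A^T.

Lemma adjmxZ (m n : nat) (a : algC) (A : 'M_(m, n)) : adjmx (a *: A) = a^* *: adjmx A.
Proof. by apply/matrixP=> i j; rewrite !mxE rmorphM. Qed.

Lemma adjmx_delta (m n : nat) (i : 'I_m) (j : 'I_n) : adjmx (delta_mx i j) = delta_mx j i.
Proof. by apply/matrixP=> k l; rewrite !mxE conjC_nat andbC. Qed.

Lemma adjmxM (m n p : nat) (A : 'M_(m, n)) (B : 'M_(n, p)) :
  adjmx (A *m B) = adjmx B *m adjmx A.
Proof. by rewrite /adjmx trmx_mul map_mxM. Qed.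

Section Representation.
Variables (n : nat) (hn : (1 < n)%N).
Implicit Types (w : int -> int) (f : 'rV[algC]_n) (x y : int).

Let n0 : n%:Z != 0. Proof. by lia. Qed.

(* The vectors [evec x] satisfy e_(x + n) = q e_x and are permuted by W. *)
Definition evec (x : int) : 'cV[algC]_n :=
  \col_(i < n) (if i%:Z == (x %% n%:Z)%Z then q ^ (x %/ n%:Z)%Z else 0).

Lemma evecM x (k : int) : evec (x + k * n%:Z) = q ^ k *: evec x.
Proof.
apply/colP=> i; rewrite !mxE addrC modzMDl divzMDl // qXD.
by case: ifP; rewrite ?mulr0.
Qed.

(* A row vector f is identified with the function x |-> f(e_x), and these are the
   functions with f(x + n) = q f(x); w acts on them by composition. *)
Definition ev f x : algC := (f *m evec x) 0 0.

Lemma evM f x (k : int) : ev f (x + k * n%:Z) = q ^ k * ev f x.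
Proof. by rewrite /ev evecM -scalemxAr mxE. Qed.

Lemma evZ a f x : ev (a *: f) x = a * ev f x.
Proof. by rewrite /ev -scalemxAl mxE. Qed.

Lemma evD f g x : ev (f + g) x = ev f x + ev g x.
Proof. by rewrite /ev mulmxDl mxE. Qed.

Lemma evN f x : ev (- f) x = - ev f x.
Proof. by rewrite -scaleN1r evZ mulN1r. Qed.

Lemma ev0 x : ev 0 x = 0.
Proof. by rewrite /ev mul0mx mxE. Qed.

Lemma ev_ord f (i : 'I_n) : ev f i%:Z = f 0 i.
Proof.
rewrite /ev mxE (bigD1 i) //= big1 ?addr0 => [|j ji].
  by rewrite mxE modz_nat divz_nat modn_small ?divn_small // eqxx expr0z mulr1.
rewrite mxE modz_nat modn_small //; case: eqP => [/eqP|_]; last by rewrite mulr0.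
by rewrite eqz_nat val_eqE (negbTE ji).
Qed.

Lemma ev_inj f g : ev f =1 ev g -> f = g.
Proof. by move=> fg; apply/rowP=> i; rewrite -!ev_ord. Qed.

Definition quasi (g : int -> algC) : Prop := forall x (k : int), g (x + k * n%:Z) = q ^ k * g x.

Definition rowf (g : int -> algC) : 'rV[algC]_n := \row_(j < n) g j%:Z.

Lemma int_ordE x : exists (i : 'I_n) (k : int), x = i%:Z + k * n%:Z.
Proof.
have np : (0 < n%:Z) by lia.
have xl := ltz_pmod x np; have x0 := modz_ge0 x n0.
have iP : (`|(x %% n%:Z)%Z|%N < n)%N by rewrite -ltz_nat gez0_abs.
exists (Ordinal iP), (x %/ n%:Z)%Z => /=.
by rewrite gez0_abs // addrC -divz_eq.
Qed.

Lemma rowfE g x : quasi g -> ev (rowf g) x = g x.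
Proof.
move=> gP; have [i [k ->]] := int_ordE x.
by rewrite evM gP ev_ord mxE.
Qed.

(** Column j is the vector of [w j]; acting on rows from the right, this is composition with w and
    keeps the order of products. *)
Definition mxW w : 'M[algC]_n := \matrix_(i, j) evec (w j%:Z) i 0.

Lemma ev_mxW w f x : periodic n w -> ev (f *m mxW w) x = ev f (w x).
Proof.
move=> wP; have [i [k ->]] := int_ordE x.
rewrite periodicMz // !evM ev_ord; congr (_ * _).
by rewrite /ev !mxE; apply: eq_bigr => j _; rewrite [in LHS]mxE.
Qed.

Lemma mxWM v w : periodic n v -> periodic n w -> mxW (v \o w) = mxW v *m mxW w.
Proof.
move=> vP wP; have vwP : periodic n (v \o w) by move=> x /=; rewrite wP vP.
apply/row_matrixP => i; rewrite !rowE; apply: ev_inj => x.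
by rewrite mulmxA !ev_mxW.
Qed.

Lemma mxW1 : mxW idfun = 1%:M.
Proof.
apply/row_matrixP => i; rewrite !rowE mulmx1; apply: ev_inj => x.
by rewrite ev_mxW.
Qed.

(** Different classes are separated by a basis vector, and x, x + k n by q^k <> 1. This makes the
    representation faithful on W. *)
Lemma ev_sep x y : (forall f, ev f x = ev f y) -> x = y.
Proof.
have [i [k ->]] := int_ordE x; have [j [l ->]] := int_ordE y => h.
have := h (delta_mx 0 i); rewrite !evM !ev_ord !mxE !eqxx /=.
case: eqP => [<-|_]; last by move/eqP; rewrite mulr1 mulr0 (negbTE (qX_neq0 _)).
by rewrite !mulr1 => /qX_inj->.
Qed.

(** Up to phases q^k the vectors of the n classes are orthonormal; |q| = 1 enters here. *)
Lemma evec_dot x y : (adjmx (evec x) *m evec y) 0 0 =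
  (if (x == y %[mod n%:Z])%Z then q ^ ((y - x) %/ n%:Z)%Z else 0).
Proof.
have [i [k ->]] := int_ordE x; have [j [l ->]] := int_ordE y.
have dE (a : 'I_n) : evec a%:Z = delta_mx a 0.
  apply/colP=> b; rewrite !mxE modz_nat divz_nat modn_small ?divn_small //.
  by rewrite eqz_nat val_eqE andbT; case: eqP.
rewrite !evecM !(addrC _ (_ * _)) !modzMDl !modz_nat !modn_small //.
rewrite eqz_nat val_eqE !dE adjmxZ adjmx_delta -scalemxAr -scalemxAl.
rewrite mul_delta_mx_cond !mxE qX_conj mulmxnE !mxE !eqxx.
case: eqP => [->|_]; last by rewrite mulr0n !mulr0.
rewrite mulr1n mulr1 -qXD; congr (q ^ _).
by rewrite opprD addrACA subrr addr0 -mulrBl mulzK // addrC.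
Qed.

Lemma mxW_unitary w : periodic n w -> injective w ->
  adjmx (mxW w) *m mxW w = 1%:M.
Proof.
move=> wP wI; apply/matrixP=> i j.
transitivity ((adjmx (evec (w i%:Z)) *m evec (w j%:Z)) 0 0).
  by rewrite !mxE; apply: eq_bigr => k _; rewrite !mxE.
rewrite evec_dot mxE; case: (eqVneq i j) => [->|ij].
  by rewrite eqxx subrr div0z expr0z.
case: ifP => [/(periodic_mod wI wP)|//].
by rewrite !modz_nat !modn_small // eqz_nat val_eqE (negbTE ij).
Qed.

End Representation.

(** * Conjugation-invariant norms and the rank of w - 1 *)

Section MinusOrder.
Variables (F : fieldType) (n : nat).
Implicit Types A B N : 'M[F]_n.

(** Fixed vectors are rows, so inclusions of fixed spaces are inclusions of left kernels, dual to
    reverse inclusions of column spaces. *)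
Lemma ker_colsub A B : kermx A *m B = 0 -> exists Y, B = A *m Y.
Proof.
move=> kAB; set L := col_ebase A; set R := row_ebase A; set r := \rank A.
have Lu : L \in unitmx := col_ebase_unit A.
have Ru : R \in unitmx := row_ebase_unit A.
have LB : invmx L *m B = pid_mx r *m (invmx L *m B).
  apply/eqP; rewrite -subr_eq0 -{1}[invmx L *m B]mul1mx -mulmxBl mulmxA.
  by move: kAB; rewrite /kermx -/L -/r /copid_mx => ->.
exists (invmx R *m (invmx L *m B)).
rewrite -[in RHS](mulmx_ebase A) -/L -/R -/r !mulmxA mulmxK //.
by rewrite -!mulmxA -LB mulmxA mulmxV // mul1mx.
Qed.

Lemma rank_colsub A B : (\rank A + \rank (B - A)%R <= \rank B)%N -> exists Y, A = B *m Y.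
Proof.
move=> rAB.
have sB : (B^T <= A^T + (B - A)%R^T)%MS.
  by rewrite -[X in (X^T <= _)%MS](subrKC A) linearD /= addmx_sub_adds.
have sA : (A^T <= B^T)%MS.
  apply: submx_trans (addsmxSl _ (B - A)%R^T) _.
  have [_ <-] := mxrank_leqif_sup sB.
  rewrite eqn_leq mxrankS //= (leq_trans (mxrank_adds_leqif _ _).1) //.
  by rewrite !mxrank_tr.
have /submxP[D AD] := sA.
by exists D^T; rewrite -[A]trmxK AD trmx_mul trmxK.
Qed.

(** With P = A N^-1, the ranks of P and 1 - P add up to at most n while their row spaces span
    everything. These meet in 0, and P(1 - P) has its rows in both. *)
Lemma minus_idem A N : N \in unitmx -> (\rank A + \rank (N - A)%R <= n)%N ->
  A *m invmx N *m A = A.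
Proof.
move=> Nu rA; set P := A *m invmx N.
have PN : P *m N = A by rewrite mulmxKV.
have rP : \rank P = \rank A by rewrite mxrankMfree // row_free_unit unitmx_inv.
have P'N : (1%:M - P) *m N = N - A by rewrite mulmxBl mul1mx PN.
have rP' : \rank (1%:M - P)%R = \rank (N - A)%R.
  by rewrite -P'N mxrankMfree // row_free_unit.
have s1 : (1%:M <= P + (1%:M - P))%MS.
  by rewrite -[X in (X <= _)%MS](subrKC P) addmx_sub_adds.
have cap0 : (P :&: (1%:M - P) = 0)%MS.
  apply/eqP; rewrite -mxrank_eq0.
  have := mxrank_sum_cap P (1%:M - P); have := mxrankS s1.
  by rewrite mxrank1 rP rP'; lia.
have : P *m (1%:M - P) = 0.
  apply/eqP; rewrite -submx0 -cap0 sub_capmx submxMl andbT.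
  by rewrite mulmxBr mulmx1 addmx_sub // eqmx_opp submxMl.
rewrite mulmxBr mulmx1 => /eqP; rewrite subr_eq0 => /eqP PP.
by rewrite -{1}PN mulmxA -PP PN.
Qed.

(** P = A N^-1 and Q = B N^-1 are idempotents with PQ = QP = P, so the row spaces of P and Q - P
    meet in 0 and lie in that of Q. *)
Lemma minus_rank A B N Y Z : N \in unitmx ->
    A *m invmx N *m A = A -> B *m invmx N *m B = B -> A = B *m Y -> A = Z *m B ->
  (\rank A + \rank (B - A)%R <= \rank B)%N.
Proof.
move=> Nu AA BB AY AZ; set M := invmx N.
have Mf : row_free M by rewrite row_free_unit unitmx_inv.
rewrite -(mxrankMfree A Mf) -(mxrankMfree B Mf) -(mxrankMfree (B - A) Mf) mulmxBl.
set P := A *m M; set Q := B *m M.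
have PP : P *m P = P by rewrite /P mulmxA AA.
have QP : Q *m P = P by rewrite /P /Q AY !mulmxA BB.
have PQ : P *m Q = P by rewrite /P AZ !mulmxA -!(mulmxA Z) BB.
have cap0 : (P :&: (Q - P) = 0)%MS.
  apply/eqP; rewrite -submx0; set C := (P :&: _)%MS.
  have /submxP[D1 C1] : (C <= P)%MS by exact: capmxSl.
  have /submxP[D2 C2] : (C <= Q - P)%MS by exact: capmxSr.
  have CP : C *m P = C by rewrite C1 -mulmxA PP.
  by rewrite -CP C2 -mulmxA mulmxBl QP PP subrr mulmx0.
have := mxrank_sum_cap P (Q - P); rewrite cap0 mxrank0 addn0 => <-.
apply: mxrankS; rewrite addsmx_sub; apply/andP; split.
  by rewrite -PQ submxMl.
by rewrite -[X in (X - _ <= _)%MS]mul1mx -{1}PQ -mulmxBl submxMl.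
Qed.
End MinusOrder.

Record conj_norm (G : groupType) (l : G -> nat) : Prop := ConjNorm {
  norm1 : l 1%g = 0%N;
  norm_eq0 : forall x, l x = 0%N -> x = 1%g;
  normM : forall x y, (l (x * y)%g <= l x + l y)%N;
  normC : forall x y, l (x * y)%g = l (y * x)%g;
  normV : forall x, l x^-1%g = l x }.

Section NormOrder.
Local Open Scope group_scope.
Variables (G : groupType) (l : G -> nat) (lP : conj_norm l).
Implicit Types x y z c : G.

(* For l = lR, nle x y says that x divides y. *)
Definition nle x y : Prop := (l x + l (x^-1 * y)%g = l y)%N.

Lemma nleP x y : (l x + l (x^-1 * y)%g <= l y)%N -> nle x y.
Proof.
by move=> h; apply/eqP; rewrite eqn_leq h -{1}[y](mulVKg x) normM.
Qed.

Lemma nle_refl x : nle x x.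
Proof. by rewrite /nle mulVg norm1 // addn0. Qed.

Lemma nle1 x : nle 1 x.
Proof. by rewrite /nle norm1 // invg1 mul1g. Qed.

Lemma nle_leq x y : nle x y -> (l x <= l y)%N.
Proof. by rewrite /nle => <-; exact: leq_addr. Qed.

Lemma norm_tri x y z : (l (x^-1 * z)%g <= l (x^-1 * y)%g + l (y^-1 * z)%g)%N.
Proof.
have -> : x^-1 * z = (x^-1 * y) * (y^-1 * z) by rewrite mulgA mulgK.
exact: normM.
Qed.

Lemma nle_trans x y z : nle x y -> nle y z -> nle x z.
Proof. by move=> xy yz; apply: nleP; have := norm_tri x y z; rewrite -yz -xy; lia. Qed.

Lemma nle_eq x y : nle x y -> (l y <= l x)%N -> x = y.
Proof.
move=> xy yx; have /(norm_eq0 lP) : l (x^-1 * y)%g = 0%N by rewrite /nle in xy; lia.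
by move/(congr1 (fun t => x * t)); rewrite mulVKg mulg1.
Qed.

Lemma nle_mulr x y : (l (x * y)%g = l x + l y)%N -> nle x (x * y).
Proof. by rewrite /nle mulKg. Qed.

Lemma normJ x y : l (x^-1 * (y * x)) = l y.
Proof. by rewrite normC // mulgK. Qed.

(** Conjugation invariance moves the complement to the other side, so left and right divisors of y
    are the same elements. *)
Lemma nle_compl x y : nle x y -> nle (x^-1 * y) y.
Proof. by rewrite /nle invgM invgK -mulgA normJ addnC. Qed.

Lemma nle_mull x y : (l (x * y)%g = l x + l y)%N -> nle y (x * y).
Proof.
move=> /nle_mulr/nle_compl; by rewrite mulKg.
Qed.

Lemma nle_quot x y z : nle x y -> nle y z -> nle (x^-1 * y) (x^-1 * z).
Proof.
move=> xy yz; have xz := nle_trans xy yz.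
have e : (x^-1 * y)^-1 * (x^-1 * z) = y^-1 * z.
  by rewrite invgM invgK -mulgA mulVKg.
by rewrite /nle e; rewrite /nle in xy yz xz; lia.
Qed.

Lemma nle_quot_top x y z : nle x y -> nle y z -> nle (x^-1 * y) z.
Proof. by move=> xy yz; exact: nle_trans (nle_compl xy) yz. Qed.

Lemma nle_mul x y z : nle x z -> nle y (x^-1 * z) ->
  [/\ l (x * y)%g = (l x + l y)%N, nle x (x * y) & nle (x * y) z].
Proof.
move=> xz yz; have e : (x * y)^-1 * z = y^-1 * (x^-1 * z) by rewrite invgM mulgA.
have t1 := normM lP x y; have t2 := normM lP (x * y) ((x * y)^-1 * z).
rewrite mulVKg in t2; rewrite e in t2.
have lxy : l (x * y)%g = (l x + l y)%N by rewrite /nle in xz yz; lia.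
split=> //; first exact: nle_mulr.
by rewrite /nle e; rewrite /nle in xz yz; lia.
Qed.

Lemma norm_add3 x y z : l (x * y * z)%g = (l x + l y + l z)%N ->
  l (x * y)%g = (l x + l y)%N /\ l (y * z)%g = (l y + l z)%N.
Proof.
move=> e; have e' : l (x * (y * z))%g = (l x + l y + l z)%N by rewrite mulgA.
have t1 := normM lP x y; have t2 := normM lP y z.
have t3 := normM lP (x * y) z; have t4 := normM lP x (y * z).
rewrite e in t3; rewrite e' in t4; split; lia.
Qed.

Lemma norm_sandwich p r x y : (l x <= p)%N -> (l y <= r)%N -> (p + r <= l (x * y)%g)%N ->
  [/\ l x = p, l y = r & l (x * y)%g = (l x + l y)%N].
Proof. by move=> xp yr; have := normM lP x y; split; lia. Qed.

End NormOrder.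

Section RhoNorm.
Variables (n : nat) (hn : (1 < n)%N).
Implicit Types v w c : affine_perm n.

Definition mx (v : affine_perm n) : 'M[algC]_n := mxW n v.

Lemma affine_periodic v : periodic n v.
Proof. by have [_] := asboolW (affine_funP v). Qed.

Lemma affine_bij v : bijective v.
Proof. by have [] := asboolW (affine_funP v). Qed.

Lemma affine_inj v : injective v.
Proof. exact: bij_inj (affine_bij v). Qed.

Lemma affineD v (x k : int) : v (x + k * n%:Z) = v x + k * n%:Z.
Proof. exact: periodicMz (@affine_periodic v). Qed.

Lemma mxM v w : mx (v * w)%g = mx v *m mx w.
Proof. exact: mxWM (@affine_periodic v) (@affine_periodic w). Qed.

Lemma mx1 : mx 1%g = 1%:M.
Proof. exact: mxW1. Qed.

Lemma mxK v : mx v *m mx v^-1%g = 1%:M.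
Proof. by rewrite -mxM mulgV mx1. Qed.

Lemma mxVK v : mx v^-1%g *m mx v = 1%:M.
Proof. by rewrite -mxM mulVg mx1. Qed.

Lemma mx_unit v : mx v \in unitmx.
Proof. by case: (mulmx1_unit (mxK v)). Qed.

Lemma ev_mx v (f : 'rV_n) x : ev (f *m mx v) x = ev f (v x).
Proof. by apply: ev_mxW => //; exact: affine_periodic. Qed.

Definition fixes v (f : 'rV[algC]_n) : Prop := f *m mx v = f.

Lemma fixesP v f : fixes v f <-> forall x, ev f (v x) = ev f x.
Proof.
split=> [fv x|fv]; first by rewrite -ev_mx fv.
by apply: ev_inj => x; rewrite ev_mx.
Qed.

Lemma fixesM v w f : fixes v f -> fixes w f -> fixes (v * w)%g f.
Proof. by rewrite /fixes mxM mulmxA => -> ->. Qed.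

Lemma fixesE v f : fixes v f <-> f *m (mx v - 1%:M) = 0.
Proof.
rewrite mulmxBr mulmx1 /fixes; split=> [->|/eqP]; first by rewrite subrr.
by rewrite subr_eq0 => /eqP.
Qed.

Definition rho v : nat := \rank (mx v - 1%:M).

(** Multiplying by the invertible [mx v] preserves the rank. Thus [nle rho v w] says that the ranks
    of v - 1 and w - v add up to that of w - 1: the minus order on matrices. *)
Lemma rhoB v w : rho (v^-1 * w)%g = \rank (mx w - mx v)%R.
Proof.
have -> : mx w - mx v = mx v *m (mx (v^-1 * w)%g - 1%:M).
  by rewrite mulmxBr mulmx1 -mxM mulVKg.
by rewrite -mxrank_tr trmx_mul mxrankMfree ?mxrank_tr // row_free_unit unitmx_tr mx_unit.
Qed.

Lemma rho_norm : conj_norm rho.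
Proof.
split.
- by rewrite /rho mx1 subrr mxrank0.
- move=> v /eqP; rewrite mxrank_eq0 subr_eq0 => /eqP v1.
  apply: affine_permP => x; apply: (ev_sep hn) => f.
  by rewrite -ev_mx v1 mulmx1.
- move=> v w; rewrite /rho.
  have -> : mx (v * w)%g - 1%:M = (mx v - 1%:M) *m mx w + (mx w - 1%:M).
    by rewrite mulmxBl mul1mx -mxM addrA subrK.
  by apply: leq_trans (mxrank_add _ _) _; rewrite leq_add2r mxrankM_maxl.
- move=> v w; have := rhoB v^-1%g w; rewrite invgK => ->.
  have -> : rho (w * v)%g = rho ((w * v)^-1^-1 * 1)%g by rewrite invgK mulg1.
  rewrite rhoB mx1 invgM; have := mxK w.
  have -> : mx w - mx v^-1%g = (mx w *m mx v - 1%:M) *m mx v^-1%g.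
    by rewrite mulmxBl mul1mx -mulmxA mxK mulmx1.
  rewrite mxrankMfree ?row_free_unit ?mx_unit // => _.
  have -> : mx w *m mx v - 1%:M = (1%:M - mx (v^-1 * w^-1)%g) *m mx (w * v)%g.
    by rewrite mulmxBl mul1mx -!mxM mulgA mulgVK mulVg mx1.
  by rewrite mxrankMfree // row_free_unit mx_unit.
- move=> v; have := rhoB v 1%g; rewrite mulg1 => ->.
  by rewrite mx1 -mxrank_opp opprB.
Qed.

Lemma rho_kernel v : \rank (kermx (mx v - 1%:M)) = (n - rho v)%N.
Proof. exact: mxrank_ker. Qed.

Lemma rho_le v : (rho v <= n)%N.
Proof. exact: rank_leq_row. Qed.

Definition fixsub w v : Prop := forall f, fixes w f -> fixes v f.

Lemma fixsub_ker w v : fixsub w v <-> (kermx (mx w - 1%:M) *m (mx v - 1%:M) = 0).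
Proof.
split=> [wv|wv f /fixesE/eqP].
  apply/row_matrixP=> i; rewrite row_mul row0; apply/fixesE/wv/fixesE.
  by rewrite -row_mul mulmx_ker row0.
rewrite -sub_kermx => /submxP[D ->]; apply/fixesE.
by rewrite -mulmxA wv mulmx0.
Qed.

Lemma fixsub_rho w v : fixsub w v -> (rho v <= rho w)%N.
Proof.
by move/fixsub_ker/ker_colsub => [Y e]; rewrite /rho e mxrankM_maxl.
Qed.

Lemma fixsub_rho_lt w v f : fixsub w v -> fixes v f -> ~ fixes w f -> (rho v < rho w)%N.
Proof.
move=> wv vf wf; rewrite ltn_neqAle fixsub_rho // andbT; apply/eqP => e.
case: wf; apply/fixesE/eqP; rewrite -sub_kermx.
have sk : (kermx (mx w - 1%:M) <= kermx (mx v - 1%:M))%MS.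
  by rewrite sub_kermx; apply/eqP/fixsub_ker.
have [_ /esym] := mxrank_leqif_sup sk; rewrite !rho_kernel e eqxx => h.
by apply: submx_trans h; rewrite sub_kermx; apply/eqP/fixesE.
Qed.

Lemma rho_full v : (forall f, fixes v f -> f = 0) -> rho v = n.
Proof.
move=> v0; apply/eqP; rewrite -[_ == _]/(row_free _) -kermx_eq0; apply/eqP.
apply/row_matrixP=> i; rewrite row0; apply: v0; apply/fixesE.
by rewrite -row_mul mulmx_ker row0.
Qed.

Lemma rho_defect v f : fixes v f -> f != 0 -> (rho v < n)%N.
Proof.
move=> vf f0; rewrite ltn_neqAle rho_le andbT; apply: contraNneq f0 => rn.
have := rho_kernel v; rewrite rn subnn => /eqP; rewrite mxrank_eq0 => /eqP k0.
by rewrite -submx0 -k0 sub_kermx; apply/eqP/fixesE.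
Qed.

Lemma nle_fixsub v w : nle rho v w -> fixsub w v.
Proof.
rewrite /nle rhoB => vw.
have [Y vY] : exists Y, mx v - 1%:M = (mx w - 1%:M) *m Y.
  apply: rank_colsub; rewrite opprB addrA subrK.
  by rewrite -[leqRHS]/(rho w) -vw leqnn.
by move=> f /fixesE fw; apply/fixesE; rewrite vY mulmxA fw mul0mx.
Qed.

(* Unitarity turns the inclusion of column spaces of v - 1 and w - 1 into the
   inclusion of their row spaces; below a common c without nonzero fixed vector
   the idempotents (v - 1)(c - 1)^-1 and (w - 1)(c - 1)^-1 then commute. *)
Lemma fixsub_nle c v w : rho c = n -> nle rho v c -> nle rho w c ->
  fixsub w v -> nle rho v w.
Proof.
move=> cn vc wc /fixsub_ker/ker_colsub[Y vY].
have Nu : mx c - 1%:M \in unitmx by rewrite -row_free_unit; apply/eqP.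
have idem u : nle rho u c ->
    (mx u - 1%:M) *m invmx (mx c - 1%:M) *m (mx u - 1%:M) = mx u - 1%:M.
  rewrite /nle rhoB cn => uc; apply: minus_idem => //.
  by rewrite opprB addrA subrK -[leqRHS]uc leqnn.
(* Unitarity: the adjoint of u - 1 is u^-1 - 1 = -u^-1 (u - 1). *)
have adjE u : adjmx (mx u - 1%:M) = - mx u^-1%g *m (mx u - 1%:M).
  have uU : adjmx (mx u) = mx u^-1%g.
    have := mxW_unitary hn (@affine_periodic u) (@affine_inj u) => e.
    by rewrite -[LHS]mulmx1 -(mxK u) mulmxA [adjmx _ *m _]e mul1mx.
  rewrite mulmxBr mulmx1 mulNmx mxVK opprK addrC -uU.
  by apply/matrixP=> i j; rewrite !mxE rmorphD rmorphN /= conjC_nat eq_sym.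
apply: nleP; first exact: rho_norm.
rewrite rhoB.
have -> : mx w - mx v = (mx w - 1%:M) - (mx v - 1%:M) by rewrite opprB addrA subrK.
(* Z is read off from the adjoint of v - 1 = (w - 1) Y, transformed by [adjE]. *)
apply: (minus_rank (N := mx c - 1%:M) (Y := Y)
  (Z := mx v *m adjmx Y *m mx w^-1%g)) => //; try exact: idem.
have := congr1 (@adjmx _ _) vY; rewrite adjmxM !adjE => /(congr1 (mulmx (mx v))).
rewrite mulmxA mulmxN mxK mulNmx mul1mx !mulmxA mulmxN !mulNmx.
by move/oppr_inj.
Qed.
End RhoNorm.

(** * Reflection length *)

Section Reflections.
Variables (n : nat) (hn : (1 < n)%N).
Implicit Types (v w : affine_perm n) (a b x y : int).

Let n0 : n%:Z != 0. Proof. by lia. Qed.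

Definition cong x y : bool := (x == y %[mod n%:Z])%Z.

Lemma congP x y : reflect (exists k : int, x = y + k * n%:Z) (cong x y).
Proof.
rewrite /cong eqz_mod_dvd; apply: (iffP dvdzP) => -[k e]; exists k.
  by rewrite -e subrKC.
by rewrite e addrC addKr.
Qed.

Lemma congxx x : cong x x. Proof. exact: eqxx. Qed.

Lemma cong_sym x y : cong x y = cong y x. Proof. exact: eq_sym. Qed.

Lemma congDl x y (k : int) : cong (x + k * n%:Z) y = cong x y.
Proof. by rewrite /cong addrC modzMDl. Qed.

Lemma congDr x y (k : int) : cong x (y + k * n%:Z) = cong x y.
Proof. by rewrite cong_sym congDl cong_sym. Qed.

Lemma cong_shift x (k : int) : cong (x + k * n%:Z) x.
Proof. by rewrite congDl congxx. Qed.

Lemma affine_cong v x y : cong (v x) (v y) = cong x y.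
Proof.
apply/idP/idP; first exact: periodic_mod (@affine_inj _ v) (@affine_periodic _ v).
by move=> /congP[k ->]; rewrite affineD cong_shift.
Qed.

Lemma affine_fixD v x (k : int) : v x = x -> v (x + k * n%:Z) = x + k * n%:Z.
Proof. by rewrite affineD => ->. Qed.

Lemma reflxE a b x : ~~ cong a b -> refl n a b x =
  if cong x a then b + (x - a) else if cong x b then a + (x - b) else x.
Proof.
move=> ab; rewrite reflE // /pcycle /= mul0r addr0 -/(cong x a) -/(cong x b).
by case: (cong x a) => //=; case: (cong x b).
Qed.

Lemma refl_l a b (k : int) : ~~ cong a b -> refl n a b (a + k * n%:Z) = b + k * n%:Z.
Proof. by move=> ab; rewrite reflxE // cong_shift (addrC a) addrK. Qed.

Lemma refl_r a b (k : int) : ~~ cong a b -> refl n a b (b + k * n%:Z) = a + k * n%:Z.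
Proof.
move=> ab; rewrite reflxE // congDl cong_sym (negbTE ab) cong_shift.
by rewrite (addrC b) addrK.
Qed.

Lemma refl_a a b : ~~ cong a b -> refl n a b a = b.
Proof. by move=> ab; have := refl_l 0 ab; rewrite mul0r !addr0. Qed.

Lemma refl_b a b : ~~ cong a b -> refl n a b b = a.
Proof. by move=> ab; have := refl_r 0 ab; rewrite mul0r !addr0. Qed.

Lemma refl_out a b x : ~~ cong a b -> ~~ cong x a -> ~~ cong x b -> refl n a b x = x.
Proof. by move=> ab /negbTE xa /negbTE xb; rewrite reflxE // xa xb. Qed.

Variant refl_spec a b x : int -> Prop :=
| ReflL (k : int) of x = a + k * n%:Z : refl_spec a b x (b + k * n%:Z)
| ReflR (k : int) of x = b + k * n%:Z : refl_spec a b x (a + k * n%:Z)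
| ReflN of ~~ cong x a & ~~ cong x b : refl_spec a b x x.

Lemma reflP a b x : ~~ cong a b -> refl_spec a b x (refl n a b x).
Proof.
move=> ab; have [/congP[k e]|xa] := boolP (cong x a).
  by rewrite [in refl n a b x]e refl_l //; constructor.
have [/congP[k e]|xb] := boolP (cong x b).
  by rewrite [in refl n a b x]e refl_r //; constructor.
by rewrite refl_out //; constructor.
Qed.

Lemma refl_sym a b : ~~ cong a b -> refl n a b = refl n b a.
Proof.
move=> ab; have ba : ~~ cong b a by rewrite cong_sym.
apply: affine_permP => x; case: (reflP x ab) => [k ->|k ->|xa xb].
- by rewrite refl_r.
- by rewrite refl_l.
- by rewrite refl_out.
Qed.

Lemma refl_shift a b (k : int) : ~~ cong a b ->
  refl n (a + k * n%:Z) (b + k * n%:Z) = refl n a b.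
Proof.
move=> ab; have ab' : ~~ cong (a + k * n%:Z) (b + k * n%:Z) by rewrite congDl congDr.
apply: affine_permP => x; case: (reflP x ab) => [l ->|l ->|xa xb].
- have -> : a + l * n%:Z = (a + k * n%:Z) + (l - k) * n%:Z by ring.
  by rewrite refl_l //; ring.
- have -> : b + l * n%:Z = (b + k * n%:Z) + (l - k) * n%:Z by ring.
  by rewrite refl_r //; ring.
- by rewrite refl_out // congDr.
Qed.

Lemma reflK a b : ~~ cong a b -> (refl n a b * refl n a b = 1)%g.
Proof.
move=> ab; apply: affine_permP => x; rewrite affine_permM.
case: (reflP x ab) => [k ->|k ->|xa xb].
- by rewrite refl_r.
- by rewrite refl_l.
- by rewrite refl_out.
Qed.

Lemma reflV a b : ~~ cong a b -> (refl n a b)^-1%g = refl n a b.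
Proof. by move=> ab; rewrite -[LHS]mulg1 -(reflK ab) mulKg. Qed.

Lemma refl_conj v a b : ~~ cong a b -> (v * refl n a b * v^-1)%g = refl n (v a) (v b).
Proof.
move=> ab; have ab' : ~~ cong (v a) (v b) by rewrite affine_cong.
suff e : (v * refl n a b = refl n (v a) (v b) * v)%g by rewrite e mulgK.
apply: affine_permP => x; rewrite !affine_permM.
case: (reflP x ab) => [k ->|k ->|xa xb].
- by rewrite !(affineD v) refl_l.
- by rewrite !(affineD v) refl_r.
- by rewrite refl_out // affine_cong.
Qed.

Lemma fixes_refl a b (f : 'rV_n) : ~~ cong a b ->
  fixes (refl n a b) f <-> ev f a = ev f b.
Proof.
move=> ab; rewrite (fixesP hn); split=> [/(_ b)|e x]; first by rewrite refl_b.
by case: (reflP x ab) => [k ->|k ->|//]; rewrite !evM // e.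
Qed.

Definition delta a x : algC := if cong x a then q ^ ((x - a) %/ n%:Z)%Z else 0.

Lemma delta_quasi a : quasi n (delta a).
Proof.
move=> x k; rewrite /delta congDl; case: ifP; rewrite ?mulr0 // => _.
by rewrite -qXD; congr (q ^ _); rewrite addrAC addrC divzMDl.
Qed.

Definition drow a : 'rV[algC]_n := rowf n (delta a).

Lemma drowE a x : ev (drow a) x = delta a x.
Proof. by rewrite rowfE //; exact: delta_quasi. Qed.

Lemma delta_aa a : delta a a = 1.
Proof. by rewrite /delta congxx subrr div0z expr0z. Qed.

Lemma delta_out a x : ~~ cong x a -> delta a x = 0.
Proof. by rewrite /delta => /negbTE->. Qed.

Lemma rho_refl a b : ~~ cong a b -> (rho (refl n a b) <= 1)%N.
Proof.
move=> ab; set r := refl n a b.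
have ba : ~~ cong b a by rewrite cong_sym.
suff /mxrankS h : (mx r - 1%:M <= drow b *m (mx r - 1%:M))%MS.
  by apply: leq_trans h _; rewrite -[1%N]/(1%N) rank_leq_row.
apply/row_subP => i; rewrite rowE; set f := delta_mx 0 i.
apply/submxP; exists (ev f b - ev f a)%:M; rewrite mul_scalar_mx.
apply: ev_inj => x; rewrite evZ !mulmxBr !mulmx1 !evD !evN !ev_mx // !drowE.
case: (reflP x ab) => [k ->|k ->|xa xb].
- by rewrite !evM // !delta_quasi delta_aa (delta_out ab); ring.
- by rewrite !evM // !delta_quasi delta_aa (delta_out ab); ring.
- by rewrite !subrr mulr0.
Qed.

(** Shift 0 is used here: the displacements over one period add up to 0, so a single class cannot be
    the only one moved. *)
Lemma sum_fix w x : (forall y, ~~ cong y x -> w y = y) -> w x = x.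
Proof.
move=> wf; have [_ _ /eqP] := asboolW (affine_funP w).
rewrite /shift mulf_eq0 invr_eq0 pnatr_eq0 intr_eq0 -(negbK (n == 0)%N).
have -> : (n != 0)%N by lia.
rewrite orbF big_add1 /= big_mkord => /eqP.
have [i [k xE]] := int_ordE hn (x - 1).
have {}xE : x = i.+1%:Z + k * n%:Z by rewrite intS -addrA -xE subrKC.
rewrite (bigD1 i) //= big1 ?addr0 => [/eqP|j ji].
  by rewrite subr_eq0 xE => /eqP; exact: affine_fixD.
apply/eqP; rewrite subr_eq0; apply/eqP/wf; rewrite xE congDr.
by rewrite /cong -[j.+1]addn1 -[i.+1]addn1 !PoszD eqz_modDr !modz_nat !modn_small.
Qed.

Definition moved w : nat := #|[pred i : 'I_n | w i%:Z != i%:Z]|.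

Lemma moved_lt w v y : (forall x, w x = x -> v x = x) -> v y = y -> w y <> y ->
  (moved v < moved w)%N.
Proof.
move=> wv vy wy; have [i [k yE]] := int_ordE hn y; subst y.
apply: proper_card; apply/properP; split.
  by apply/fintype.subsetP => j; rewrite !inE; apply: contra => /eqP/wv->.
exists i; rewrite !inE; first by apply: contra_not_neq wy => wi; exact: affine_fixD.
rewrite negbK; move: vy; rewrite affineD => /addIr->; exact: eqxx.
Qed.

Lemma moved_leq w v : (forall x, w x = x -> v x = x) -> (moved v <= moved w)%N.
Proof.
move=> wv; apply/subset_leq_card/fintype.subsetP => j; rewrite !inE.
by apply: contra => /eqP/wv->.
Qed.

Lemma refl_step w y : ~~ cong (w y) y ->
  ((refl n y (w y) * w)%g y = y) /\ forall x, w x = x -> (refl n y (w y) * w)%g x = x.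
Proof.
rewrite cong_sym => wy; split=> [|x wx]; rewrite affine_permM; first by rewrite refl_b.
rewrite wx refl_out //; apply/negP => /congP[k xE].
  by move: wy; rewrite -{1}[y](addrK (k * n%:Z)) -xE -mulNr congDl xE;
     move: wx; rewrite xE affineD => /addIr->; rewrite congDl congxx.
have : w x = w (y + k * n%:Z) by rewrite affineD -xE.
move/affine_inj => e; move: wy; rewrite -(congDr _ _ k) -xE e.
by rewrite cong_sym cong_shift.
Qed.

Lemma is_refl a b : ~~ cong a b -> is_reflection (refl n a b).
Proof. by move=> ab; exists a, b. Qed.

Lemma reflection_product_refl a b w k : ~~ cong a b ->
  reflection_product (refl n a b * w)%g k -> reflection_product w k.+1.
Proof.
move=> ab [s [sk sR e]]; exists (refl n a b :: s); split; first by rewrite /= sk.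
  by move=> t; rewrite inE => /orP[/eqP->|/sR//]; exact: is_refl.
by rewrite big_cons -e mulgA reflK // mul1g.
Qed.

(** If w moves y to another class, (y, w y) w fixes y and all that w fixed. Otherwise w preserves
    all classes and, by [sum_fix], moves two of them; exchanging these leads back to the first case
    without moving more points. *)
Lemma affine_generated w : exists k, reflection_product w k.
Proof.
elim/ltn_ind: (moved w) {-2}w (erefl (moved w)) => m IH {}w wm.
have step v y : (moved v <= m)%N -> ~~ cong (v y) y ->
    exists k, reflection_product v k.
  move=> vm vy; have [fy fx] := refl_step vy.
  have yv : ~~ cong y (v y) by rewrite cong_sym.
  have lt : (moved (refl n y (v y) * v)%g < m)%N.
    apply: leq_trans vm; apply: moved_lt fx fy _ => e.
    by rewrite e congxx in vy.
  have [k kP] := IH _ lt _ erefl; exists k.+1.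
  exact: reflection_product_refl yv kP.
have [[y]|wc] := pselect (exists y, ~~ cong (w y) y); first by apply: step; rewrite wm.
have {}wc y : cong (w y) y by apply: contrapT => /negP yc; apply: wc; exists y.
have [w1|w1] := pselect (w = 1%g).
  by exists 0%N, [::]; split=> //; rewrite big_nil.
have [x wx] : exists x, w x <> x.
  by apply: contrapT => h; apply: w1; apply: affine_permP => x; apply: contrapT => wx; apply: h; exists x.
have [y yx wy] : exists2 y, ~~ cong y x & w y <> y.
  apply: contrapT => h; apply: wx; apply: sum_fix => y yx.
  by apply: contrapT => wy; apply: h; exists y.
have xy : ~~ cong x y by rewrite cong_sym.
have [||k kP] := step (refl n x y * w)%g x.
- rewrite -wm; apply: moved_leq => z wz; rewrite affine_permM wz refl_out //.
    by apply/negP=> /congP[l zE]; apply: wx; move: wz; rewrite zE affineD => /addIr.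
  by apply/negP=> /congP[l zE]; apply: wy; move: wz; rewrite zE affineD => /addIr.
- rewrite affine_permM; have /congP[l ->] := wc x.
  by rewrite refl_l // congDl.
- by exists k.+1; exact: reflection_product_refl xy kP.
Qed.

Lemma lR_product w : reflection_product w (lR w).
Proof.
rewrite /lR; case: pselect => [wP|[]]; first by case: ex_minnP => k /asboolP.
by have [k kP] := affine_generated w; exists k; apply/asboolP.
Qed.

Lemma lR_min w k : reflection_product w k -> (lR w <= k)%N.
Proof.
move=> wk; rewrite /lR; case: pselect => // wP.
by case: ex_minnP => m _; apply; apply/asboolP.
Qed.

Lemma reflection_productM v w k l : reflection_product v k ->
  reflection_product w l -> reflection_product (v * w)%g (k + l).
Proof.
move=> [s [<- sR ->]] [t [<- tR ->]]; exists (s ++ t); split.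
- by rewrite size_cat.
- by move=> u; rewrite mem_cat => /orP[/sR|/tR].
- by rewrite big_cat.
Qed.

Lemma reflection_productV v k : reflection_product v k -> reflection_product (v^-1)%g k.
Proof.
move=> [s [<- sR ->]]; exists (rev s); split; first by rewrite size_rev.
  by move=> t; rewrite mem_rev => /sR.
elim: s sR => [|t s IH] sR; first by rewrite !big_nil invg1.
rewrite rev_cons -cats1 big_cat /= !big_cons big_nil mulg1 invgM IH.
  by have [|a [b [ab ->]]] := sR t; rewrite ?mem_head // reflV.
by move=> u us; apply: sR; rewrite inE us orbT.
Qed.

Lemma reflection_productJ v w k : reflection_product v k ->
  reflection_product (w * v * w^-1)%g k.
Proof.
move=> [s [<- sR ->]]; exists [seq (w * t * w^-1)%g | t <- s]; split.
- by rewrite size_map.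
- move=> u /mapP[t ts ->]; have [a [b [ab ->]]] := sR t ts.
  by rewrite refl_conj //; apply: is_refl; rewrite affine_cong.
- elim: s {sR} => [|t s IH]; first by rewrite !big_nil mulg1 mulgV.
  by rewrite /= !big_cons -IH !mulgA mulgVK.
Qed.

Lemma lR_norm : conj_norm (@lR n).
Proof.
split.
- by apply/eqP; rewrite -leqn0; apply: lR_min; exists [::]; split; rewrite ?big_nil.
- move=> w w0; have [s []] := lR_product w; rewrite w0 => /size0nil-> _ ->.
  by rewrite big_nil.
- by move=> v w; apply/lR_min/reflection_productM; exact: lR_product.
- have h v w : (lR (v * w)%g <= lR (w * v)%g)%N.
    apply: lR_min; have := reflection_productJ v (lR_product (w * v)%g).
    by rewrite !mulgA mulgK.
  by move=> v w; apply/eqP; rewrite eqn_leq !h.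
- have h v : (lR v^-1%g <= lR v)%N.
    by apply: lR_min; apply: reflection_productV; exact: lR_product.
  by move=> v; apply/eqP; rewrite eqn_leq h -{1}[v]invgK h.
Qed.

Lemma lR_refl_le a b : ~~ cong a b -> (lR (refl n a b) <= 1)%N.
Proof.
move=> ab; apply: lR_min; exists [:: refl n a b]; split=> //; last by rewrite big_seq1.
by move=> t; rewrite inE => /eqP->; exact: is_refl.
Qed.

Lemma refl_neq1 a b : ~~ cong a b -> refl n a b <> 1%g.
Proof.
move=> ab /(congr1 (fun v : affine_perm n => v a)); rewrite refl_a // => ba.
by move: ab; rewrite ba congxx.
Qed.

Lemma lR_refl a b : ~~ cong a b -> lR (refl n a b) = 1%N.
Proof.
move=> ab; apply/eqP; rewrite eqn_leq lR_refl_le //= lt0n; apply/eqP.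
by move/(norm_eq0 lR_norm); exact: refl_neq1.
Qed.

Lemma rho_refl1 a b : ~~ cong a b -> rho (refl n a b) = 1%N.
Proof.
move=> ab; apply/eqP; rewrite eqn_leq rho_refl //= lt0n; apply/eqP.
by move/(norm_eq0 (rho_norm hn)); exact: refl_neq1.
Qed.

Lemma rho_lR w : (rho w <= lR w)%N.
Proof.
have [s [<- sR ->]] := lR_product w; elim: s sR => [|t s IH] sR.
  by rewrite big_nil (norm1 (rho_norm hn)).
rewrite big_cons; apply: leq_trans (normM (rho_norm hn) _ _) _.
have [|a [b [ab ->]]] := sR t; first by rewrite mem_head.
rewrite rho_refl1 // leq_add2l IH // => u us; apply: sR.
by rewrite inE us orbT.
Qed.

Lemma lR_pred w : w <> 1%g -> exists a b w',
  [/\ ~~ cong a b, w = (refl n a b * w')%g & lR w = (lR w').+1].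
Proof.
move=> w1; have [[|t s] [sk sR e]] := lR_product w; first by rewrite big_nil in e.
have [|a [b [ab tE]]] := sR t; first by rewrite mem_head.
exists a, b, (\prod_(u <- s) u)%g; rewrite big_cons tE in e; split=> //.
apply/eqP; rewrite eqn_leq; apply/andP; split.
  by rewrite {1}e; apply: leq_trans (normM lR_norm _ _) _; rewrite lR_refl.
rewrite -sk /= ltnS; apply: lR_min; exists s; split=> // u us; apply: sR.
by rewrite inE us orbT.
Qed.

End Reflections.

(** * Infinite orbits and reflection length *)

Section Orbits.
Variables (n : nat) (hn : (1 < n)%N).
Implicit Types (u v w : affine_perm n) (a b x y : int).

Lemma fixsub_refl a b v : ~~ cong n a b ->
  fixsub v (refl n a b) <-> (forall f, fixes v f -> ev f a = ev f b).
Proof.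
by move=> ab; split=> h f /h; [move/(fixes_refl hn f ab) | move=> ?; apply/(fixes_refl hn f ab)].
Qed.

Lemma fixsub_mul v w : fixsub v w -> fixsub v (w * v)%g.
Proof. by move=> vw f vf; apply: fixesM => //; exact: vw. Qed.

Lemma fixes_drow v y : fixes v (drow n y) <-> v y = y.
Proof.
rewrite (fixesP hn); split=> [/(_ y)|vy x]; rewrite !drowE //.
  rewrite delta_aa // /delta; case: congP => [[k vy]|_]; last by move/eqP; rewrite eq_sym oner_eq0.
  by rewrite vy (addrC y) addrK mulzK; [move/q_inf->; rewrite mul0r add0r | lia].
have [/congP[k ->]|xy] := boolP (cong n x y); first by rewrite affine_fixD.
by rewrite !delta_out // -[X in cong n _ X]vy affine_cong.
Qed.

(* The points of the infinite orbits of v. *)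
Definition vanish v x : Prop := forall f, fixes v f -> ev f x = 0.

Lemma vanish_fixsub v w x : fixsub v w -> vanish w x -> vanish v x.
Proof. by move=> vw wx f /vw; exact: wx. Qed.

Lemma vanishD v x (k : int) : vanish v (x + k * n%:Z) <-> vanish v x.
Proof.
split=> h f fv; have := h f fv; rewrite evM //; last by move->; rewrite mulr0.
by move/eqP; rewrite mulf_eq0 (negbTE (qX_neq0 _)) => /eqP.
Qed.

Lemma vanish_cong v x y : cong n x y -> vanish v x -> vanish v y.
Proof. by case/congP => k ->; move/vanishD. Qed.

Lemma vanish_img v x : vanish v x -> vanish v (v x).
Proof. by move=> vx f fv; rewrite (fixesP hn v f).1 // vx. Qed.

Lemma vanish_shift v x (k : int) : v x = x + k * n%:Z -> k != 0 -> vanish v x.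
Proof.
move=> vx k0 f /(fixesP hn)/(_ x); rewrite vx evM // => /esym h.
exact: qX_fix h k0.
Qed.

Lemma fixed_not_vanish v x : v x = x -> ~ vanish v x.
Proof.
move=> /fixes_drow fx /(_ _ fx)/eqP; rewrite drowE // delta_aa //.
by rewrite oner_eq0.
Qed.

Lemma nonvanish_moved v x : ~ vanish v x -> v x <> x -> ~~ cong n (v x) x.
Proof.
move=> nv vx; apply/negP => /congP[k e]; apply: nv; apply: (vanish_shift e).
by apply: contra_not_neq vx => k0; rewrite e k0 mul0r addr0.
Qed.

(** The delta function [drow n y] is fixed after splitting off (y, v y) but not before, whence the
    strict drop of [rho]. *)
Lemma orbit_step v y : ~~ cong n (v y) y ->
  [/\ fixsub v (refl n y (v y)), fixsub v (refl n y (v y) * v)%g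
    & (rho (refl n y (v y) * v)%g < rho v)%N].
Proof.
move=> vy; have yv : ~~ cong n y (v y) by rewrite cong_sym.
have s1 : fixsub v (refl n y (v y)).
  by apply/fixsub_refl => // f /(fixesP hn)->.
have s2 := fixsub_mul s1; split=> //.
apply: (fixsub_rho_lt (f := drow n y)) => //.
  by apply/fixes_drow; case: (refl_step vy).
by move/fixes_drow => e; rewrite e congxx in vy.
Qed.

(** Each reflection (x, v x) split off lowers [rho] and creates no infinite orbit, so at most
    [rho v] of them exhaust v. *)
Lemma lR_elliptic v : (forall x, ~ vanish v x) -> (lR v <= rho v)%N.
Proof.
elim/ltn_ind: (rho v) {-2}v (erefl (rho v)) => m IH {}v vm nv.
have [->|v1] := pselect (v = 1%g); first by rewrite (norm1 (lR_norm hn)).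
have [x vx] : exists x, v x <> x.
  apply: contrapT => h; apply: v1; apply: affine_permP => x.
  by apply: contrapT => vx; apply: h; exists x.
have vxx := nonvanish_moved (nv x) vx.
have xv : ~~ cong n x (v x) by rewrite cong_sym.
have [_ s2 lt] := orbit_step vxx; rewrite vm in lt.
have {}IH := IH _ lt _ erefl (fun y h => nv y (vanish_fixsub s2 h)).
have h : (lR v <= (lR (refl n x (v x) * v)%g).+1)%N.
  have {1}-> : v = (refl n x (v x) * (refl n x (v x) * v))%g by rewrite mulgA reflK ?mul1g.
  by apply: leq_trans (normM (lR_norm hn) _ _) _; rewrite lR_refl.
rewrite -vm in lt *; exact: leq_trans h (leq_ltn_trans IH lt).
Qed.

(** Infinite orbits cannot occupy one class only: splitting off reflections outside the class of x
    would end with an element moving this class alone, against [sum_fix]. *)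
Lemma vanish_other v x : vanish v x -> exists2 y, ~~ cong n y x & vanish v y.
Proof.
elim/ltn_ind: (rho v) {-2}v (erefl (rho v)) => m IH {}v vm vx.
apply: contrapT => h.
have {h} nv y : ~~ cong n y x -> ~ vanish v y by move=> yx vy; apply: h; exists y.
have vxx : cong n (v x) x by apply/negPn/negP => /nv; apply; exact: vanish_img.
have [/congP[k vxE]] := vxx.
have k0 : k != 0.
  by apply/eqP => k0; apply: (fixed_not_vanish (v := v) (x := x)) => //; rewrite vxE k0 mul0r addr0.
have [[y yx vy]|all] := pselect (exists2 y, ~~ cong n y x & v y <> y); last first.
  apply: (fixed_not_vanish _ vx); apply: (sum_fix hn) => y yx.
  by apply: contrapT => vy; apply: all; exists y.
have vyy := nonvanish_moved (nv y yx) vy.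
have yv : ~~ cong n y (v y) by rewrite cong_sym.
have [_ s2 lt] := orbit_step vyy; rewrite vm in lt.
have [|z zx vz] := IH _ lt _ erefl.
  apply: (vanish_shift (k := k) _ k0); rewrite affine_permM vxE refl_out //.
    by rewrite congDl cong_sym.
  by rewrite -vxE affine_cong cong_sym.
by apply: (nv z zx); exact: vanish_fixsub s2 vz.
Qed.

End Orbits.

(** * Joins from joins of atoms *)

Section LocalJoins.
Local Open Scope group_scope.
Variables (G : groupType) (l : G -> nat) (lP : conj_norm l) (c : G).
Implicit Types x y z r u v w : G.

Definition join_below v w := exists j, [/\ nle l j c, nle l v j, nle l w j &
  forall u, nle l u c -> nle l v u -> nle l w u -> nle l j u].

Lemma join_belowC v w : join_below v w -> join_below w v.
Proof. by move=> [j [j1 j2 j3 j4]]; exists j; split=> // u uc wu vu; exact: j4. Qed.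

Variable R : G -> Prop.
Hypothesis R_atom : forall x, nle l x c -> x <> 1 -> exists2 r, R r & nle l r x.
Hypothesis R_gt0 : forall r, R r -> (0 < l r)%N.
Hypothesis R_join : forall r s, R r -> R s -> nle l r c -> nle l s c -> join_below r s.

(* The local criterion of Bjorner, Edelman and Ziegler: it is enough to join two
   covers a, b of z; then x \/ y is obtained as (x \/ (a \/ b)) \/ y. *)
Lemma atom_joins z x y : nle l z x -> nle l z y -> nle l x c -> nle l y c -> join_below x y.
Proof.
have tr := nle_trans lP; elim/ltn_ind: (l c - l z)%N {-2}z (erefl (l c - l z)%N) x y => m IH {}z zm x y zx zy xc yc.
have zc := tr _ _ _ zx xc.
have atom t : nle l z t -> nle l t c -> z <> t ->
    exists r, [/\ R r, nle l r (z^-1 * c), nle l z (z * r), nle l (z * r) t & (l z < l (z * r)%g)%N].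
  move=> zt tc nzt; have [|r Rr rt] := R_atom (nle_quot_top lP zt tc).
    by move=> e; apply: nzt; rewrite -[t](mulVKg z) e mulg1.
  have [e1 e2 e3] := nle_mul lP zt rt; exists r; split=> //.
    exact: tr rt (nle_quot lP zt tc).
  by rewrite e1 -{1}[l z]addn0 ltn_add2l R_gt0.
have [<-|nzx] := pselect (z = x); first by exists y; split=> //; exact: nle_refl.
have [<-|nzy] := pselect (z = y); first by exists x; split=> //; exact: nle_refl.
have [r [Rr rc zr rx lr]] := atom x zx xc nzx; have [s [Rs sc zs sy ls]] := atom y zy yc nzy.
have zcc := nle_compl lP zc.
have [j [jc rj sj jmin]] := R_join Rr Rs (tr _ _ _ rc zcc) (tr _ _ _ sc zcc).
have jzc := jmin _ zcc rc sc; have [_ zj zjc] := nle_mul lP zc jzc.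
have up t : nle l t j -> nle l (z * t) (z * j).
  by move=> tj; have [|_ _] := nle_mul lP zj (y := t); rewrite ?mulKg.
have low t u : nle l z (z * t) -> nle l (z * t) u -> nle l t (z^-1 * u).
  by move=> zt tu; have := nle_quot lP zt tu; rewrite mulKg.
have lc t : nle l t c -> (l t <= l c)%N := @nle_leq _ _ _ _.
(* The two joins are taken above z r and z s respectively, which are longer than z, so the induction
   measure decreases. *)
have [k [kc xk jk kmin]] : join_below x (z * j).
  by apply: (IH _ _ _ erefl _ _ rx (up _ rj) xc zjc); have := lc _ (tr _ _ _ rx xc); lia.
have [i [ic yi ki imin]] : join_below y k.
  by apply: (IH _ _ _ erefl _ _ sy (tr _ _ _ (up _ sj) jk) yc kc); have := lc _ (tr _ _ _ sy yc); lia.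
exists i; split=> //; first exact: tr xk ki.
move=> u uc xu yu; apply: imin => //; apply: kmin => //.
have ru := tr _ _ _ rx xu; have su := tr _ _ _ sy yu; have zu := tr _ _ _ zx xu.
have := jmin _ (nle_quot_top lP zu uc) (low _ _ zr ru) (low _ _ zs su).
by move/(nle_mul lP zu) => [].
Qed.

Lemma all_joins x y : nle l x c -> nle l y c -> join_below x y.
Proof. by apply: atom_joins; exact: nle1. Qed.
End LocalJoins.

(** Inversion exchanges left and right complements, whose lengths agree by conjugation
    invariance. *)
Lemma nleV (G : groupType) (l : G -> nat) (x y : G) : conj_norm l ->
  nle l x y -> nle l x^-1%g y^-1%g.
Proof.
move=> lP; rewrite /nle !normV // invgK => <-; congr (_ + _)%N.
by rewrite normC // -(normV lP) invgM invgK.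
Qed.

Lemma join_belowV (G : groupType) (l : G -> nat) (c v w : G) : conj_norm l ->
  join_below l c^-1%g v^-1%g w^-1%g -> join_below l c v w.
Proof.
move=> lP [j [jc vj wj jmin]]; exists j^-1%g.
have V x y : nle l x^-1%g y -> nle l x y^-1%g by move/(nleV lP); rewrite invgK.
split; [by move: (nleV lP jc); rewrite invgK | exact: V | exact: V |].
move=> u uc vu wu; have := jmin _ (nleV lP uc) (nleV lP vu) (nleV lP wu).
by move/(nleV lP); rewrite invgK.
Qed.

(** * Coxeter elements *)

(* c moves each point of X to the next point of X and each point of the complement Xi
   to the previous point of Xi. *)
Record cox_data (n : nat) (c : affine_perm n) (X : int -> bool) : Prop := CoxData {
  cox_periodic : forall (x k : int), X (x + k * n%:Z) = X x;
  cox_up : forall x, X x ->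
    [/\ X (c x), x < c x & forall y, X y -> x < y -> c x <= y];
  cox_down : forall x, ~~ X x ->
    [/\ ~~ X (c x), c x < x & forall y, ~~ X y -> y < x -> y <= c x];
  cox_exX : exists x, X x;
  cox_exXi : exists x, ~~ X x }.

Section CoxData.
Variables (n : nat) (hn : (1 < n)%N) (c : affine_perm n) (X : int -> bool).
Hypothesis cX : cox_data c X.
Implicit Types (x y z k l : int).

Lemma coxE x : X (c x) = X x.
Proof.
have [Xx|Xx] := boolP (X x); first by have [-> ] := cox_up cX Xx.
by have [/negbTE-> ] := cox_down cX Xx.
Qed.

Lemma cox_inv : cox_data c^-1%g (fun x => ~~ X x).
Proof.
have cK x : c (c^-1%g x) = x by rewrite -affine_permM mulgV.
have XV x : X (c^-1%g x) = X x by rewrite -coxE cK.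
split=> [x k|x Xx|x|  |].
- by rewrite (cox_periodic cX).
- have Xz : ~~ X (c^-1%g x) by rewrite XV.
  have [_ lt h] := cox_down cX Xz; rewrite cK in lt h; split=> // y Xy xy.
  by rewrite leNgt; apply/negP => /(h y Xy); rewrite leNgt xy.
- move/negbNE => Xx; have Xz : X (c^-1%g x) by rewrite XV.
  have [_ lt h] := cox_up cX Xz; rewrite cK in lt h.
  rewrite XV Xx; split=> // y /negbNE Xy xy.
  by rewrite leNgt; apply/negP => /(h y Xy); rewrite leNgt xy.
- by have [x] := cox_exXi cX; exists x.
- by have [x] := cox_exX cX; exists x; rewrite negbK.
Qed.

Lemma cox_ind (Q : int -> Prop) x y : X x -> X y -> x <= y -> Q x ->
  (forall z, X z -> x <= z -> z < y -> Q z -> Q (c z)) -> Q y.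
Proof.
move=> Xx Xy; have [m] := ubnP `|y - x|%N; elim: m x Xx => // m IH x Xx lt xy Qx Qc.
have [<-//|xNy] := eqVneq x y; have {xNy} xy' : x < y by rewrite lt_neqAle xNy.
have [Xc xc h] := cox_up cX Xx; have cy := h y Xy xy'.
apply: (IH (c x)) => //; first lia.
  exact: Qc.
by move=> z Xz cz zy; apply: Qc => //; lia.
Qed.

(** Iterating c from x reaches x + n, so f(x) = f(x + n) = q f(x). *)
Lemma fixes_cox f x : fixes c f -> X x -> ev f x = 0.
Proof.
move=> /(fixesP hn) fc Xx.
have : ev f (x + 1 * n%:Z) = ev f x.
  apply: (cox_ind (Q := fun y => ev f y = ev f x) Xx) => //.
  - by rewrite (cox_periodic cX).
  - lia.
  - by move=> z _ _ _; rewrite fc.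
by rewrite evM // => /esym/qX_fix; apply.
Qed.
End CoxData.

Lemma rho_cox n (hn : (1 < n)%N) (c : affine_perm n) X : cox_data c X -> rho c = n.
Proof.
move=> cX; apply: rho_full => f fc; apply: ev_inj => x; rewrite ev0.
have [Xx|Xx] := boolP (X x); first exact: (fixes_cox hn cX fc).
apply: (fixes_cox hn (cox_inv cX)) => //.
have h : f *m mx c *m mx c^-1%g = f *m mx c^-1%g by rewrite fc.
rewrite -mulmxA (mxK hn) mulmx1 in h.
by rewrite /fixes -h.
Qed.

Section Floor.
Variables (n : nat) (hn : (1 < n)%N).
Implicit Types (x y z k l : int).

Lemma ltz_muln k l : (k * n%:Z < l * n%:Z) = (k < l).
Proof. by rewrite ltr_pM2r //; lia. Qed.

Lemma lez_muln k l : (k * n%:Z <= l * n%:Z) = (k <= l).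
Proof. by rewrite ler_pM2r //; lia. Qed.

Lemma floor_ex x z : exists k, x + k * n%:Z <= z < x + (k + 1) * n%:Z.
Proof.
exists ((z - x) %/ n%:Z)%Z; have np : 0 < n%:Z by lia.
have n0 : n%:Z != 0 by lia.
have := divz_eq (z - x) n%:Z; have := ltz_pmod (z - x) np; have := modz_ge0 (z - x) n0.
set k := (_ %/ _)%Z; set r := (_ %% _)%Z; rewrite mulrDl mul1r; lia.
Qed.

Lemma floorE x z k : x + k * n%:Z <= z < x + (k + 1) * n%:Z -> ((z - x) %/ n%:Z)%Z = k.
Proof.
move=> h; have n0 : n%:Z != 0 by lia.
have -> : z - x = k * n%:Z + (z - x - k * n%:Z) by rewrite subrKC.
by rewrite mulrDl mul1r in h; rewrite divzMDl // divz_small ?addr0 //; lia.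
Qed.

Lemma window_ncong x y : x < y < x + n%:Z -> ~~ cong n x y.
Proof.
move=> h; apply/negP => /congP[k e].
have : (-1) * n%:Z < k * n%:Z by lia.
have : k * n%:Z < 0 * n%:Z by lia.
by rewrite !ltz_muln; lia.
Qed.

Lemma cong_window x y : ~~ cong n y x -> exists2 k, x < y + k * n%:Z & y + k * n%:Z < x + n%:Z.
Proof.
move=> yx; have [k /andP[h1 h2]] := floor_ex x y; exists (- k); last by rewrite mulrDl in h2; lia.
rewrite lt_neqAle mulNr; apply/andP; split; last lia.
by apply: contraNneq yx => e; apply/congP; exists k; rewrite [in RHS]e subrK.
Qed.

End Floor.

(** * From cycle notation to successor and predecessor maps *)

Section PeriodicCycle.
Variables (n : nat) (hn : (1 < n)%N).
Implicit Types (s : seq int) (x y k : int).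

Lemma cong_box x y k l : 1 <= x <= n%:Z -> 1 <= y <= n%:Z ->
  x + k * n%:Z = y + l * n%:Z -> x = y /\ k = l.
Proof.
move=> hx hy e; have kl : k = l.
  have : k < l + 1 by rewrite -(ltz_muln hn) mulrDl; lia.
  have : l < k + 1 by rewrite -(ltz_muln hn) mulrDl; lia.
  lia.
by rewrite kl in e *; split=> //; exact: addIr e.
Qed.

Lemma mul_step k l : k < l -> k * n%:Z + n%:Z <= l * n%:Z.
Proof. by move=> kl; have : (k + 1) * n%:Z <= l * n%:Z by [rewrite lez_muln //; lia]; rewrite mulrDl; lia. Qed.

Definition boxed s := forall x, x \in s -> 1 <= x <= n%:Z.

Lemma pcycle_nth (h : int) s i k : uniq s -> boxed s -> (i < size s)%N ->
  pcycle n h s (nth 0 s i + k * n%:Z) =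
    (if (i.+1 < size s)%N then nth 0 s i.+1 else nth 0 s 0 + h * n%:Z) + k * n%:Z.
Proof.
move=> us bs si; rewrite /pcycle; set P := (fun b => _); set x := nth 0 s i + _.
have sP : has P s by apply/hasP; exists (nth 0 s i); [exact: mem_nth | exact: cong_shift].
have -> : find P s = i.
  have /congP[l e] := nth_find 0 sP; have fs : (find P s < size s)%N by rewrite -has_find.
  have [|||e' _] := @cong_box (nth 0 s i) (nth 0 s (find P s)) k l; rewrite ?bs ?mem_nth //.
  by apply/eqP; rewrite -(nth_uniq 0 fs si us) e'.
by rewrite si /x; case: ifP => _; ring.
Qed.

Lemma pcycle_out (h : int) s x : ~~ has (cong n x) s -> pcycle n h s x = x.
Proof. by rewrite has_find /pcycle => /negbTE->. Qed.

Lemma res_nth s x : has (cong n x) s ->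
  exists (i : nat) (k : int), (i < size s)%N /\ x = nth 0 s i + k * n%:Z.
Proof.
move=> /hasP[b bs /congP[k ->]]; exists (index b s), k.
by rewrite index_mem bs nth_index.
Qed.

Lemma nth_res s i k : (i < size s)%N -> has (cong n (nth 0 s i + k * n%:Z)) s.
Proof. by move=> si; apply/hasP; exists (nth 0 s i); rewrite ?mem_nth // cong_shift. Qed.

Lemma pcycle_res (h : int) s x : uniq s -> boxed s -> has (cong n x) s ->
  has (cong n (pcycle n h s x)) s.
Proof.
move=> us bs /res_nth[i [k [si ->]]]; rewrite pcycle_nth //.
case: ifP => si'; first exact: nth_res.
by rewrite -addrA -mulrDl; apply: nth_res; apply: leq_ltn_trans si.
Qed.

Lemma pcycle_succ s x : sorted <%R s -> boxed s -> has (cong n x) s ->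
  x < pcycle n 1 s x /\ forall y, has (cong n y) s -> x < y -> pcycle n 1 s x <= y.
Proof.
move=> ss bs; have us := sorted_uniq lt_trans ltxx ss.
have mono i j : (i < j)%N -> (j < size s)%N -> nth 0 s i < nth 0 s j.
  move=> ij sj; apply: (sorted_ltn_nth lt_trans 0 ss) => //; rewrite inE //.
  exact: ltn_trans sj.
have box i : (i < size s)%N -> 1 <= nth 0 s i <= n%:Z by move=> si; apply/bs/mem_nth.
move=> /res_nth[i [k [si ->]]]; rewrite pcycle_nth //; case: ifP => si'.
  split; first by have := mono i i.+1 (ltnSn i) si'; lia.
  move=> y /res_nth[j [l [sj ->]]] lt.
  have [kl|lk|e] := ltgtP k l.
  - by have := mul_step kl; have := box _ sj; have := box _ si'; lia.
  - by have := mul_step lk; have := box _ sj; have := box _ si; lia.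
  subst l; rewrite lerD2r; rewrite ltrD2r in lt.
  have [ij|ji|e] := ltngtP i j; last by rewrite e ltxx in lt.
    have [ij'|ji'|->//] := ltngtP i.+1 j; last by rewrite ltnS leqNgt ij in ji'.
    exact: ltW (mono _ _ ij' sj).
  by have := mono _ _ ji si; lia.
have s0 : (0 < size s)%N by exact: leq_ltn_trans si.
split; first by have := box _ si; have := box _ s0; lia.
move=> y /res_nth[j [l [sj ->]]] lt.
have ji : (j <= i)%N by rewrite -ltnS; apply: leq_trans sj _; rewrite leqNgt si'.
have le_ji : nth 0 s j <= nth 0 s i.
  by move: ji; rewrite leq_eqVlt => /orP[/eqP->//|ji]; exact: ltW (mono _ _ ji si).
have le_0j : nth 0 s 0 <= nth 0 s j.
  by case: (posnP j) => [->//|j0]; exact: ltW (mono _ _ j0 sj).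
have [kl|lk|e] := ltgtP k l; last by subst l; lia.
  by have := mul_step kl; rewrite mul1r; lia.
by have := mul_step lk; have := box _ sj; have := box _ si; lia.
Qed.

Lemma pcycle_pred s x : sorted >%R s -> boxed s -> has (cong n x) s ->
  pcycle n (-1) s x < x /\ forall y, has (cong n y) s -> y < x -> y <= pcycle n (-1) s x.
Proof.
have gt_trans : transitive (>%R : rel int) by move=> y x' z /= h1 h2; exact: lt_trans h2 h1.
move=> ss bs; have us : uniq s by apply: (sorted_uniq gt_trans) ss => z; exact: ltxx.
have mono i j : (i < j)%N -> (j < size s)%N -> nth 0 s j < nth 0 s i.
  move=> ij sj; apply: (sorted_ltn_nth gt_trans 0 ss) => //; rewrite inE //.
  exact: ltn_trans sj.
have box i : (i < size s)%N -> 1 <= nth 0 s i <= n%:Z by move=> si; apply/bs/mem_nth.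
move=> /res_nth[i [k [si ->]]]; rewrite pcycle_nth //; case: ifP => si'.
  split; first by have := mono i i.+1 (ltnSn i) si'; lia.
  move=> y /res_nth[j [l [sj ->]]] lt.
  have [kl|lk|e] := ltgtP k l.
  - by have := mul_step kl; have := box _ sj; have := box _ si; lia.
  - by have := mul_step lk; have := box _ sj; have := box _ si'; lia.
  subst l; rewrite lerD2r; rewrite ltrD2r in lt.
  have [ij|ji|e] := ltngtP i j; last by rewrite e ltxx in lt.
    have [ij'|ji'|->//] := ltngtP i.+1 j; last by rewrite ltnS leqNgt ij in ji'.
    exact: ltW (mono _ _ ij' sj).
  by have := mono _ _ ji si; lia.
have s0 : (0 < size s)%N by exact: leq_ltn_trans si.
split; first by have := box _ si; have := box _ s0; lia.
move=> y /res_nth[j [l [sj ->]]] lt.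
have ji : (j <= i)%N by rewrite -ltnS; apply: leq_trans sj _; rewrite leqNgt si'.
have le_ji : nth 0 s i <= nth 0 s j.
  by move: ji; rewrite leq_eqVlt => /orP[/eqP->//|ji]; exact: ltW (mono _ _ ji si).
have le_0j : nth 0 s j <= nth 0 s 0.
  by case: (posnP j) => [->//|j0]; exact: ltW (mono _ _ j0 sj).
have [kl|lk|e] := ltgtP k l; last by subst l; lia.
  by have := mul_step kl; have := box _ sj; have := box _ si; lia.
by have := mul_step lk; rewrite mulN1r; lia.
Qed.

(** As the entries are sorted, the first cycle is the successor map of X and the reversed one the
    predecessor map of Xi; the indices 1 and -1 are the passage to the adjacent period. *)
Lemma associated_cox (c : affine_perm n) (X Xi : set int) : associated_sets c X Xi ->
  exists B : int -> bool, [/\ cox_data c B, forall x, X x <-> B x & forall x, Xi x <-> ~~ B x].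
Proof.
case=> a [al [[sa sal] pe [a0 al0] cE [XE XiE]]].
have resE (s : seq int) x : residue_set n s x <-> has (cong n x) s.
  by split=> [[b bs h]|/hasP[b bs h]]; [apply/hasP; exists b | exists b].
have memE x : (x \in a) || (x \in al) = (1 <= x <= n%:Z).
  rewrite -mem_cat (perm_mem pe); apply/mapP/idP => [[i]|h].
    by rewrite mem_iota => h ->; lia.
  by exists `|x|%N; rewrite ?mem_iota; lia.
have ba : boxed a by move=> x xa; rewrite -memE xa.
have bal : boxed al by move=> x xa; rewrite -memE xa orbT.
have bral : boxed (rev al) by move=> x; rewrite mem_rev; exact: bal.
have ual : uniq al := sorted_uniq lt_trans ltxx sal.
have uu : uniq (a ++ al).
  by rewrite (perm_uniq pe) map_inj_uniq ?iota_uniq // => i j [].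
have disj x : has (cong n x) a -> ~~ has (cong n x) al.
  move=> /res_nth[i [k [si ->]]]; apply/negP => /res_nth[j [l [sj e]]].
  have [||e' _] := cong_box _ _ e; [by apply/ba/mem_nth | by apply/bal/mem_nth |].
  move: uu; rewrite cat_uniq => /and3P[_ /hasPn/(_ (nth 0 al j) (mem_nth _ sj))/negP h _].
  by apply: h; rewrite -e' mem_nth.
have cover x : ~~ has (cong n x) a -> has (cong n x) al.
  have [k xk] := floor_ex hn 1 x; have : 1 <= x + (- k) * n%:Z <= n%:Z.
    by rewrite mulrDl in xk; rewrite mulNr; lia.
  rewrite -memE => /orP[h|h] na.
    by case/negP: na; apply/hasP; exists (x + (- k) * n%:Z); rewrite // congDr congxx.
  by apply/hasP; exists (x + (- k) * n%:Z); rewrite // congDr congxx.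
have alE x : has (cong n x) al = ~~ has (cong n x) a.
  by apply/idP/idP => [h|/cover//]; apply/negP => /disj; rewrite h.
have revE x : has (cong n x) (rev al) = has (cong n x) al by rewrite has_rev.
exists (fun x => has (cong n x) a); split; last 2 first.
- by move=> x; rewrite XE.
- by move=> x; rewrite XiE -alE.
split=> [x k|x Xx|x Xx||].
- by apply: eq_has => b; rewrite congDl.
- have e : c x = pcycle n 1 a x by rewrite cE /= (@pcycle_out (-1)) // revE; exact: disj.
  have [h1 h2] := pcycle_succ sa ba Xx; rewrite e; split=> //.
  by apply: pcycle_res => //; exact: sorted_uniq lt_trans ltxx _ sa.
- have Xr : has (cong n x) (rev al) by rewrite revE alE.
  have ur : uniq (rev al) by rewrite rev_uniq.
  have Xp := pcycle_res (-1) ur bral Xr; rewrite revE alE in Xp.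
  have e : c x = pcycle n (-1) (rev al) x by rewrite cE /= (@pcycle_out 1).
  have sr : sorted >%R (rev al) by rewrite rev_sorted.
  have [h1 h2] := pcycle_pred sr bral Xr; rewrite e; split=> // y Xy.
  by apply: h2; rewrite revE alE.
- by exists (nth 0 a 0); rewrite -[nth 0 a 0]addr0 -(mul0r n%:Z) nth_res.
- by exists (nth 0 al 0); rewrite -alE -[nth 0 al 0]addr0 -(mul0r n%:Z) nth_res.
Qed.
End PeriodicCycle.

(** * One residue class in Xi *)

Lemma fixes_line n (v : affine_perm n) (f g : 'rV[algC]_n) :
  (rho v).+1 = n -> fixes v g -> g != 0 -> fixes v f -> exists a, f = a *: g.
Proof.
move=> vn vg g0 vf; apply/sub_rVP.
have sg : (g <= kermx (mx v - 1%:M))%MS by rewrite sub_kermx; apply/eqP/fixesE.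
have sf : (f <= kermx (mx v - 1%:M))%MS by rewrite sub_kermx; apply/eqP/fixesE.
apply: (submx_trans sf); have [_ <-] := mxrank_leqif_sup sg.
by rewrite rho_kernel rank_rV g0 -[X in (X - _)%N]vn subSnn.
Qed.

Section OneXi.
Variables (n : nat) (hn : (1 < n)%N) (c : affine_perm n) (X : int -> bool).
Hypothesis cX : cox_data c X.
Variable (alpha : int).
Hypothesis (Xalpha : ~~ X alpha) (Xi1 : forall y, ~~ X y -> cong n y alpha).
Implicit Types (x y z k l : int) (u v w : affine_perm n).

Local Notation rho := (@rho n).
Let np : 0 < n%:Z. Proof. by lia. Qed.
Let rn := rho_norm hn.

Lemma X_cong x : X x = ~~ cong n x alpha.
Proof.
apply/idP/idP => [Xx|]; last by apply: contraR => /Xi1.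
by apply/negP => /congP[k e]; move: Xx; rewrite e (cox_periodic cX) (negbTE Xalpha).
Qed.

Lemma ver_ncong x : X x -> ~~ cong n x alpha.
Proof. by rewrite X_cong. Qed.

Lemma cox_alpha k : c (alpha + k * n%:Z) = alpha + (k - 1) * n%:Z.
Proof.
suff ca : c alpha = alpha + (-1) * n%:Z by rewrite affineD ca; ring.
have [Xc lt h] := cox_down cX Xalpha.
have le := h (alpha + (-1) * n%:Z); rewrite (cox_periodic cX) in le.
have {le} le := le Xalpha (ltac:(lia)).
have /congP[l e] := Xi1 Xc; rewrite e in lt le *.
have : -1 <= l by rewrite -(lez_muln hn); lia.
have : l < 0 by rewrite -(ltz_muln hn); lia.
by move=> l1 l2; congr (_ + _ * _); lia.
Qed.

(* The element (x, y) c preserves the finite set of the points of X in [x, y[; gh x y is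
   its indicator, extended by f(z + n) = q f(z). Likewise (x, alpha) c is a single finite
   cycle on the points of X in [x, x + n[ together with alpha + n, whence gv x. *)
Definition gh x y z : algC :=
  if X z && (((z - x) %% n%:Z)%Z < y - x) then q ^ ((z - x) %/ n%:Z)%Z else 0.

Definition gv x z : algC :=
  if X z then q ^ ((z - x) %/ n%:Z)%Z else q ^ (((z - alpha) %/ n%:Z)%Z - 1).

Lemma shift_div x z k : ((z + k * n%:Z - x) %/ n%:Z)%Z = k + ((z - x) %/ n%:Z)%Z.
Proof. by rewrite addrAC addrC divzMDl //; lia. Qed.

Lemma gh_quasi x y : quasi n (gh x y).
Proof.
move=> z k; rewrite /gh (cox_periodic cX) shift_div addrAC addrC modzMDl.
by case: ifP; rewrite ?mulr0 ?qXD.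
Qed.

Lemma gv_quasi x : quasi n (gv x).
Proof.
move=> z k; rewrite /gv (cox_periodic cX) !shift_div -addrA.
by case: ifP; rewrite ?qXD.
Qed.

Lemma ghE x y z k : x + k * n%:Z <= z < x + (k + 1) * n%:Z ->
  gh x y z = if X z && (z < y + k * n%:Z) then q ^ k else 0.
Proof.
move=> zk; have dE := floorE hn zk; rewrite /gh /modz dE.
by congr (if _ && _ then _ else _); apply/idP/idP; lia.
Qed.

Lemma gvE x z k : X z -> x + k * n%:Z <= z < x + (k + 1) * n%:Z -> gv x z = q ^ k.
Proof. by move=> Xz zk; rewrite /gv Xz (floorE hn zk). Qed.

Lemma gv_alpha x k : gv x (alpha + k * n%:Z) = q ^ (k - 1).
Proof.
by rewrite /gv (cox_periodic cX) (negbTE Xalpha) shift_div subrr div0z addr0.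
Qed.

Lemma gh_alpha x y k : gh x y (alpha + k * n%:Z) = 0.
Proof. by rewrite /gh (cox_periodic cX) (negbTE Xalpha). Qed.

Definition ghr x y : 'rV[algC]_n := rowf n (gh x y).
Definition gvr x : 'rV[algC]_n := rowf n (gv x).

Lemma ghrE x y z : ev (ghr x y) z = gh x y z.
Proof. by rewrite rowfE //; exact: gh_quasi. Qed.

Lemma gvrE x z : ev (gvr x) z = gv x z.
Proof. by rewrite rowfE //; exact: gv_quasi. Qed.

(** Horizontal reflections join two points of X less than n apart, vertical ones a point of X and a
    translate of alpha. By [atom_class] nothing else divides c. *)
Definition is_hor x y := [/\ X x, X y & x < y < x + n%:Z].

Lemma hor_ncong x y : is_hor x y -> ~~ cong n x y.
Proof. by case=> _ _; exact: window_ncong. Qed.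

Lemma window_index z x k l : x + k * n%:Z < z <= x + (k + 1) * n%:Z -> z = x + l * n%:Z -> l = k + 1.
Proof.
move=> h e; have : k < l by rewrite -(ltz_muln hn); lia.
by have : l <= k + 1 by [rewrite -(lez_muln hn); lia]; lia.
Qed.

(** If c z is y + k n, it is sent back to x + k n; if it is x + (k + 1) n, it is sent on to y + (k +
    1) n. So no point enters or leaves the translates of [x, y[. *)
Lemma ghr_fixes x y : is_hor x y -> fixes (refl n x y * c)%g (ghr x y).
Proof.
move=> hxy; have xy := hor_ncong hxy; have [Xx Xy lxy] := hxy.
apply/(fixesP hn) => z; rewrite affine_permM !ghrE.
have Xs t k : X (t + k * n%:Z) = X t := cox_periodic cX t k.
have [Xz|Xz] := boolP (X z); last first.
  have /congP[k ->] := Xi1 Xz; rewrite cox_alpha refl_out ?gh_alpha // congDl cong_sym;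
  exact: ver_ncong.
have [k zk] := floor_ex hn x z; have zk' := zk; rewrite mulrDl mul1r in zk'.
have [Xc cz h] := cox_up cX Xz.
have c1 : c z <= x + (k + 1) * n%:Z by apply: h; rewrite ?Xs //; lia.
have c2 : z < y + k * n%:Z -> c z <= y + k * n%:Z by apply: h; rewrite Xs.
rewrite (ghE y zk) Xz /=; case: (reflP (c z) xy) => [l e|l e|cx cy].
- have l1 : l = k + 1 by apply: (window_index (z := c z) (x := x)) e; lia.
  rewrite l1 in e *; rewrite (ghE _ (k := k + 1)); last by rewrite !mulrDl !mul1r; lia.
  rewrite ltxx andbF; case: ifP => // /c2; rewrite e mulrDl; lia.
- have kl : l = k.
    have : k - 1 < l by rewrite -(ltz_muln hn) mulrBl; lia.
    have : l < k + 1 by rewrite -(ltz_muln hn); lia.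
    lia.
  rewrite kl in e *; rewrite (ghE _ (k := k)); last by rewrite mulrDl mul1r; lia.
  by rewrite Xs Xx /=; have -> : x + k * n%:Z < y + k * n%:Z by [lia]; have -> : z < y + k * n%:Z by lia.
- have cx' : c z != x + (k + 1) * n%:Z by apply: contraNneq cx => ->; rewrite congDl congxx.
  have cy' : c z != y + k * n%:Z by apply: contraNneq cy => ->; rewrite congDl congxx.
  rewrite (ghE _ (k := k)); last lia.
  rewrite Xc /=; congr (if _ then _ else _); apply/idP/idP => [|/c2]; lia.
Qed.

Lemma ghr_x x y : is_hor x y -> ev (ghr x y) x = 1.
Proof.
case=> Xx Xy lxy; rewrite ghrE (ghE _ (k := 0)); last by rewrite mulrDl; lia.
by rewrite Xx mul0r addr0; have -> : x < y by lia.
Qed.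

Lemma ghr_neq0 x y : is_hor x y -> ghr x y != 0.
Proof.
move/ghr_x => h; apply/eqP => g0; move: h; rewrite g0 ev0 => /esym/eqP.
by rewrite oner_eq0.
Qed.

Lemma gvr_fixes x : X x -> fixes (refl n x alpha * c)%g (gvr x).
Proof.
move=> Xx; have xa := ver_ncong Xx.
apply/(fixesP hn) => z; rewrite affine_permM !gvrE.
have Xs t k : X (t + k * n%:Z) = X t := cox_periodic cX t k.
have [Xz|Xz] := boolP (X z); last first.
  have /congP[k ->] := Xi1 Xz; rewrite cox_alpha refl_r // gv_alpha.
  by rewrite (gvE (k := k - 1)) ?Xs // subrK mulrBl; lia.
have [k zk] := floor_ex hn x z; have zk' := zk; rewrite mulrDl mul1r in zk'.
have [Xc cz h] := cox_up cX Xz.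
have c1 : c z <= x + (k + 1) * n%:Z by apply: h; rewrite ?Xs //; lia.
rewrite (gvE Xz zk); case: (reflP (c z) xa) => [l e|l e|cx cy].
- have l1 : l = k + 1 by apply: (window_index (z := c z) (x := x)) e; lia.
  by rewrite l1 gv_alpha addrK.
- by move: Xc; rewrite e Xs (negbTE Xalpha).
- have cx' : c z != x + (k + 1) * n%:Z by apply: contraNneq cx => ->; rewrite congDl congxx.
  by rewrite (gvE (k := k)) //; lia.
Qed.

Lemma gv_neq0 x z : gv x z != 0.
Proof. by rewrite /gv; case: ifP; rewrite qX_neq0. Qed.

Lemma gvr_neq0 x : gvr x != 0.
Proof. by apply/eqP => g0; have := gv_neq0 x 0; rewrite -gvrE g0 ev0 eqxx. Qed.

(** The vector g certifies that (a, b) divides c, since it bounds the [rho] of (a, b) c by n - 1. It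
    spans the fixed line, and later conditions are tested on it. *)
Definition atom a b (g : 'rV[algC]_n) :=
  [/\ ~~ cong n a b, g != 0 & fixes (refl n a b * c)%g g].

Lemma hor_atom x y : is_hor x y -> atom x y (ghr x y).
Proof. by move=> h; split; [exact: hor_ncong | exact: ghr_neq0 | exact: ghr_fixes]. Qed.

Lemma ver_atom x : X x -> atom x alpha (gvr x).
Proof. by move=> h; split; [exact: ver_ncong | exact: gvr_neq0 | exact: gvr_fixes]. Qed.

Lemma atom_nle a b g : atom a b g -> nle rho (refl n a b) c.
Proof.
case=> ab g0 fg; apply: nleP => //; rewrite (rho_refl1 hn) // reflV // (rho_cox hn cX).
exact: rho_defect fg g0.
Qed.

Lemma atom_line a b g f : atom a b g -> fixes (refl n a b * c)%g f -> exists e, f = e *: g.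
Proof.
move=> abg ff; have [ab g0 fg] := abg; apply: fixes_line fg g0 ff.
by have := atom_nle abg; rewrite /nle (rho_refl1 hn ab) reflV // (rho_cox hn cX) add1n.
Qed.

Lemma refl_quot a b v : ~~ cong n a b -> nle rho (refl n a b) c -> nle rho v c ->
    fixsub v (refl n a b) ->
  [/\ nle rho (refl n a b * v)%g c, (rho (refl n a b * v)%g).+1 = rho v
    & fixsub (refl n a b * c)%g (refl n a b * v)%g].
Proof.
move=> ab rc vc vr; have rv := fixsub_nle hn (rho_cox hn cX) rc vc vr.
have := nle_quot_top rn rv vc; have := nle_fixsub hn (nle_quot rn rv vc).
by move: (rv); rewrite /nle !reflV // (rho_refl1 hn) // add1n.
Qed.

Lemma refl_unmul a b v f : ~~ cong n a b -> fixes (refl n a b * v)%g f ->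
  ev f a = ev f b -> fixes v f.
Proof.
move=> ab fv fab; have -> : v = (refl n a b * (refl n a b * v))%g by rewrite mulgA reflK ?mul1g.
by apply: fixesM => //; apply/fixes_refl.
Qed.

(** Being fixed is constancy along orbits, so pointwise operations preserve it, linear or not, as
    long as they commute with multiplication by powers of q. *)
Lemma fixes_comb v f g (phi : algC -> algC -> algC) :
    (forall k s t, phi (q ^ k * s) (q ^ k * t) = q ^ k * phi s t) ->
    fixes v f -> fixes v g ->
  exists2 h, fixes v h & forall z, ev h z = phi (ev f z) (ev g z).
Proof.
move=> phiH /(fixesP hn) fv /(fixesP hn) gv'.
have hE z : ev (rowf n (fun z => phi (ev f z) (ev g z))) z = phi (ev f z) (ev g z).
  by rewrite rowfE // => x k; rewrite !evM.
exists (rowf n (fun z => phi (ev f z) (ev g z))) => //.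
by apply/(fixesP hn) => z; rewrite !hE fv gv'.
Qed.

(** The cofactor (x, alpha) v lies below (x, alpha) c and so fixes [gvr x], which vanishes nowhere;
    hence [lR_elliptic] applies to the cofactor. *)
Lemma ver_elliptic v x : nle rho v c -> X x -> fixsub v (refl n x alpha) ->
  (lR v <= rho v)%N.
Proof.
move=> vc Xx vr; have xa := ver_ncong Xx.
have [_ <- fs] := refl_quot xa (atom_nle (ver_atom Xx)) vc vr.
have nv z : ~ vanish (refl n x alpha * v)%g z.
  move=> /(_ _ (fs _ (gvr_fixes Xx))) /eqP; rewrite gvrE.
  by rewrite (negbTE (gv_neq0 x z)).
apply: leq_trans (_ : ((lR (refl n x alpha * v)%g).+1 <= _)%N); last by rewrite ltnS lR_elliptic.
have {1}-> : v = (refl n x alpha * (refl n x alpha * v))%g by rewrite mulgA reflK ?mul1g.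
by apply: leq_trans (normM (lR_norm hn) _ _) _; rewrite lR_refl.
Qed.

Lemma vanish_X v x : ~ vanish v alpha -> vanish v x -> X x.
Proof.
move=> va vx; apply/negPn/negP => /Xi1 xa; apply: va; exact: vanish_cong xa vx.
Qed.

Lemma ghr_out x y p : is_hor x y -> y <= p < x + n%:Z -> ev (ghr x y) p = 0.
Proof.
move=> [_ _ lxy] h; rewrite ghrE (ghE _ (k := 0)); last by rewrite add0r mul1r mul0r; lia.
by rewrite mul0r addr0; case: ifP => // /andP[_]; lia.
Qed.

Lemma ghr_out' x y p : is_hor x y -> y - n%:Z <= p < x -> ev (ghr x y) p = 0.
Proof.
move=> [_ _ lxy] h; rewrite ghrE (ghE _ (k := -1)); last by rewrite addNr mul0r mulN1r; lia.
by rewrite mulN1r; case: ifP => // /andP[_]; lia.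
Qed.

Lemma ghr_in x y p : X p -> x <= p < y -> y < x + n%:Z -> ev (ghr x y) p = 1.
Proof.
move=> Xp h1 h2; rewrite ghrE (ghE _ (k := 0)); last by rewrite add0r mul1r mul0r; lia.
by rewrite Xp mul0r addr0; have -> : p < y by lia.
Qed.

Lemma ghr_1 x y p : is_hor x y -> ev (ghr x y) p = 1 -> X p /\ x <= p < y.
Proof.
move=> hxy; have [k pk] := floor_ex hn x p; rewrite ghrE (ghE _ pk).
case: ifP => [/andP[Xp lp] /q_inf k0|_ /esym/eqP]; last by rewrite oner_eq0.
by rewrite k0 mul0r !addr0 in pk lp; split=> //; lia.
Qed.

Lemma ghr_alpha x y k : ev (ghr x y) (alpha + k * n%:Z) = 0.
Proof. by rewrite ghrE gh_alpha. Qed.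

Lemma ghr_alpha0 x y : ev (ghr x y) alpha = 0.
Proof. by rewrite -[alpha]addr0 -(mul0r n%:Z) ghr_alpha. Qed.

(* Otherwise two points x, y' of X lie on infinite orbits of v while, by induction, all
   orbits of (x, y') v are finite; a combination of their indicators taking the value 1 at
   both x and y' is then fixed by v, a contradiction. *)
Lemma vanish_alpha v x : nle rho v c -> vanish v x -> vanish v alpha.
Proof.
elim/ltn_ind: (rho v) {-2}v (erefl (rho v)) x => m IH {}v vm x vc vx.
apply: contrapT => va; have Xx := vanish_X va vx.
have [y yx vy] := vanish_other hn vx.
have [k k1 k2] := cong_window hn yx; set y' := y + k * n%:Z in k1 k2.
have vy' : vanish v y' by apply/(vanishD hn).
have hxy : is_hor x y' by split; [|exact: vanish_X va vy'|rewrite k1].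
have xy := hor_ncong hxy.
have vr : fixsub v (refl n x y').
  by apply/(fixsub_refl hn) => // f fv; rewrite vx // vy'.
have [rvc lt fs] := refl_quot xy (atom_nle (hor_atom hxy)) vc vr.
have s2 := fixsub_mul hn vr.
have : ~ vanish (refl n x y' * v)%g y'.
  move=> h; apply: va; apply: vanish_fixsub s2 _.
  by apply: (IH _ _ _ erefl y'); rewrite // -vm -lt.
move=> /existsNP[f /not_implyP[ff fy]].
(* h agrees with f on the zeros of [ghr x y'], in particular at y', and is 0 elsewhere, in
   particular at x. *)
have [k' s t|h fh hE] := fixes_comb (phi := fun s t => if t == 0 then s else 0) _
    ff (fs _ (ghr_fixes hxy)).
  by rewrite mulf_eq0 (negbTE (qX_neq0 k')) /=; case: ifP; rewrite ?mulr0.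
have gx := ghr_x hxy.
have gy : ev (ghr x y') y' = 0 by apply: ghr_out => //; lia.
have fF : fixes (refl n x y' * v)%g (ghr x y' + (ev f y')^-1 *: h).
  rewrite /fixes mulmxDl -scalemxAl; have := fs _ (ghr_fixes hxy); rewrite /fixes => ->.
  by rewrite fh.
have Fx : ev (ghr x y' + (ev f y')^-1 *: h) x = 1.
  by rewrite evD evZ hE gx oner_eq0 mulr0 addr0.
have Fy : ev (ghr x y' + (ev f y')^-1 *: h) y' = 1.
  by rewrite evD evZ hE gy eqxx add0r mulVf //; apply/eqP.
have := vx _ (refl_unmul xy fF (etrans Fx (esym Fy))); rewrite Fx => /eqP.
by rewrite oner_eq0.
Qed.

(** If v has an infinite orbit, fixed functions vanish at alpha and at some z in X, so (z, alpha)
    divides v and [ver_elliptic] applies; otherwise [lR_elliptic] does. *)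
Lemma nle_rho_lR v : nle rho v c -> lR v = rho v.
Proof.
move=> vc; apply/eqP; rewrite eqn_leq rho_lR // andbT.
have [[x vx]|nv] := pselect (exists x, vanish v x); last first.
  by apply: lR_elliptic => // x vx; apply: nv; exists x.
have va := vanish_alpha vc vx; have [z za vz] := vanish_other hn va.
have Xz : X z by rewrite X_cong.
by apply: (ver_elliptic vc Xz); apply/(fixsub_refl hn) => // f fv; rewrite va // vz.
Qed.

Lemma nle_lR_c v : nle (@lR n) v c <-> nle rho v c.
Proof.
have lc := nle_rho_lR (nle_refl rn c).
split=> vc; last first.
  by rewrite /nle lc (nle_rho_lR vc) (nle_rho_lR (nle_compl rn vc)).
apply: nleP => //; rewrite -lc -vc; apply: leq_add; exact: rho_lR.
Qed.

Lemma nle_lR v w : nle rho w c -> nle (@lR n) v w <-> nle rho v w.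
Proof.
move=> wc; split=> vw.
  have vc : nle rho v c by apply/nle_lR_c; apply: (nle_trans (lR_norm hn)) vw _; apply/nle_lR_c.
  have vwc : nle rho (v^-1 * w)%g c.
    by apply/nle_lR_c; apply: (nle_quot_top (lR_norm hn)) vw _; apply/nle_lR_c.
  by move: vw; rewrite /nle (nle_rho_lR vc) (nle_rho_lR wc) (nle_rho_lR vwc).
have vc := nle_trans rn vw wc; have vwc := nle_quot_top rn vw wc.
by rewrite /nle (nle_rho_lR vc) (nle_rho_lR wc) (nle_rho_lR vwc).
Qed.

(* As (t c) has a one-dimensional fixed space, spanned by g, the divisibility of c by t t'
   amounts to g being fixed by t'; a product of reflections is controlled pairwise. *)
Fixpoint chain (ts : seq (int * int * 'rV[algC]_n)) : Prop :=
  if ts is t :: ts' then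
    [/\ atom t.1.1 t.1.2 t.2,
        forall t', t' \in ts' -> ev t.2 t'.1.1 = ev t.2 t'.1.2
      & chain ts']
  else True.

Lemma chain_prod ts : chain ts -> exists2 w, nle rho w c &
  forall f, fixes w f <-> (forall t, t \in ts -> ev f t.1.1 = ev f t.1.2).
Proof.
elim: ts => [_|[[a b] g] ts IH /= [abg cg /IH[w wc wE]]].
  exists 1%g; first exact: nle1.
  by move=> f; split=> // _; rewrite /fixes mx1 // mulmx1.
have [ab g0 fg] := abg; have rc := atom_nle abg.
have rcc : nle rho (refl n a b * c)%g c by have := nle_compl rn rc; rewrite reflV.
have wrc : nle rho w (refl n a b * c)%g.
  apply: (fixsub_nle hn (rho_cox hn cX)) => // f /(atom_line abg)[e ->].
  by apply/wE => t /cg; rewrite !evZ => ->.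
have [|e1 e2 e3] := nle_mul rn rc (y := w); first by rewrite reflV.
exists (refl n a b * w)%g => // f; split=> [fr t|h].
  rewrite inE => /orP[/eqP->|] /=.
    by apply/(fixes_refl hn f ab); apply: (nle_fixsub hn e2).
  by apply: (wE f).1; apply: (nle_fixsub hn (nle_mull rn e1)).
apply: fixesM => //; first by apply/(fixes_refl hn f ab); apply: (h (a, b, g)); rewrite mem_head.
by apply/wE => t tts; apply: h; rewrite inE tts orbT.
Qed.

(** * Joins of two reflections below c *)

Local Notation has_join := (join_below rho c).

Lemma fixsub_join r1 r2 j : nle rho r1 c -> nle rho r2 c -> nle rho j c ->
    (forall f, fixes j f -> fixes r1 f /\ fixes r2 f) ->
    (forall u, nle rho u c -> fixsub u r1 -> fixsub u r2 -> fixsub u j) ->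
  has_join r1 r2.
Proof.
move=> r1c r2c jc jr h; have cn := rho_cox hn cX; exists j; split=> //.
- by apply: (fixsub_nle hn cn) => // f /jr[].
- by apply: (fixsub_nle hn cn) => // f /jr[].
- move=> u uc r1u r2u; apply: (fixsub_nle hn cn) => //; apply: h => //; exact: (nle_fixsub hn).
Qed.

(** A product of reflections whose fixed space is cut out by such equalities lies below every common
    upper bound. *)
Definition forced a b a' b' p p' := forall u, nle rho u c ->
  fixsub u (refl n a b) -> fixsub u (refl n a' b') ->
  forall f, fixes u f -> ev f p = ev f p'.

Lemma chain_join a b g a' b' g' ts : atom a b g -> atom a' b' g' -> chain ts ->
    (forall f : 'rV_n, (forall t, t \in ts -> ev f t.1.1 = ev f t.1.2) ->
       ev f a = ev f b /\ ev f a' = ev f b') ->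
    (forall t, t \in ts -> forced a b a' b' t.1.1 t.1.2) ->
  has_join (refl n a b) (refl n a' b').
Proof.
move=> ab ab' /chain_prod[j jc jE] h1 h2; have [nab _ _] := ab; have [nab' _ _] := ab'.
apply: (fixsub_join (atom_nle ab) (atom_nle ab') jc).
  by move=> f /jE/h1[e1 e2]; split; apply/fixes_refl.
move=> u uc u1 u2 f fu; apply/jE => t /h2/(_ u uc u1 u2 f fu); exact.
Qed.

(* h is the indicator of the set where f is proportional to g with the same factor as
   at z. *)
Lemma indicator u a b g f z : nle rho u c -> atom a b g -> fixsub u (refl n a b) ->
    fixes u f ->
    (ev g a = 0 \/ ev f a * ev g z <> ev f z * ev g a) ->
    (ev g b = 0 \/ ev f b * ev g z <> ev f z * ev g b) ->
  exists2 h, fixes u h & forall y, ev h y =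
    if (ev f y * ev g z == ev f z * ev g y) then ev g y else 0.
Proof.
move=> uc abg ur fu ha hb; have [ab g0 fg] := abg.
have [_ _ fs] := refl_quot ab (atom_nle abg) uc ur.
have [k s t|h fh hE] := fixes_comb (phi := fun s t => if s * ev g z == ev f z * t then t else 0)
  _ (fixsub_mul hn ur fu) (fs _ fg).
  rewrite -mulrA (mulrCA _ (q ^ k)) (inj_eq (mulfI (qX_neq0 k))).
  by case: ifP => //; rewrite mulr0.
(* By hypothesis h vanishes at a and at b, so it is fixed by (a, b) as well as by (a, b) u. *)
exists h => //; apply: (refl_unmul ab fh); rewrite !hE.
have e0 p : (ev g p = 0 \/ ev f p * ev g z <> ev f z * ev g p) ->
    (if ev f p * ev g z == ev f z * ev g p then ev g p else 0) = 0.
  by case=> [->|/eqP/negbTE->]; rewrite ?if_same.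
by rewrite !e0.
Qed.

(** If f(z) <> f(x), the indicator of the points of X in [x, y[ where f takes the value f(z) is
    fixed by u. It is 1 at z but not at p, although functions fixed by u agree at z and p. *)
Lemma hor_cross u x y z p : nle rho u c -> is_hor x y -> fixsub u (refl n x y) ->
    X z -> x < z < y -> ~ (X p /\ x <= p < y) ->
    (forall f, fixes u f -> ev f z = ev f p) ->
  forall f, fixes u f -> ev f z = ev f x.
Proof.
move=> uc hxy ur Xz xzy hp fzp f fu; apply: contrapT => fzx.
have [_ _ lxy] := hxy.
have gz : ev (ghr x y) z = 1 by apply: ghr_in => //; lia.
have [||h fh hE] := indicator (z := z) uc (hor_atom hxy) ur fu.
- by right; rewrite gz ghr_x // !mulr1 => /esym.
- by left; apply: ghr_out => //; lia.
have := fzp _ fh; rewrite !hE eqxx gz; case: ifP => _; last by move/eqP; rewrite oner_eq0.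
by move/esym/(ghr_1 hxy).
Qed.

Lemma gvr_window x p k : X p -> x + k * n%:Z <= p < x + (k + 1) * n%:Z -> ev (gvr x) p = q ^ k.
Proof. by move=> Xp h; rewrite gvrE (gvE Xp h). Qed.

Lemma gvr_alpha x : ev (gvr x) alpha = q ^ (-1).
Proof. by rewrite gvrE -[alpha]addr0 -(mul0r n%:Z) gv_alpha. Qed.

(** At x, y and alpha the function [gvr x] takes the values 1, q^k with k > 0, and q^(-1), while f
    takes a single value. If this is nonzero, [indicator] at y yields a function fixed by u, nonzero
    at y and zero at alpha. *)
Lemma ver_far u x y : nle rho u c -> X x -> X y -> x + n%:Z <= y ->
    fixsub u (refl n x alpha) -> fixsub u (refl n y alpha) ->
  vanish u y.
Proof.
move=> uc Xx Xy xy ux uy f fu; apply: contrapT => fy.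
have fxa := (fixsub_refl hn u (ver_ncong Xx)).1 ux.
have fya := (fixsub_refl hn u (ver_ncong Xy)).1 uy.
have [k yk] := floor_ex hn x y; have gy := gvr_window Xy yk.
have k0 : 0 < k.
  by have : 0 < k by [have : 1 * n%:Z < (k + 1) * n%:Z by [lia]; rewrite ltz_muln //; lia].
have gx : ev (gvr x) x = q ^ 0 by apply: gvr_window => //; rewrite mulrDl mul0r mul1r; lia.
have cancel l : l != k -> ev f y * q ^ k <> ev f y * q ^ l.
  by move=> lk; move/eqP: fy => /mulfI h /h/qX_inj e; rewrite e eqxx in lk.
have [||h fh hE] := indicator (z := y) uc (ver_atom Xx) ux fu.
- right; rewrite gx gy fxa // -fya //; apply: cancel; lia.
- right; rewrite gvr_alpha gy -fya //; apply: cancel; lia.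
have := fya _ fh; rewrite -fxa // !hE eqxx gy gx fxa // -fya //.
case: eqP => [/cancel|_ /eqP]; last by rewrite (negbTE (qX_neq0 k)).
by case; lia.
Qed.

(** [gvr p] takes the value q^(-1) at alpha and at all points of X in [p - n, p[; hence the
    decreasing order and the window. *)
Lemma vertical_chain (S : seq int) : (forall p, p \in S -> X p) ->
    pairwise (fun p p' => (p' < p) && (p - n%:Z <= p')) S ->
  chain [seq (p, alpha, gvr p) | p <- S].
Proof.
elim: S => //= p S IH SX /andP[/allP pS Sp]; split.
- by apply: ver_atom; apply: SX; rewrite mem_head.
- move=> t /mapP[p' p'S ->] /=; have /andP[h1 h2] := pS p' p'S.
  rewrite gvr_alpha (gvr_window (k := -1)) //; last by rewrite addNr mul0r mulN1r; lia.
  by apply: SX; rewrite inE p'S orbT.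
- by apply: IH => // p' p'S; apply: SX; rewrite inE p'S orbT.
Qed.

(** Imposing f = f(alpha) at the translates of L in [x0, x0 + n], both ends included, gives f(alpha)
    = q f(alpha), so all these values vanish. *)
Lemma hyperbolic_elt (L : seq int) : L != [::] -> (forall x, x \in L -> X x) ->
  exists2 w, nle rho w c &
  forall f, fixes w f <-> ev f alpha = 0 /\ (forall x, x \in L -> ev f x = 0).
Proof.
case: L => // x0 L _; move: (x0 :: L) (mem_head x0 L) => {}L x0L LX.
(* Listed decreasingly, as [vertical_chain] requires; n + 1 entries, to contain both x0 + n and
   x0. *)
set S := [seq p <- [seq x0 + n%:Z - i%:Z | i <- iota 0 n.+1] | has (cong n p) L].
have memS p : x0 <= p <= x0 + n%:Z -> (exists2 x, x \in L & cong n p x) -> p \in S.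
  move=> h hL; rewrite mem_filter; apply/andP; split; first exact/hasP.
  by apply/mapP; exists `|(x0 + n%:Z - p)%R|%N; [rewrite mem_iota; lia | lia].
have SX p : p \in S -> X p.
  rewrite mem_filter => /andP[/hasP[x xL /congP[k ->]] _].
  by rewrite (cox_periodic cX) LX.
have Sp : pairwise (fun p p' => (p' < p) && (p - n%:Z <= p')) S.
  apply: pairwise_filter; rewrite pairwise_map.
  have := iota_ltn_sorted 0 n.+1; rewrite (sorted_pairwise ltn_trans) => ltP.
  have : all (gtn n.+1) (iota 0 n.+1) by apply/allP => i; rewrite mem_iota.
  move: ltP; elim: (iota _ _) => //= i s IH /andP[/allP is_ ss] /andP[ni /allP ns].
  rewrite IH ?andbT //; last exact/allP.
  by apply/allP => j js; have := is_ _ js; have := ns _ js => /=; lia.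
have [w wc wE] := chain_prod (vertical_chain SX Sp); exists w => // f.
have {wE} wE : fixes w f <-> forall p, p \in S -> ev f p = ev f alpha.
  split=> [/wE h p pS|h]; first by apply: (h (p, alpha, gvr p)); exact: map_f.
  by apply/wE => t /mapP[p pS ->] /=; exact: h.
split=> [/wE h|[fa fL]]; last first.
  apply/wE => p; rewrite mem_filter => /andP[/hasP[x xL /congP[k ->]] _].
  by rewrite evM // fa fL // mulr0.
have fa : ev f alpha = 0.
  have h0 : ev f x0 = ev f alpha by apply/h/memS; [lia | exists x0; rewrite ?congxx].
  have h1 : ev f (x0 + 1 * n%:Z) = ev f alpha.
    by apply/h/memS; [rewrite mul1r; lia | exists x0 => //; rewrite congDl congxx].
  by apply: (qX_fix (k := 1)) => //; rewrite -{2}h0 -evM // h1.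
split=> // x xL; have [k xk] := floor_ex hn x0 x.
have := h (x + (- k) * n%:Z); rewrite evM // fa.
have /memS -> : x0 <= x + (- k) * n%:Z <= x0 + n%:Z by rewrite mulNr; rewrite mulrDl in xk; lia.
  by move/(_ erefl)/eqP; rewrite mulf_eq0 (negbTE (qX_neq0 _)) => /eqP.
by exists x => //; rewrite congDl congxx.
Qed.

Lemma hyper_join a b g a' b' g' (L : seq int) : atom a b g -> atom a' b' g' ->
    L != [::] -> (forall x, x \in L -> X x) ->
    (forall f : 'rV_n, ev f alpha = 0 -> (forall x, x \in L -> ev f x = 0) ->
       ev f a = ev f b /\ ev f a' = ev f b') ->
    (forall u, nle rho u c -> fixsub u (refl n a b) -> fixsub u (refl n a' b') ->
       forall x, x \in L -> vanish u x) ->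
  has_join (refl n a b) (refl n a' b').
Proof.
move=> ab ab' L0 LX h1 h2; have [j jc jE] := hyperbolic_elt L0 LX.
have [nab _ _] := ab; have [nab' _ _] := ab'.
apply: (fixsub_join (atom_nle ab) (atom_nle ab') jc) => [f /jE[fa fL]|u uc u1 u2 f fu].
  by have [e1 e2] := h1 f fa fL; split; apply/fixes_refl.
have uL := h2 u uc u1 u2; apply/jE; split=> [|x xL]; last exact: uL.
have [x xL] : exists x, x \in L by case: (L) L0 => // x L' _; exists x; rewrite mem_head.
exact: (vanish_alpha uc (uL x xL)).
Qed.

Lemma forcedL a b a' b' : ~~ cong n a b -> forced a b a' b' a b.
Proof. by move=> ab u _ /(fixsub_refl hn u ab). Qed.

Lemma forcedR a b a' b' : ~~ cong n a' b' -> forced a b a' b' a' b'.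
Proof. by move=> ab u _ _ /(fixsub_refl hn u ab). Qed.

(** As (a', b') fixes g, the product (a, b)(a', b') divides c, and the two given equalities alone
    cut out its fixed space. *)
Lemma pair_join a b g a' b' g' : atom a b g -> atom a' b' g' -> ev g a' = ev g b' ->
  has_join (refl n a b) (refl n a' b').
Proof.
move=> ab ab' e; have [nab _ _] := ab; have [nab' _ _] := ab'.
apply: (chain_join (ts := [:: (a, b, g); (a', b', g')]) ab ab') => /=.
- by split=> // t; rewrite inE => /eqP->.
- move=> f h; split; first by apply: (h (a, b, g)); rewrite mem_head.
  by apply: (h (a', b', g')); rewrite !inE eqxx orbT.
- move=> t; rewrite !inE => /orP[/eqP->|/eqP->] /=; [exact: forcedL | exact: forcedR].
Qed.

Lemma refl_join a b g : atom a b g -> has_join (refl n a b) (refl n a b).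
Proof. by move=> ab; exists (refl n a b); split=> //; [exact: atom_nle ab|exact: nle_refl|exact: nle_refl]. Qed.

Lemma hor_shift x y k : is_hor x y -> is_hor (x + k * n%:Z) (y + k * n%:Z).
Proof. by case=> Xx Xy xy; split; rewrite ?(cox_periodic cX) //; lia. Qed.

Lemma hor_join_same x y p : is_hor x y -> is_hor x p -> p < y ->
  has_join (refl n x y) (refl n x p).
Proof.
move=> hxy hxp py; apply: (pair_join (hor_atom hxy) (hor_atom hxp)).
have [Xx _ lxy] := hxy; have [_ Xp lxp] := hxp.
by rewrite !ghr_in //; lia.
Qed.

(** For p <= y a product of the two is the join. For y < p < x + n the chords cross, and [hor_cross]
    forces the four values to agree. For p >= x + n they must also vanish. *)
Lemma hor_join_inner x y z p : is_hor x y -> is_hor z p -> x < z < y ->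
  has_join (refl n x y) (refl n z p).
Proof.
move=> hxy hzp zi; have [Xx Xy lxy] := hxy; have [Xz Xp lzp] := hzp.
have nxy := hor_ncong hxy; have nzp := hor_ncong hzp.
have cross u : nle rho u c -> fixsub u (refl n x y) -> fixsub u (refl n z p) ->
    y < p -> forall f, fixes u f -> ev f z = ev f x.
  move=> uc u1 u2 yp f fu; apply: (hor_cross uc hxy u1 Xz zi (p := p)) => //; first by case; lia.
  exact: (fixsub_refl hn u nzp).1 u2.
have [py|yp|py] := ltgtP p y.
- apply: (pair_join (hor_atom hxy) (hor_atom hzp)).
  by rewrite !ghr_in //; lia.
- have [px|xp] := ltP p (x + n%:Z).
    have hxp : is_hor x p by split=> //; lia.
    have hxz : is_hor x z by split=> //; lia.
    apply: (chain_join (ts := [:: (x, p, ghr x p); (x, y, ghr x y); (x, z, ghr x z)])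
      (hor_atom hxy) (hor_atom hzp)).
    + split; [exact: hor_atom | | split; [exact: hor_atom | | split => //; exact: hor_atom]].
        by move=> t; rewrite !inE => /orP[/eqP->|/eqP->] /=; rewrite !ghr_in //; lia.
      by move=> t; rewrite !inE => /eqP-> /=; rewrite !ghr_in //; lia.
    + move=> f h; have e1 := h (x, p, ghr x p) (mem_head _ _).
      have e2 : ev f x = ev f y by apply: (h (x, y, ghr x y)); rewrite !inE eqxx orbT.
      have e3 : ev f x = ev f z by apply: (h (x, z, ghr x z)); rewrite !inE eqxx !orbT.
      by split=> //; rewrite -e3.
    + move=> t; rewrite !inE => /orP[/eqP->|/orP[/eqP->|/eqP->]] u uc u1 u2 f fu /=.
      * by rewrite -(cross u uc u1 u2 yp f fu); exact: (fixsub_refl hn u nzp).1 u2 f fu.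
      * exact: (fixsub_refl hn u nxy).1 u1 f fu.
      * by rewrite (cross u uc u1 u2 yp f fu).
  apply: (hyper_join (L := [:: x; y; z; p]) (hor_atom hxy) (hor_atom hzp)) => //.
  + by move=> t; rewrite !inE => /or4P[]/eqP->.
  + by move=> f _ h; rewrite !h ?inE ?eqxx ?orbT.
  move=> u uc u1 u2; have fxy := (fixsub_refl hn u nxy).1 u1.
  have fzp := (fixsub_refl hn u nzp).1 u2.
  suff fx f : fixes u f -> ev f x = 0.
    move=> t; rewrite !inE => /or4P[]/eqP-> f fu; rewrite ?(cross u) -?fxy -?fzp ?(cross u) //; exact: fx.
  move=> fu; have fz := cross u uc u1 u2 yp f fu.
  (* For p > x + n, [hor_cross] at p - n gives f(p) = q f(x), whereas f(p) = f(z) = f(x). *)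
  have [xp'|xp'|e] := ltgtP (x + n%:Z) p; last 1 first.
  + have : ev f p = q ^ 1 * ev f x by rewrite -evM // mul1r e.
    by rewrite -fzp // fz => /qX_fix; apply.
  + have : ev f (p + (-1) * n%:Z) = ev f x.
      apply: (hor_cross uc hxy u1 _ _ (p := z + (-1) * n%:Z)) => //.
      * by rewrite (cox_periodic cX).
      * lia.
      * by case; lia.
      * by move=> g gu; rewrite !evM // fzp.
    by rewrite evM // -fzp // fz => /esym/qX_fix; apply.
  + lia.
- apply: join_belowC; rewrite py in hzp *; apply: (pair_join (hor_atom hzp) (hor_atom hxy)).
  rewrite ghr_out' //; last lia.
  by rewrite ghr_out //; lia.
Qed.

Lemma hor_join_window x y z p : is_hor x y -> is_hor z p -> x <= z < x + n%:Z ->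
  has_join (refl n x y) (refl n z p).
Proof.
move=> hxy hzp zi; have [Xx Xy lxy] := hxy; have [Xz Xp lzp] := hzp.
have nxy := hor_ncong hxy; have nzp := hor_ncong hzp.
have [xz|zx|e] := ltgtP x z; [|lia|]; last first.
  subst z; have [py|yp|->] := ltgtP p y.
  - exact: hor_join_same.
  - by apply: join_belowC; exact: hor_join_same.
  - exact: refl_join (hor_atom hxy).
have [zy|yz|e] := ltgtP z y.
- by apply: hor_join_inner => //; rewrite xz.
- have [px|xp|e] := ltgtP p (x + n%:Z).
  + apply: (pair_join (hor_atom hxy) (hor_atom hzp)).
    by rewrite !ghr_out //; lia.
  (* The translate x + n lies between z and p: the inner case with the roles exchanged. *)
  + rewrite -(refl_shift 1 nxy); apply: join_belowC.
    by apply: hor_join_inner => //; [exact: hor_shift | lia].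
  + apply: join_belowC; apply: (pair_join (hor_atom hzp) (hor_atom hxy)).
    by rewrite !ghr_out' //; lia.
subst z; have [px|xp] := ltP p (x + n%:Z).
  apply: (pair_join (hor_atom hxy) (hor_atom hzp)).
  by rewrite !ghr_out //; lia.
apply: (hyper_join (L := [:: x; y; p]) (hor_atom hxy) (hor_atom hzp)) => //.
- by move=> t; rewrite !inE => /or3P[]/eqP->.
- by move=> f _ h; rewrite !h ?inE ?eqxx ?orbT.
move=> u uc u1 u2; have fxy := (fixsub_refl hn u nxy).1 u1.
have fyp := (fixsub_refl hn u nzp).1 u2.
suff fx f : fixes u f -> ev f x = 0.
  move=> t; rewrite !inE => /or3P[]/eqP-> f fu; rewrite -?fyp -?fxy //; exact: fx.
move=> fu; have [xp'|xp'|e] := ltgtP (x + n%:Z) p; last 1 first.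
- have : ev f p = q ^ 1 * ev f x by rewrite -evM // mul1r e.
  by rewrite -fyp // -fxy // => /qX_fix; apply.
- have : ev f (p + (-1) * n%:Z) = ev f x.
    apply: (hor_cross uc hxy u1 _ _ (p := y + (-1) * n%:Z)) => //.
    + by rewrite (cox_periodic cX).
    + lia.
    + by case; lia.
    + by move=> g gu; rewrite !evM // fyp.
  by rewrite evM // -fyp // -fxy // => /esym/qX_fix; apply.
- lia.
Qed.

Lemma window_rep x z : exists k, x <= z + k * n%:Z < x + n%:Z.
Proof.
have [k h] := floor_ex hn x z; exists (- k); rewrite mulNr; rewrite mulrDl in h; lia.
Qed.

Lemma hor_join x y z p : is_hor x y -> is_hor z p ->
  has_join (refl n x y) (refl n z p).
Proof.
move=> hxy hzp; have [k zk] := window_rep x z.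
rewrite -(refl_shift k (hor_ncong hzp)).
by apply: hor_join_window => //; exact: hor_shift.
Qed.

Lemma vertical_join a b g a' b' g' (S : seq int) : atom a b g -> atom a' b' g' ->
    (forall p, p \in S -> X p) ->
    pairwise (fun p p' => (p' < p) && (p - n%:Z <= p')) S ->
    (forall f : 'rV_n, (forall p, p \in S -> ev f p = ev f alpha) ->
       ev f a = ev f b /\ ev f a' = ev f b') ->
    (forall p, p \in S -> forced a b a' b' p alpha) ->
  has_join (refl n a b) (refl n a' b').
Proof.
move=> ab ab' SX Sp h1 h2; apply: (chain_join ab ab' (vertical_chain SX Sp)).
  by move=> f h; apply: h1 => p pS; apply: (h (p, alpha, gvr p)); exact: map_f.
by move=> t /mapP[p pS ->]; exact: h2.
Qed.

Lemma hor_ver_join x y z : is_hor x y -> X z -> has_join (refl n x y) (refl n z alpha).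
Proof.
move=> hxy Xz; wlog zi : x y hxy / x <= z < x + n%:Z.
  move=> W; have [k zk] := floor_ex hn x z.
  rewrite -(refl_shift k (hor_ncong hxy)); apply: W; first exact: hor_shift.
  by rewrite mulrDl in zk; lia.
have [Xx Xy lxy] := hxy; have nxy := hor_ncong hxy; have nz := ver_ncong Xz.
have [zy|yz] := leP z y; last first.
  by apply: (pair_join (hor_atom hxy) (ver_atom Xz)); rewrite ghr_alpha0 ghr_out //; lia.
have [zx|zx] := eqVneq z x.
  subst z; apply: (vertical_join (S := [:: y; x]) (hor_atom hxy) (ver_atom Xx)).
  - by move=> p; rewrite !inE => /orP[]/eqP->.
  - by rewrite /= !andbT; lia.
  - by move=> f h; rewrite !h ?inE ?eqxx ?orbT.
  - move=> p; rewrite !inE => /orP[]/eqP-> u uc u1 u2 f fu; last exact: (fixsub_refl hn u nz).1 u2 f fu.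
    by rewrite -((fixsub_refl hn u nxy).1 u1 f fu); exact: (fixsub_refl hn u nz).1 u2 f fu.
have [zy'|zy'] := eqVneq z y.
  subst z; apply: (vertical_join (S := [:: y; x]) (hor_atom hxy) (ver_atom Xy)).
  - by move=> p; rewrite !inE => /orP[]/eqP->.
  - by rewrite /= !andbT; lia.
  - by move=> f h; rewrite !h ?inE ?eqxx ?orbT.
  - move=> p; rewrite !inE => /orP[]/eqP-> u uc u1 u2 f fu; first exact: (fixsub_refl hn u nz).1 u2 f fu.
    by rewrite ((fixsub_refl hn u nxy).1 u1 f fu); exact: (fixsub_refl hn u nz).1 u2 f fu.
have xzy : x < z < y by lia.
apply: (vertical_join (S := [:: y; z; x]) (hor_atom hxy) (ver_atom Xz)).
- by move=> p; rewrite !inE => /or3P[]/eqP->.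
- by rewrite /= !andbT; lia.
- by move=> f h; rewrite !h ?inE ?eqxx ?orbT.
- move=> p pS u uc u1 u2.
  have fxy := (fixsub_refl hn u nxy).1 u1; have fz := (fixsub_refl hn u nz).1 u2.
  have cross := hor_cross uc hxy u1 Xz xzy (p := alpha) _ fz.
  have {}cross f : fixes u f -> ev f z = ev f x by apply: cross; case; rewrite (negbTE Xalpha).
  move=> f fu; rewrite -fz // cross //.
  by move: pS; rewrite !inE => /or3P[]/eqP->; rewrite -?fxy // cross.
Qed.

Lemma ver_join x y : X x -> X y -> has_join (refl n x alpha) (refl n y alpha).
Proof.
move=> Xx Xy; wlog xy : x y Xx Xy / x <= y.
  by move=> W; have [xy|/ltW yx] := leP x y; [|apply: join_belowC]; apply: W.
have nx := ver_ncong Xx; have ny := ver_ncong Xy.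
have [<-|nxy] := eqVneq x y; first exact: refl_join (ver_atom Xx).
have [yx|xny] := ltP y (x + n%:Z).
  apply: join_belowC; apply: (pair_join (ver_atom Xy) (ver_atom Xx)).
  by rewrite gvr_alpha (gvr_window (k := -1)) // addNr mul0r mulN1r; lia.
apply: (hyper_join (L := [:: x; y]) (ver_atom Xx) (ver_atom Xy)) => //.
- by move=> t; rewrite !inE => /orP[]/eqP->.
- by move=> f -> h; rewrite !h ?inE ?eqxx ?orbT.
move=> u uc u1 u2 t; have far := ver_far uc Xx Xy xny u1 u2.
rewrite !inE => /orP[]/eqP->// f fu; rewrite ((fixsub_refl hn u nx).1 u1 f fu).
by rewrite -((fixsub_refl hn u ny).1 u2 f fu) far.
Qed.

(** Along the iterates of c the value of f is carried unchanged up to the step that reaches y, where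
    it equals t. *)
Lemma cox_const (f : 'rV[algC]_n) x y t : X x -> X y -> x <= y -> (forall z, X z -> x <= z -> z < y ->
    ev f z = if c z < y then ev f (c z) else t) ->
  (forall z, X z -> x <= z -> z < y -> ev f z = ev f x) /\ (x < y -> ev f x = t).
Proof.
move=> Xx Xy xy h.
pose Q z := z <= y -> if z < y then ev f z = ev f x else ev f x = t.
have step z : X z -> x <= z -> x < y -> Q z.
  move=> Xz xz xy'; apply: (cox_ind hn cX (Q := Q) Xx Xz xz) => [_|z' Xz' xz' z'z IH cy].
    by rewrite xy'.
  have [_ lt _] := cox_up cX Xz'; have zy : z' < y := lt_le_trans lt cy.
  have := IH (ltW zy); rewrite zy => e; have := h z' Xz' xz' zy; rewrite e.
  by case: ifP.
split=> [z Xz xz zy|xy']; last by have := step y Xy xy xy' (lexx y); rewrite ltxx.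
by have := step z Xz xz (le_lt_trans xz zy) (ltW zy); rewrite zy.
Qed.

(* If the points a, b of X are more than n apart, (a, b) c has two infinite orbits on X, of
   nonzero shifts k and 1 - k, so that it has no nonzero fixed vector. *)
Lemma atom_class a b : ~~ cong n a b -> nle rho (refl n a b) c ->
  (exists x y, is_hor x y /\ refl n a b = refl n x y) \/
  (exists2 x, X x & refl n a b = refl n x alpha).
Proof.
move=> ab rc; have ba : ~~ cong n b a by rewrite cong_sym.
have shiftX x k : X (x + k * n%:Z) = X x := cox_periodic cX x k.
have [Xa|/Xi1/congP[k aE]] := boolP (X a); last first.
  right; exists (b + (- k) * n%:Z).
    by rewrite shiftX X_cong; apply: contra ba; rewrite aE congDr.
  by rewrite refl_sym // -(refl_shift (- k) ba) aE mulNr addrK.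
have [Xb|/Xi1/congP[k bE]] := boolP (X b); last first.
  right; exists (a + (- k) * n%:Z); first by rewrite shiftX.
  by rewrite -(refl_shift (- k) ab) bE mulNr addrK.
(* d is the translate of b in ]a, a + n[; for k = 0 or k = 1, a and b are less than n apart. *)
have [k k1 k2] := cong_window hn ba; set d := b + k * n%:Z in k1 k2.
have Xd : X d by rewrite shiftX.
have [k0|k0] := eqVneq k 0.
  left; exists a, b; split=> //; split=> //; rewrite /d k0 mul0r addr0 in k1 k2; lia.
have [k1'|k1'] := eqVneq k 1.
  left; exists b, a; split; last by rewrite refl_sym.
  split=> //; rewrite /d k1' mul1r in k1 k2; lia.
suff rn' : rho (refl n a b * c)%g = n.
  by move: rc; rewrite /nle (rho_refl1 hn) // reflV // rn' (rho_cox hn cX); lia.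
apply: rho_full => f /(fixesP hn) ff.
have tc z : X z -> ~~ cong n (c z) a -> ~~ cong n (c z) b -> ev f z = ev f (c z).
  by move=> _ za zb; rewrite -ff affine_permM refl_out.
have bd : b = d + (- k) * n%:Z by rewrite mulNr addrK.
have dE z : c z = d -> ev f z = q ^ k * ev f a.
  by move=> e; rewrite -ff affine_permM e refl_r // evM.
have aE z : c z = a + n%:Z -> ev f z = q ^ (1 - k) * ev f d.
  move=> e; rewrite -ff affine_permM e -[n%:Z]mul1r refl_l // bd -addrA -mulrDl evM //.
  by rewrite addrC.
have [z Xz az zd|c1 c2] := cox_const (f := f) (t := q ^ k * ev f a) Xa Xd (ltW k1).
  have [Xc lt h] := cox_up cX Xz; have cd := h d Xd zd.
  case: ltP => [lcd|dcz]; last by apply: dE; lia.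
  have wa : a < c z < a + n%:Z by lia.
  have wb : c z < d < c z + n%:Z by lia.
  apply: tc => //; first by rewrite cong_sym (window_ncong hn wa).
  by rewrite bd congDr (window_ncong hn wb).
have Xan : X (a + n%:Z) by rewrite -[n%:Z]mul1r shiftX.
have [z Xz dz za|c3 c4] := cox_const (f := f) (t := q ^ (1 - k) * ev f d) Xd Xan (ltW k2).
  have [Xc lt h] := cox_up cX Xz; have ca := h _ Xan za.
  case: ltP => [lca|acz]; last by apply: aE; lia.
  have wa : a < c z < a + n%:Z by lia.
  have wb : d < c z < d + n%:Z by lia.
  apply: tc => //; first by rewrite cong_sym (window_ncong hn wa).
  by rewrite bd congDr cong_sym (window_ncong hn wb).
have fa : ev f a = 0 by apply: (qX_fix _ k0); exact: c2.
have fd : ev f d = 0 by apply: (qX_fix (k := 1 - k)); [exact: c4 | lia].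
apply: ev_inj => x; rewrite ev0; have [Xx|/Xi1/congP[l ->]] := boolP (X x); last first.
  have := ff alpha; rewrite -{1}[alpha]addr0 -(mul0r n%:Z) affine_permM cox_alpha sub0r.
  rewrite refl_out // ?congDl ?[cong n alpha _]cong_sym; try exact: ver_ncong.
  by rewrite !evM // => /esym/qX_fix-> //; rewrite mulr0.
have [l xl] := window_rep a x; have Xl : X (x + l * n%:Z) by rewrite shiftX.
suff : ev f (x + l * n%:Z) = 0.
  by rewrite evM // => /eqP; rewrite mulf_eq0 (negbTE (qX_neq0 _)) => /eqP.
have [lt|le] := ltP (x + l * n%:Z) d; first by rewrite c1 //; lia.
by rewrite c3 //; lia.
Qed.

Lemma atom_join r1 r2 : is_reflection r1 -> is_reflection r2 ->
  nle rho r1 c -> nle rho r2 c -> has_join r1 r2.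
Proof.
move=> [a [b [ab ->]]] [a' [b' [ab' ->]]] /(atom_class ab) h1 /(atom_class ab') h2.
case: h1 => [[x [y [hxy ->]]]|[x Xx ->]]; case: h2 => [[z [p [hzp ->]]]|[z Xz ->]].
- exact: hor_join.
- exact: hor_ver_join.
- by apply: join_belowC; exact: hor_ver_join.
- exact: ver_join.
Qed.

Lemma lR_joins v w : nle (@lR n) v c -> nle (@lR n) w c -> join_below (@lR n) c v w.
Proof.
move=> /nle_lR_c vc /nle_lR_c wc.
have [|||j [jc vj wj jmin]] := all_joins rn (R := @is_reflection n) _ _ _ vc wc.
- move=> x xc x1; have [a [b [w' [ab xE lx]]]] := lR_pred hn x1.
  exists (refl n a b); first exact: is_refl.
  apply/(nle_lR _ xc); rewrite xE; apply: nle_mulr.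
  by rewrite -xE lx (lR_refl hn ab).
- by move=> r [a [b [ab ->]]]; rewrite (rho_refl1 hn ab).
- exact: atom_join.
exists j; split; [exact/nle_lR_c | exact/nle_lR | exact/nle_lR |].
by move=> u /nle_lR_c uc /(nle_lR _ uc) vu /(nle_lR _ uc) wu; apply/nle_lR => //; exact: jmin.
Qed.

End OneXi.

(** * Two residue classes on both sides *)

Lemma fixes_indep n (v : affine_perm n) (k : nat) (f : 'I_k -> 'rV[algC]_n) (p : 'I_k -> int) :
  (forall i, fixes v (f i)) -> (forall i j, ev (f i) (p j) = (i == j)%:R) ->
  (k <= n - rho v)%N.
Proof.
move=> fv fp; rewrite -rho_kernel; set K := kermx _.
pose E : 'M[algC]_(n, k) := \matrix_(i, j) evec n (p j) i 0.
apply: leq_trans (mxrankM_maxl K E); rewrite -{1}(mxrank1 algC k); apply: mxrankS.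
apply/row_subP => i; have fK : (f i <= K)%MS by rewrite sub_kermx; apply/eqP/fixesE.
suff -> : row i 1%:M = f i *m E by exact: submxMr.
apply/rowP => j; rewrite !mxE -fp /ev mxE.
by apply: eq_bigr => l _; rewrite !mxE.
Qed.

Section TwoTwo.
Local Open Scope group_scope.
Variables (n : nat) (hn : (1 < n)%N) (c : affine_perm n) (X : int -> bool).
Hypothesis cX : cox_data c X.
Implicit Types (x y z : int) (u v w : affine_perm n).
Let rn := rho_norm hn.
Let ln := lR_norm hn.
Let shiftX x (k : int) : X (x + k * n%:Z)%R = X x := cox_periodic cX x k.

(* The translation (y)_[1] (z)_[-1]. *)
Definition transl y z : affine_perm n := refl n (y + 1 * n%:Z)%R z * refl n y z.

Lemma X_ncong x z : X x -> ~~ X z -> ~~ cong n x z.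
Proof.
by move=> Xx; apply: contra => /congP[k e]; rewrite e shiftX in Xx.
Qed.

Lemma transl_l y z (k : int) : X y -> ~~ X z -> transl y z (y + k * n%:Z)%R = (y + (k + 1) * n%:Z)%R.
Proof.
move=> Xy Xz; have yz := X_ncong Xy Xz; rewrite affine_permM refl_l // refl_r ?congDl //.
by rewrite -addrA -mulrDl addrC (addrC 1%R) addrC.
Qed.

Lemma transl_r y z (k : int) : X y -> ~~ X z -> transl y z (z + k * n%:Z)%R = (z + (k - 1) * n%:Z)%R.
Proof.
move=> Xy Xz; have yz := X_ncong Xy Xz; rewrite affine_permM refl_r //.
have -> : (y + k * n%:Z = (y + 1 * n%:Z) + (k - 1) * n%:Z)%R by ring.
by rewrite refl_l ?congDl.
Qed.

Lemma transl_out y z x : X y -> ~~ X z -> ~~ cong n x y -> ~~ cong n x z -> transl y z x = x.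
Proof.
move=> Xy Xz xy xz; have yz := X_ncong Xy Xz.
by rewrite affine_permM !refl_out // ?congDl ?congDr.
Qed.

Lemma lR_transl y z : X y -> ~~ X z -> (lR (transl y z) <= 2)%N.
Proof.
move=> Xy Xz; have yz := X_ncong Xy Xz; apply: leq_trans (normM ln _ _) _.
by rewrite !(lR_refl hn) // congDl.
Qed.

Variable a : int.
Hypothesis Xa : X a.
Let b := c a.
Hypothesis ba : b < a + n%:Z.

Let Xb : X b. Proof. by rewrite (coxE cX). Qed.
Let ab : a < b. Proof. by have [] := cox_up cX Xa. Qed.
Let nab : ~~ cong n a b. Proof. by apply: (window_ncong hn); rewrite ab. Qed.
Let nba' : ~~ cong n b (a + 1 * n%:Z)%R. Proof. by rewrite congDr cong_sym. Qed.

(* (a, b)_[1] (z)_[-1]. *)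
Definition rot z : affine_perm n := refl n a b * transl b z.

Lemma rotE z : ~~ X z -> rot z = refl n b (a + 1 * n%:Z)%R * transl a z.
Proof.
move=> Xz; have az := X_ncong Xa Xz; have bz := X_ncong Xb Xz.
have nba : ~~ cong n b a by rewrite cong_sym.
apply: affine_permP => x.
rewrite (affine_permM (refl n a b) (transl b z)) (affine_permM (refl n b _) (transl a z)).
have [/congP[k ->]|xa] := boolP (cong n x a).
  rewrite transl_out ?congDl // refl_l // transl_l //.
  have -> : (a + (k + 1) * n%:Z = (a + 1 * n%:Z) + k * n%:Z)%R by ring.
  by rewrite refl_r.
have [/congP[k ->]|xb] := boolP (cong n x b).
  rewrite transl_l // refl_r // transl_out ?congDl // refl_l //; ring.
have [/congP[k ->]|xz] := boolP (cong n x z).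
  by rewrite !transl_r // !refl_out ?congDl ?congDr // cong_sym.
by rewrite !transl_out // !refl_out ?congDr.
Qed.

Lemma rot_z z : ~~ X z -> rot z z = (z - n%:Z)%R.
Proof.
move=> Xz; have az := X_ncong Xa Xz; have bz := X_ncong Xb Xz.
have := transl_r 0 Xb Xz; rewrite mul0r addr0 sub0r mulN1r => tz.
rewrite /rot affine_permM tz refl_out // -(mulN1r n%:Z) congDl cong_sym //.
Qed.

Lemma rot_out z x : ~~ X z -> ~~ cong n x a -> ~~ cong n x b -> ~~ cong n x z -> rot z x = x.
Proof. by move=> Xz xa xb xz; rewrite affine_permM transl_out // refl_out. Qed.

Lemma rot_a z (k : int) : ~~ X z -> rot z (a + k * n%:Z)%R = (b + k * n%:Z)%R.
Proof.
move=> Xz; have az := X_ncong Xa Xz.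
by rewrite affine_permM transl_out ?congDl ?refl_l.
Qed.

Lemma rot_b z (k : int) : ~~ X z -> rot z (b + k * n%:Z)%R = (a + (k + 1) * n%:Z)%R.
Proof. by move=> Xz; rewrite affine_permM transl_l // refl_r. Qed.

Lemma lR_rot z : ~~ X z -> (lR (rot z) <= 3)%N.
Proof.
move=> Xz; apply: leq_trans (normM ln _ _) _; rewrite (lR_refl hn) //.
by rewrite add1n ltnS lR_transl.
Qed.

Section Complement.
Variable z : int.
Hypothesis Xz : ~~ X z.
Let v := (rot z)^-1 * c.

Let vE x y : rot z y = c x -> v x = y.
Proof. by move=> e; rewrite affine_permM -e -affine_permM mulVg. Qed.

(* Indicators of the three finite cycles of rot z^-1 * c: {a}, the other points of X, and
   the points of Xi. *)
Definition comp_fix (i : nat) x : algC :=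
  match i with
  | 0 => delta n a x
  | 1 => if X x && ~~ cong n x a then q ^ ((x - a)%R %/ n%:Z)%Z else 0
  | _ => if X x then 0 else q ^ ((x - (z + 1))%R %/ n%:Z)%Z
  end%R.

Lemma comp_fix_quasi i : quasi n (comp_fix i).
Proof.
case: i => [|[|i]] x k /=; first exact: delta_quasi.
  rewrite shiftX congDl; case: ifP => _; rewrite ?mulr0 // -qXD; congr (q ^ _)%R.
  by rewrite addrAC addrC divzMDl //; lia.
rewrite shiftX; case: ifP => _; rewrite ?mulr0 // -qXD; congr (q ^ _)%R.
by rewrite addrAC addrC divzMDl //; lia.
Qed.

Lemma rot_other x : ~~ cong n (c x) a -> ~~ cong n (c x) b -> ~~ cong n (c x) z -> v x = c x.
Proof. by move=> xa xb xz; apply: vE; exact: rot_out. Qed.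

(** The point that c sends to a + (k + 1) n is sent to b + k n instead, which closes the cycle
    inside its window. *)
Lemma comp_X x (k : int) : X x -> ~~ cong n x a -> (a + k * n%:Z <= x < a + (k + 1) * n%:Z)%R ->
  [/\ X (v x), ~~ cong n (v x) a & (a + k * n%:Z <= v x < a + (k + 1) * n%:Z)%R].
Proof.
move=> Xx xa xk; have [Xc lt h] := cox_up cX Xx.
have cle : c x <= (a + (k + 1) * n%:Z)%R by apply: h; rewrite ?shiftX //; lia.
have [e|ne] := eqVneq (c x) (a + (k + 1) * n%:Z)%R.
  rewrite (vE (y := (b + k * n%:Z)%R)); last by rewrite rot_b.
  rewrite shiftX congDl [cong n b a]cong_sym; split=> //.
  by rewrite mulrDl mul1r; lia.
have w1 : (a + k * n%:Z < c x < (a + k * n%:Z) + n%:Z)%R by rewrite mulrDl mul1r in cle ne xk; lia.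
have ca : ~~ cong n (c x) a.
  by have := window_ncong hn w1; rewrite congDl cong_sym.
have vx : v x = c x.
  by apply: rot_other => //; [rewrite affine_cong | exact: X_ncong].
by rewrite vx; split=> //; rewrite mulrDl mul1r; lia.
Qed.

(** The window starts at z + 1 because the point that c sends to z + k n is sent to z + (k + 1) n
    instead. *)
Lemma comp_Xi x (k : int) : ~~ X x -> (z + 1 + k * n%:Z <= x < z + 1 + (k + 1) * n%:Z)%R ->
  ~~ X (v x) /\ (z + 1 + k * n%:Z <= v x < z + 1 + (k + 1) * n%:Z)%R.
Proof.
move=> Xx xk; have [Xc lt h] := cox_down cX Xx.
have cle : (z + k * n%:Z <= c x)%R by apply: h; rewrite ?shiftX //; lia.
have [e|ne] := eqVneq (c x) (z + k * n%:Z)%R.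
  rewrite (vE (y := (z + (k + 1) * n%:Z)%R)); last first.
    by rewrite affineD rot_z // e; ring.
  by rewrite shiftX; split=> //; rewrite !mulrDl !mul1r; lia.
have cz : ~~ cong n (c x) z.
  apply/negP => /congP[l cl]; have : k < l by rewrite -(ltz_muln hn); lia.
  have : l < k + 1 by rewrite -(ltz_muln hn) mulrDl; rewrite mulrDl in xk; lia.
  lia.
have Xn y : X y -> ~~ cong n (c x) y by move=> Xy; rewrite cong_sym; exact: X_ncong.
have -> : v x = c x by apply: rot_other => //; exact: Xn.
by split=> //; lia.
Qed.

Lemma comp_fixes i : fixes v (rowf n (comp_fix i)).
Proof.
apply/(fixesP hn) => x; rewrite !rowfE //; try exact: comp_fix_quasi.
have va (k : int) : v (a + k * n%:Z)%R = (a + k * n%:Z)%R.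
  by apply: vE; rewrite rot_a // affineD.
have [/congP[k ->]|xa] := boolP (cong n x a); first by rewrite va.
have [Xx|Xx] := boolP (X x).
  have [k xk] := floor_ex hn a x; have [Xv nv vk] := comp_X Xx xa xk.
  case: i => [|[|i]] /=; rewrite ?Xx ?Xv ?xa ?nv //=.
    by rewrite !delta_out.
  by rewrite (floorE hn xk) (floorE hn vk).
have [k xk] := floor_ex hn (z + 1)%R x; have [Xv vk] := comp_Xi Xx xk.
have nv : ~~ cong n (v x) a by rewrite cong_sym; exact: X_ncong.
case: i => [|[|i]] /=; rewrite ?(negbTE Xx) ?(negbTE Xv) //=.
  by rewrite !delta_out.
by rewrite (floorE hn xk) (floorE hn vk).
Qed.

Lemma lR_comp : (lR v + 3 <= n)%N.
Proof.
have lo : (lR v <= rho v)%N.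
  apply: (lR_elliptic hn) => x vx.
  have ce i : comp_fix i x = 0%R.
    by have := vx _ (comp_fixes i); rewrite rowfE //; exact: comp_fix_quasi.
  have := ce 0%N; have := ce 1%N; have := ce 2%N => /=.
  case: ifP => [Xx _|_ /eqP]; last by rewrite (negbTE (qX_neq0 _)).
  case: ifP => [_ /eqP|]; first by rewrite (negbTE (qX_neq0 _)).
  by rewrite /= => /negbFE h _; rewrite /delta h => /eqP; rewrite (negbTE (qX_neq0 _)).
suff h : (3 <= n - rho v)%N by have := rho_le v; lia.
(* One test point for each cycle; in Xi it is z + n and not z, as the window is ]z, z + n]. *)
apply: (fixes_indep (v := v) (f := fun i : 'I_3 => rowf n (comp_fix i))
  (p := fun j : 'I_3 => nth 0%R [:: a; b; (z + 1 * n%:Z)%R] j)).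
- by move=> i; exact: comp_fixes.
- have za : ~~ cong n (z + 1 * n%:Z)%R a by rewrite congDl cong_sym; exact: X_ncong.
  have ba' : ~~ cong n b a by rewrite cong_sym.
  have fb : ((b - a)%R %/ n%:Z)%Z = 0%R by apply: (floorE hn); rewrite addrC mulrDl; lia.
  have fz : ((z + 1 * n%:Z - (z + 1))%R %/ n%:Z)%Z = 0%R by apply: (floorE hn); rewrite mul0r mulrDl; lia.
  case=> [[|[|[|//]]] i3] [[|[|[|//]]] j3]; rewrite rowfE //; try exact: comp_fix_quasi.
  + by rewrite /= delta_aa.
  + by rewrite /= delta_out.
  + by rewrite /= delta_out.
  + by rewrite /= congxx andbF.
  + by rewrite /= Xb ba' /= fb.
  + by rewrite /= shiftX (negbTE Xz).
  + by rewrite /= Xa.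
  + by rewrite /= Xb.
  + by rewrite /= shiftX (negbTE Xz) fz.
Qed.
End Complement.

Lemma lR_cox_ge : (n <= lR c)%N.
Proof. by rewrite -[leqLHS](rho_cox hn cX) rho_lR. Qed.

(** The lengths of [rot z] and of its complement are at most 3 and n - 3, while lR c >= rho c = n;
    subadditivity leaves only equalities. *)
Lemma rot_top z : ~~ X z -> [/\ lR c = n, lR (rot z) = 3 & nle (@lR n) (rot z) c].
Proof.
move=> Xz; have h1 := lR_rot Xz; have h3 := lR_cox_ge; set v := (rot z)^-1 * c.
have h2 : (lR v + 3 <= n)%N := lR_comp Xz.
have h4 : (lR c <= lR (rot z) + lR v)%N by rewrite -{1}[c](mulVKg (rot z)); exact: normM.
by rewrite /nle -/v; split; lia.
Qed.

Lemma rot_left z : ~~ X z -> nle (@lR n) (refl n a b) (rot z).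
Proof.
move=> Xz; have [_ l3 _] := rot_top Xz; apply: (nleP ln).
by rewrite l3 /rot mulKg (lR_refl hn nab) add1n ltnS lR_transl.
Qed.

Lemma rot_right z : ~~ X z -> nle (@lR n) (refl n b (a + 1 * n%:Z)%R) (rot z).
Proof.
move=> Xz; have [_ l3 _] := rot_top Xz; apply: (nleP ln).
by rewrite l3 rotE // mulKg (lR_refl hn nba') add1n ltnS lR_transl.
Qed.

Variables z1 z2 : int.
Hypotheses (Xz1 : ~~ X z1) (Xz2 : ~~ X z2) (z12 : ~~ cong n z1 z2).

(** The equality lR c = rho c passes to both factors of c, as rho <= lR and rho is subadditive. *)
Lemma nle_rho_eq u : nle (@lR n) u c -> lR u = rho u.
Proof.
move=> uc; have [lc _ _] := rot_top Xz1; apply/eqP; rewrite eqn_leq rho_lR // andbT.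
set v := u^-1 * c; have h : (n <= rho u + rho v)%N.
  by rewrite -[leqLHS](rho_cox hn cX) -{1}[c](mulVKg u); exact: normM.
by have := rho_lR hn v; rewrite /nle lc -/v in uc; lia.
Qed.

(* The elements (a, b)_[1] (z_i)_[-1] are two upper bounds of (a, b) and (b, a + n); a
   join would fix both z_1 and z_2, but z_1 is moved to z_1 - n by the first one. *)
Lemma no_join : ~ join_below (@lR n) c (refl n a b) (refl n b (a + 1 * n%:Z)%R).
Proof.
move=> [j [jc aj bj jmin]].
have [_ l1 w1c] := rot_top Xz1; have [_ l2 w2c] := rot_top Xz2.
have j1 := jmin _ w1c (rot_left Xz1) (rot_right Xz1).
have j2 := jmin _ w2c (rot_left Xz2) (rot_right Xz2).
have j_ge2 : (2 <= lR j)%N.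
  rewrite ltnNge; apply/negP => j_le1.
  have e1 : refl n a b = j by apply: (nle_eq ln aj); rewrite lR_refl.
  have e2 : refl n b (a + 1 * n%:Z)%R = j by apply: (nle_eq ln bj); rewrite lR_refl.
  have : refl n a b a = refl n b (a + 1 * n%:Z)%R a by rewrite e1 e2.
  rewrite refl_a //; have := refl_r (-1) nba'.
  have -> : (a + 1 * n%:Z + (-1) * n%:Z = a)%R by ring.
  by move=> ->; lia.
have jz1 : j z1 = z1.
  apply/(fixes_drow hn); have : nle (@rho n) j (rot z2).
    by rewrite /nle -(nle_rho_eq jc) -(nle_rho_eq (nle_quot_top ln j2 w2c)) -(nle_rho_eq w2c).
  move/(nle_fixsub hn); apply; apply/(fixes_drow hn); apply: rot_out => //.
    by rewrite cong_sym; exact: X_ncong.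
  by rewrite cong_sym; exact: X_ncong.
(* t has length at most 1 but moves z1 within its class, which no reflection does. *)
set t := j^-1 * rot z1; have lt : (lR t <= 1)%N by rewrite /nle l1 in j1; rewrite /t; lia.
have tz : t z1 = (z1 - n%:Z)%R.
  rewrite affine_permM rot_z //; apply: (@affine_inj _ j).
  by rewrite -affine_permM mulgV -mulN1r (affineD j) jz1.
have zc : cong n (t z1) z1 by rewrite tz -mulN1r cong_shift.
have zne : t z1 <> z1 by rewrite tz; lia.
have [t1|t1] := pselect (t = 1); first by apply: zne; rewrite t1.
have [a' [b' [w' [nab' tE lt']]]] := lR_pred hn t1.
have w1 : w' = 1 by apply: (norm_eq0 ln); lia.
rewrite tE w1 mulg1 in zc zne; move: zc zne.
case: (reflP z1 nab') => [k ->|k ->|_ _] //.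
  by rewrite congDl congDr cong_sym (negbTE nab').
by rewrite congDl congDr (negbTE nab').
Qed.

End TwoTwo.

(** * Germs with lcms *)

Section PresCong.
Variables (T : Type) (r : seq T -> seq T -> Prop).

Lemma pres_cong_catl (l u v : seq T) : pres_cong r u v -> pres_cong r (l ++ u) (l ++ v).
Proof. by move/(pres_cong_ctx l [::]); rewrite !cats0. Qed.

Lemma pres_cong_catr (l u v : seq T) : pres_cong r u v -> pres_cong r (u ++ l) (v ++ l).
Proof. by move/(pres_cong_ctx [::] l). Qed.

Lemma pres_cong_cons x (u v : seq T) : pres_cong r u v -> pres_cong r (x :: u) (x :: v).
Proof. exact: (pres_cong_catl [:: x]). Qed.

Lemma pres_cong_sub (r' : seq T -> seq T -> Prop) u v :
  (forall u v, r u v -> pres_cong r' u v) -> pres_cong r u v -> pres_cong r' u v.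
Proof.
move=> rr'; elim=> {u v} [l l' u v /rr'|u|u v _|u v w _ uv _].
- exact: pres_cong_ctx.
- exact: PresRefl.
- exact: PresSym.
- exact: PresTrans.
Qed.

Lemma pres_cong_rev (r' : seq T -> seq T -> Prop) u v :
    (forall u v, r u v -> pres_cong r' (rev u) (rev v)) -> pres_cong r u v ->
  pres_cong r' (rev u) (rev v).
Proof.
move=> rr'; elim=> {u v} [l l' u v /rr'|u|u v _|u v w _ uv _].
- by rewrite !rev_cat -!catA; exact: pres_cong_ctx.
- exact: PresRefl.
- exact: PresSym.
- exact: PresTrans.
Qed.
End PresCong.

(** The partial product is a ternary relation, so that exchanging its arguments gives a germ again
    and right divisibility needs no second proof. The associativity axioms also say when products
    are defined. *)
Record germ (T : Type) (e : T) (mul : T -> T -> T -> Prop) (wt : T -> nat) : Prop := Germ {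
  germ_wt_e : wt e = 0%N;
  germ_wt0 : forall u, wt u = 0%N -> u = e;
  germ_wtM : forall u v w, mul u v w -> wt w = (wt u + wt v)%N;
  germ_1l : forall u, mul e u u;
  germ_1r : forall u, mul u e u;
  germ_fun : forall u v w w', mul u v w -> mul u v w' -> w = w';
  germ_canl : forall u v v' w, mul u v w -> mul u v' w -> v = v';
  germ_canr : forall u u' v w, mul u v w -> mul u' v w -> u = u';
  germ_assoc : forall a b ab d f, mul a b ab -> mul ab d f ->
    exists2 bd, mul b d bd & mul a bd f;
  germ_assocV : forall a b d bd f, mul b d bd -> mul a bd f ->
    exists2 ab, mul a b ab & mul ab d f }.

Lemma germ_op (T : Type) e (mul : T -> T -> T -> Prop) wt :
  germ e mul wt -> germ e (fun u v => mul v u) wt.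
Proof.
move=> g; split.
- exact: germ_wt_e g.
- exact: germ_wt0 g.
- by move=> u v w /(germ_wtM g); rewrite addnC.
- exact: germ_1r g.
- exact: germ_1l g.
- by move=> u v w w'; exact: (germ_fun g).
- by move=> u v v' w; exact: (germ_canr g).
- by move=> u u' v w; exact: (germ_canl g).
- by move=> a b ab d f h1 h2; have [x] := germ_assocV g h1 h2; exists x.
- by move=> a b d bd f h1 h2; have [x] := germ_assoc g h1 h2; exists x.
Qed.

Inductive germ_rel (T : Type) (e : T) (mul : T -> T -> T -> Prop) :
    seq T -> seq T -> Prop :=
| GermOne : germ_rel e mul [:: e] [::]
| GermMul u v w : mul u v w -> germ_rel e mul [:: u; v] [:: w].

Section GermMonoid.
Variables (T : Type) (e : T) (mul : T -> T -> T -> Prop) (wt : T -> nat).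
Hypothesis gP : germ e mul wt.
Implicit Types (a b c d x y z j k : T) (u v w l : seq T).

Notation "u '~' v" := (pres_cong (germ_rel e mul) u v) (at level 70).

Lemma word_sym u v : u ~ v -> v ~ u. Proof. exact: PresSym. Qed.
Lemma word_trans u v w : u ~ v -> v ~ w -> u ~ w. Proof. exact: PresTrans. Qed.

Lemma cong_e u : e :: u ~ u.
Proof. exact: (PresRel [::] u (GermOne e mul)). Qed.

Lemma cong_mul x y z u : mul x y z -> x :: y :: u ~ z :: u.
Proof. by move=> xyz; exact: (PresRel [::] u (GermMul e xyz)). Qed.

Definition wword u : nat := sumn (map wt u).

Lemma wword_cat u v : wword (u ++ v) = (wword u + wword v)%N.
Proof. by rewrite /wword map_cat sumn_cat. Qed.

Lemma wword_cong u v : u ~ v -> wword u = wword v.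
Proof.
elim=> {u v} [l l' u v uv|//|u v _ ->//|u v w _ -> _ ->//].
rewrite !wword_cat; congr (_ + (_ + _))%N; case: uv => [|x y z /(germ_wtM gP) h].
  by rewrite /wword /= (germ_wt_e gP).
by rewrite /wword /= !addn0 h.
Qed.

(* The letter e is an invisible first letter, so first letters are compared after erasing
   the letters of weight 0. *)
Definition strip u := [seq x <- u | wt x != 0%N].

Lemma strip_cong u : strip u ~ u.
Proof.
elim: u => [|x u IH]; first exact: PresRefl.
rewrite /strip /=; case: eqP => [/(germ_wt0 gP)->|_] /=; last exact: pres_cong_cons.
exact: (word_trans IH (word_sym (cong_e u))).
Qed.

Lemma strip_nil u : strip u = [::] -> wword u = 0%N.
Proof. by move=> h; have := wword_cong (strip_cong u); rewrite h. Qed.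

Definition germ_lub a b j x y := [/\ mul a x j, mul b y j &
  forall k x' y', mul a x' k -> mul b y' k -> exists z, mul j z k].

Lemma germ_lubC a b j x y : germ_lub a b j x y -> germ_lub b a j y x.
Proof. by case=> h1 h2 h3; split=> // k x' y' h4 h5; exact: h3 h5 h4. Qed.

Lemma germ_lub_le a b j x y d : mul a d b -> germ_lub a b j x y -> x = d /\ y = e.
Proof.
move=> adb [ax by_ h]; have [z jz] := h b d e adb (germ_1r gP b).
have y0 : y = e.
  by apply: (germ_wt0 gP); have := germ_wtM gP jz; have := germ_wtM gP by_; lia.
split=> //; subst y; have jb := germ_fun gP by_ (germ_1r gP b); subst j.
exact: (germ_canl gP ax adb).
Qed.

Hypothesis lubs : forall a b, exists j x y, germ_lub a b j x y.

(** For a = b this amounts to left cancellation; for different letters it yields lcms of words. *)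
Definition head_lub u v := forall a u' b v' j x y,
  strip u = a :: u' -> strip v = b :: v' -> germ_lub a b j x y ->
  exists2 z, u' ~ x :: z & v' ~ y :: z.

Lemma head_lub_same a u v j x y : u ~ v -> germ_lub a a j x y ->
  exists2 z, u ~ x :: z & v ~ y :: z.
Proof.
move=> uv /(germ_lub_le (germ_1r gP a))[-> ->]; exists v.
  exact: (word_trans uv (word_sym (cong_e v))).
exact/word_sym/cong_e.
Qed.

Lemma cons_lub N : (forall u v, (wword u < N)%N -> u ~ v -> head_lub u v) ->
  forall a b u v j x y, (wword (a :: u) < N)%N -> a :: u ~ b :: v ->
  germ_lub a b j x y -> exists2 z, u ~ x :: z & v ~ y :: z.
Proof.
move=> IH a b u v j x y lt uv lub; have := IH _ _ lt uv.
have [a0|a0] := eqVneq (wt a) 0%N.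
  have ea := germ_wt0 gP a0; subst a => _; have [xb ye] := germ_lub_le (germ_1l gP b) lub.
  subst x y; exists v; last exact/word_sym/cong_e.
  exact: (word_trans (word_sym (cong_e u)) uv).
have [b0|b0] := eqVneq (wt b) 0%N.
  have eb := germ_wt0 gP b0; subst b => _; have [ya xe] := germ_lub_le (germ_1l gP a) (germ_lubC lub).
  subst x y; exists u; first exact/word_sym/cong_e.
  exact: (word_trans (word_sym (cong_e v)) (word_sym uv)).
move=> /(_ a (strip u) b (strip v) j x y); rewrite /strip /= a0 b0 => /(_ erefl erefl lub).
case=> z h1 h2; exists z; first exact: (word_trans (word_sym (strip_cong u)) h1).
exact: (word_trans (word_sym (strip_cong v)) h2).
Qed.

(* Garside's argument: along a chain of relations leading from a u to b v, glue the
   lcms at an intermediate first letter d; everything takes place below the lcm of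
   a, b and d in the germ. *)
Lemma head_lub_trans a b d u v m j x y :
    (forall w w', (wword w < wt d + wword m)%N -> w ~ w' -> head_lub w w') ->
    wt d != 0%N -> germ_lub a b j x y ->
    (forall j x y, germ_lub a d j x y -> exists2 z, u ~ x :: z & m ~ y :: z) ->
    (forall j x y, germ_lub d b j x y -> exists2 z, m ~ x :: z & v ~ y :: z) ->
  exists2 z, u ~ x :: z & v ~ y :: z.
Proof.
move=> IH d0 [ax by_ jmin] h1 h2.
have [j1 [x1 [y1 lub1]]] := lubs a d; have [w1 u1 m1] := h1 _ _ _ lub1.
have [j2 [x2 [y2 lub2]]] := lubs d b; have [w2 m2 v2] := h2 _ _ _ lub2.
have [j3 [p [r lub3]]] := lubs y1 x2.
have m12 := word_trans (word_sym m1) m2.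
have [|w3 e1 e2] := cons_lub IH _ m12 lub3; first by rewrite -(wword_cong m1); lia.
have [ax1 dy1 _] := lub1; have [dx2 by2 _] := lub2; have [yp xr j3min] := lub3.
(* E bounds a, b and d; it serves to show that d j3 is defined, and with it the products j1 p and j2
   r. *)
have [E [s [t [j1s j2t _]]]] := lubs j1 j2.
have [f y1s df] := germ_assoc gP dy1 j1s.
have [f' x2t df'] := germ_assoc gP dx2 j2t.
have ff := germ_canl gP df df'; subst f'.
have [g j3g] := j3min _ _ _ y1s x2t.
have [h dj3 _] := germ_assocV gP j3g df.
have [j1' dy1' jp] := germ_assocV gP yp dj3.
have e3 := germ_fun gP dy1 dy1'; subst j1'.
have [j2' dx2' jr] := germ_assocV gP xr dj3.
have e4 := germ_fun gP dx2 dx2'; subst j2'.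
have [xp x1p axp] := germ_assoc gP ax1 jp.
have [yr y2r byr] := germ_assoc gP by2 jr.
have [k jk] := jmin _ _ _ axp byr.
have [xk xkE axk] := germ_assoc gP ax jk; have e5 := germ_canl gP axp axk; subst xk.
have [yk ykE byk] := germ_assoc gP by_ jk; have e6 := germ_canl gP byr byk; subst yk.
exists (k :: w3).
  apply: (word_trans u1); apply: (word_trans (pres_cong_cons x1 e1)).
  exact: (word_trans (cong_mul w3 x1p) (word_sym (cong_mul w3 xkE))).
apply: (word_trans v2); apply: (word_trans (pres_cong_cons y2 e2)).
exact: (word_trans (cong_mul w3 y2r) (word_sym (cong_mul w3 ykE))).
Qed.

(** Induction on the weight, then on the derivation. One relation replaces a first letter by a
    comparable one at most; only transitivity calls for smaller weights. *)
Lemma cong_head_lub u v : u ~ v -> head_lub u v.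
Proof.
elim/ltn_ind: (wword u) {-2}u (erefl (wword u)) v => N IHN {}u uN v uv.
have {}IHN w w' : (wword w < N)%N -> w ~ w' -> head_lub w w'.
  by move=> wN; exact: IHN wN _ erefl w'.
elim: uv uN => {u v} [l l' u v uv|u|u v uv IH|u m v um IH1 mv IH2] uN.
- move=> a u' b v' j x y; rewrite /strip !filter_cat -!/(strip _).
  case lE: (strip l) => [|a0 l0] /=; last first.
    move=> [<- <-] [<- <-]; apply: head_lub_same; apply: pres_cong_catl.
    rewrite -!filter_cat; apply: word_trans (strip_cong _) _.
    apply: word_trans (word_sym (strip_cong _)).
    exact: (PresRel [::] l' uv).
  case: uv {uN} => [|c d f cdf]; rewrite /strip /= ?(germ_wt_e gP) /=.
    by move=> -> [<- <-]; apply: head_lub_same; exact: PresRefl.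
  have := germ_wtM gP cdf.
  have [c0|c0] := eqVneq (wt c) 0%N.
    have ce := germ_wt0 gP c0; subst c; have df := germ_fun gP (germ_1l gP d) cdf; subst f.
    by rewrite ?(germ_wt_e gP) /= => _ -> [<- <-]; apply: head_lub_same; exact: PresRefl.
  have [d0|d0] := eqVneq (wt d) 0%N.
    have de := germ_wt0 gP d0; subst d; have df := germ_fun gP (germ_1r gP c) cdf; subst f.
    by rewrite ?(germ_wt_e gP) ?c0 /= => _ -> [<- <-]; apply: head_lub_same; exact: PresRefl.
  move=> fE; have -> /= : wt f != 0%N by lia.
  move=> [<- <-] [<- <-] /(germ_lub_le cdf)[-> ->].
  by exists (strip l'); [exact: PresRefl | exact/word_sym/cong_e].
- by move=> a u' b v' j x y -> [<- <-]; apply: head_lub_same; exact: PresRefl.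
- move=> a u' b v' j x y ua vb /germ_lubC lub.
  have [|z h1 h2] := IH _ b v' a u' j y x vb ua lub; last by exists z.
  by rewrite (wword_cong uv).
- move=> a u' b v' j x y ua vb lub.
  have mN : wword m = N by rewrite -(wword_cong um).
  case mE: (strip m) => [|d m'].
    have := strip_nil mE; rewrite mN -uN -(wword_cong (strip_cong u)) ua.
    have := filter_all (fun x => wt x != 0%N) u; rewrite -/(strip u) ua /wword /=; lia.
  have := filter_all (fun x => wt x != 0%N) m; rewrite -/(strip m) mE /= => /andP[d0 _].
  apply: (head_lub_trans (d := d) (m := m') _ d0 lub).
  + move=> w w' lt; apply: IHN; rewrite -mN -(wword_cong (strip_cong m)) mE; exact: lt.
  + by move=> j' x' y'; apply: (IH1 uN).
  + by move=> j' x' y'; apply: (IH2 mN).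
Qed.

Lemma cong_cons_lub a b u v j x y : a :: u ~ b :: v -> germ_lub a b j x y ->
  exists2 z, u ~ x :: z & v ~ y :: z.
Proof.
by apply: (cons_lub (N := (wword (a :: u)).+1)) => // u' v' _; exact: cong_head_lub.
Qed.

Lemma word_cancel l u v : l ++ u ~ l ++ v -> u ~ v.
Proof.
elim: l => //= a l IH h; apply: IH; have [j [x [y lub]]] := lubs a a.
have [z uz vz] := cong_cons_lub h lub.
have [xe ye] := germ_lub_le (germ_1r gP a) lub; subst x y.
exact: (word_trans uz (word_sym vz)).
Qed.

Definition word_lcm u v u' v' := u ++ u' ~ v ++ v' /\
  forall l l', u ++ l ~ v ++ l' -> exists2 z, l ~ u' ++ z & l' ~ v' ++ z.

Lemma word_lcmC u v u' v' : word_lcm u v u' v' -> word_lcm v u v' u'.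
Proof.
move=> [h1 h2]; split; first exact: word_sym.
by move=> l l' /word_sym/h2[z]; exists z.
Qed.

Lemma word_lcm_cat u v1 v2 p r' r s : word_lcm u v1 p r' -> word_lcm r' v2 r s ->
  word_lcm u (v1 ++ v2) (p ++ r) s.
Proof.
move=> [h1 h2] [h3 h4]; split.
  have := pres_cong_catr r h1; have := pres_cong_catl v1 h3; rewrite !catA => e1 e2.
  exact: (word_trans e2 e1).
move=> l l'; rewrite -catA => /h2[z lz /word_sym/h4[z' zz' lz']]; exists z' => //.
by rewrite -catA; exact: (word_trans lz (pres_cong_catl p zz')).
Qed.

Lemma word_lcm_nil u : word_lcm u [::] [::] u.
Proof.
split; first by rewrite cats0; exact: PresRefl.
by move=> l l' h; exists l; [exact: PresRefl | exact: word_sym].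
Qed.

(** The complement of a letter is again a single letter, which lets the recursion on v close up. *)
Lemma word_lcm_letter a v : exists p s, word_lcm [:: a] v p [:: s].
Proof.
elim: v a => [|b v IH] a; first by exists [::], a; exact: word_lcm_nil.
have [j [x [y lub]]] := lubs a b; have [p [s ps]] := IH y.
exists ([:: x] ++ p), s; apply: (word_lcm_cat (v1 := [:: b]) _ ps); split.
  by have [ax by_ _] := lub; apply: (word_trans (cong_mul [::] ax)); apply: word_sym; exact: cong_mul.
by move=> l l' h; exact: cong_cons_lub h lub.
Qed.

Lemma word_lcm_ex u v : exists u' v', word_lcm u v u' v'.
Proof.
elim: u v => [|a u IH] v.
  by exists v, [::]; apply/word_lcmC/word_lcm_nil.
have [p [s ps]] := word_lcm_letter a v; have [p' [s' ps']] := IH p.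
exists p', ([:: s] ++ s'); apply: word_lcmC.
exact: (word_lcm_cat (v1 := [:: a]) (word_lcmC ps) (word_lcmC ps')).
Qed.
End GermMonoid.

(** * The dual monoid *)

(** The meet is a common lower bound of maximal rank: its join with any other one is again a lower
    bound, of no larger rank. *)
Lemma lattice_of_joins (T : Type) (le : T -> T -> Prop) (rk : T -> nat) (bot : T) :
    (forall x, le x x) -> (forall x y z, le x y -> le y z -> le x z) ->
    (forall x, le bot x) -> (forall x y, le x y -> (rk x <= rk y)%N) ->
    (forall x y, le x y -> (rk y <= rk x)%N -> x = y) ->
    (forall x y, exists z, is_join le x y z) ->
  is_lattice le.
Proof.
move=> lexx le_trans le0 rk_le rk_eq joins; split=> // [x y xy yx|x y].
  by apply: rk_eq => //; exact: rk_le.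
have exP : exists k, `[< exists z, [/\ le z x, le z y & rk z = k] >].
  by exists (rk bot); apply/asboolP; exists bot.
have ubP k : `[< exists z, [/\ le z x, le z y & rk z = k] >] -> (k <= rk x)%N.
  by move=> /asboolP[z [zx _ <-]]; exact: rk_le.
case: (ex_maxnP exP ubP) => k /asboolP[z [zx zy <-]] zmax; exists z => t.
split=> [tz|[tx ty]]; first by split; exact: le_trans tz _.
have [j jP] := joins z t; have [zj tj] := (jP j).1 (lexx j).
have jx : le j x by apply/jP. have jy : le j y by apply/jP.
suff -> : z = j by [].
by apply: rk_eq => //; apply: zmax; apply/asboolP; exists j.
Qed.

Section DualMonoid.
Local Open Scope group_scope.
Variables (n : nat) (hn : (1 < n)%N) (c : affine_perm n).
Local Notation lR := (@lR n).
Local Notation D := (divisor c).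
Local Notation M := (dual_monoid c).
Let lP := lR_norm hn.
Implicit Types (u v w : seq D) (x y z : M) (a b d f : D).

Lemma dividesE (s t : affine_perm n) : divides s t <-> nle lR s t.
Proof.
split=> [[v' [-> e]]|st]; first exact: nle_mulr e.
by exists (s^-1 * t); rewrite mulVKg; split=> //; rewrite st.
Qed.

Definition mkdiv (s : affine_perm n) (sc : nle lR s c) : D :=
  exist _ s (asboolT (proj2 (dividesE s c) sc)).

Lemma div_nle a : nle lR (val a) c.
Proof. exact: (proj1 (dividesE _ _) (asboolW (proj2_sig a))). Qed.

Definition dunit : D := mkdiv (nle1 lP c).

Definition dmul a b d : Prop :=
  val d = val a * val b /\ lR (val d) = (lR (val a) + lR (val b))%N.

Lemma dual_relE u v : dual_rel u v <-> germ_rel dunit dmul u v.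
Proof.
split=> [[a a1|a b d e1 e2]|[|a b d [e1 e2]]].
- have -> : a = dunit by exact: val_inj. exact: GermOne.
- exact: GermMul.
- exact: DualOne.
- exact: DualMul.
Qed.

Lemma dual_germ : germ dunit dmul (fun a => lR (val a)).
Proof.
split=> /=.
- exact: norm1 lP.
- by move=> a /(norm_eq0 lP) a1; exact: val_inj.
- by move=> a b d [_].
- by move=> a; split; rewrite ?mul1g // (norm1 lP).
- by move=> a; split; rewrite ?mulg1 // (norm1 lP) addn0.
- by move=> a b d d' [e _] [e' _]; apply: val_inj; rewrite e e'.
- by move=> a b b' d [e _] [e' _]; apply: val_inj; apply: (mulgI (val a)); rewrite -e.
- by move=> a a' b d [e _] [e' _]; apply: val_inj; apply: (mulIg (val b)); rewrite -e.
- move=> a b ab d f [e1 l1] [e2 l2]; rewrite l1 e1 in e2 l2.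
  have [_ l3] := norm_add3 lP (etrans (congr1 lR (esym e2)) l2).
  have l4 : lR (val a * (val b * val d)) = (lR (val a) + lR (val b * val d)%g)%N.
    by rewrite mulgA -e2 l2 l3 addnA.
  have bdc : nle lR (val b * val d)%g c.
    by apply: (nle_trans lP) (div_nle f); rewrite e2 -mulgA; exact: (nle_mull lP).
  by exists (mkdiv bdc); split=> //=; rewrite e2 -mulgA.
- move=> a b d bd f [e1 l1] [e2 l2]; rewrite l1 e1 mulgA addnA in e2 l2.
  have [l3 _] := norm_add3 lP (etrans (congr1 lR (esym e2)) l2).
  have abc : nle lR (val a * val b)%g c.
    apply: (nle_trans lP) (div_nle f); rewrite e2; apply: nle_mulr.
    by rewrite -e2 l2 l3.
  by exists (mkdiv abc); split=> //=; rewrite l2 l3.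
Qed.

Definition cls u : M := pres_class (@dual_rel n c) u.

Lemma clsP u v : cls u = cls v <-> pres_cong (germ_rel dunit dmul) u v.
Proof.
rewrite /cls pres_classP; split; apply: pres_cong_sub => u' v' uv;
  by rewrite -[u']cats0 -[v']cats0 -[u' ++ _]cat0s -[v' ++ _]cat0s; apply: PresRel; apply/dual_relE.
Qed.

Lemma cls_cat u v : cls (u ++ v) = cls u * cls v.
Proof. exact: pres_class_cat. Qed.

Lemma cls_nil : cls [::] = 1. Proof. by []. Qed.

Lemma cls_ex x : exists u, x = cls u.
Proof. by exists (repr x); rewrite /cls pres_class_repr. Qed.

Definition mwt x : nat := wword (fun a => lR (val a)) (repr x).

Lemma mwt_cls u : mwt (cls u) = wword (fun a => lR (val a)) u.
Proof.
by apply: (wword_cong dual_germ); apply/clsP; rewrite /cls pres_class_repr.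
Qed.

Lemma mwtM x y : mwt (x * y) = (mwt x + mwt y)%N.
Proof.
have [u ->] := cls_ex x; have [v ->] := cls_ex y.
by rewrite -cls_cat !mwt_cls wword_cat.
Qed.

Lemma mwt_eq0 x : mwt x = 0%N -> x = 1.
Proof.
have [u ->] := cls_ex x; rewrite mwt_cls -cls_nil => u0; apply/clsP.
elim: u u0 => [|a u IH]; first by move=> _; exact: PresRefl.
rewrite /wword /= => /eqP; rewrite addn_eq0 => /andP[/eqP/(germ_wt0 dual_germ)-> /eqP/IH h].
exact: PresTrans (cong_e _ _ u) h.
Qed.

Definition wprod u : affine_perm n := \prod_(a <- u) val a.

Lemma wprod_cat u v : wprod (u ++ v) = wprod u * wprod v.
Proof. by rewrite /wprod big_cat. Qed.

Lemma wprod_cong u v : pres_cong (germ_rel dunit dmul) u v -> wprod u = wprod v.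
Proof.
elim=> {u v} [l l' u v uv|//|u v _ ->//|u v w _ -> _ ->//].
rewrite !wprod_cat; congr (_ * (_ * _)); case: uv => [|a b d [e _]]; rewrite /wprod.
  by rewrite big_seq1 big_nil.
by rewrite !big_cons !big_nil !mulg1 e.
Qed.

Lemma wprod_le u : (lR (wprod u) <= wword (fun a => lR (val a)) u)%N.
Proof.
elim: u => [|a u IH]; first by rewrite /wprod big_nil (norm1 lP).
rewrite /wprod big_cons; apply: leq_trans (normM lP _ _) _.
by rewrite /wword /= leq_add2l.
Qed.

(** No length is lost in the product, so the products of final segments stay below c and the letters
    can be merged from the right. *)
Lemma reduced_word u (uc : nle lR (wprod u) c) :
  (wword (fun a => lR (val a)) u <= lR (wprod u))%N -> cls u = cls [:: mkdiv uc].
Proof.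
elim: u uc => [|a u IH] uc.
  move=> _; have -> : mkdiv uc = dunit by apply: val_inj; rewrite /= /wprod big_nil.
  by apply/clsP/PresSym; exact: cong_e.
have pE : wprod (a :: u) = val a * wprod u by rewrite /wprod big_cons.
rewrite /wword /= -/(wword _ _) => le; rewrite pE in le.
have [_ lu lE] := norm_sandwich lP (leqnn (lR (val a))) (wprod_le u) le.
have uc' : nle lR (wprod u) c.
  by apply: (nle_trans lP) uc; rewrite pE; exact: nle_mull.
transitivity (cls ([:: a] ++ [:: mkdiv uc'])).
  by rewrite -[LHS]/(cls ([:: a] ++ u)) !cls_cat (IH uc') ?lu.
by apply/clsP; apply: cong_mul; split; rewrite /= pE.
Qed.

(** The length of the product in W never exceeds the weight of a word. For u and v the two totals
    coincide, so both words are reduced and collapse to generators. *)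
Lemma cls_factor u v d : cls u * cls v = cls [:: d] ->
  [/\ exists2 a, cls u = cls [:: a] & nle lR (val a) (val d),
      exists2 b, cls v = cls [:: b] & nle lR (val b) (val d)
    & nle lR (wprod u) (val d)].
Proof.
rewrite -cls_cat => /clsP uvd.
have := wprod_cong uvd; have := wword_cong dual_germ uvd.
rewrite wprod_cat wword_cat /wprod [in X in _ -> X]big_seq1 -!/(wprod _) /wword /= addn0 -!/(wword _ _).
move=> lE pE'; have pE : wprod u * wprod v = val d := pE'; have le : (wword (fun a => lR (val a)) u + wword (fun a => lR (val a)) v <= lR (wprod u * wprod v)%g)%N.
  by rewrite pE lE.
have [lu lv additive] := norm_sandwich lP (wprod_le u) (wprod_le v) le.
have ud : nle lR (wprod u) (val d) by rewrite -pE; exact: nle_mulr.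
have vd : nle lR (wprod v) (val d) by rewrite -pE; exact: nle_mull.
have uc := nle_trans lP ud (div_nle d); have vc := nle_trans lP vd (div_nle d).
split=> //.
  by exists (mkdiv uc) => //; apply: reduced_word; rewrite lu.
by exists (mkdiv vc) => //; apply: reduced_word; rewrite lv.
Qed.

Lemma ldiv_cls a b : ldiv (cls [:: a]) (cls [:: b]) <-> nle lR (val a) (val b).
Proof.
split=> [[z]|ab].
  have [v ->] := cls_ex z => /esym/cls_factor[_ _].
  by rewrite /wprod big_seq1.
exists (cls [:: mkdiv (nle_quot_top lP ab (div_nle b))]); rewrite -cls_cat.
by apply/clsP/PresSym; apply: cong_mul; split=> /=; rewrite ?mulVKg.
Qed.

Lemma rdiv_cls a b : nle lR (val a) (val b) -> rdiv (cls [:: a]) (cls [:: b]).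
Proof.
move=> ab; have e : lR (val b) = (lR (val b * (val a)^-1)%g + lR (val a))%N.
  by rewrite -ab (normC lP (val b)) addnC.
have bc : nle lR (val b * (val a)^-1)%g c.
  by apply: (nle_trans lP) (div_nle b); rewrite -{2}[val b](mulgVK (val a)); apply: nle_mulr; rewrite mulgVK.
exists (cls [:: mkdiv bc]); rewrite -cls_cat.
by apply/clsP/PresSym; apply: cong_mul; split=> /=; rewrite ?mulgVK.
Qed.

Definition dtop : D := mkdiv (nle_refl lP c).

(** The join of two generators divides the class of c, so it is a generator by [cls_factor], and
    [ldiv_cls] carries its universal property to W. *)
Lemma lattice_joins : is_lattice (@ldiv M) ->
  forall s t, nle lR s c -> nle lR t c -> join_below lR c s t.
Proof.
move=> [lxx ltr _ _ joins] s t sc tc.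
have [z zP] := joins (cls [:: mkdiv sc]) (cls [:: mkdiv tc]).
have [v zE] := cls_ex z; subst z.
have [sz tz] := (zP _).1 (lxx _).
have [y yE] : ldiv (cls v) (cls [:: dtop]) by apply/zP; split; apply/ldiv_cls.
have [v' yE'] := cls_ex y; subst y; have [[j jE _] _ _] := cls_factor (esym yE).
rewrite jE in zP sz tz; exists (val j); split; first exact: div_nle.
- by move/ldiv_cls: sz.
- by move/ldiv_cls: tz.
- move=> w wc sw tw; have /ldiv_cls : ldiv (cls [:: j]) (cls [:: mkdiv wc]) by apply/zP; split; apply/ldiv_cls.
  exact.
Qed.

Lemma mono_bounded : bounded_factorizations M.
Proof.
move=> m; exists (mwt m) => s s1 <-; elim: s s1 => //= x s IH.
rewrite inE negb_or big_cons mwtM => /andP[x1 /IH h].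
rewrite -add1n leq_add // lt0n; apply: contra x1 => /eqP/mwt_eq0 ->; exact: eqxx.
Qed.

Lemma mono_garside : has_garside_element M.
Proof.
exists (cls [:: dtop]) => [x|m].
  split=> [[y]|[y]]; have [u ->] := cls_ex x; have [v ->] := cls_ex y.
    by move=> /esym/cls_factor[[a -> ac] _ _]; exact: rdiv_cls.
  by move=> /esym/cls_factor[_ [a -> ac] _]; apply/ldiv_cls.
have [u ->] := cls_ex m; exists [seq cls [:: a] | a <- u].
  by move=> x /mapP[a _ ->]; apply/ldiv_cls; exact: div_nle.
elim: u => [|a u IH]; first by rewrite big_nil.
by rewrite /= big_cons -IH -cls_cat.
Qed.

Section Lattice.
Hypothesis joins : forall s t, nle lR s c -> nle lR t c -> join_below lR c s t.

Lemma dual_lubs a b : exists j d f, germ_lub dmul a b j d f.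
Proof.
have [j [jc aj bj jmin]] := joins (div_nle a) (div_nle b).
exists (mkdiv jc), (mkdiv (nle_quot_top lP aj jc)), (mkdiv (nle_quot_top lP bj jc)).
split; [by split=> /=; rewrite ?mulVKg | by split=> /=; rewrite ?mulVKg |].
move=> k x' y' [kx lx] [ky ly].
have jk : nle lR j (val k).
  apply: jmin; first exact: div_nle.
    by rewrite kx; apply: nle_mulr; rewrite -kx.
  by rewrite ky; apply: nle_mulr; rewrite -ky.
by exists (mkdiv (nle_quot_top lP jk (div_nle k))); split=> /=; rewrite ?mulVKg.
Qed.

Lemma nle_left (s t : affine_perm n) : nle lR s t ->
  lR t = (lR (t * s^-1)%g + lR s)%N /\ nle lR (t * s^-1)%g t.
Proof.
move=> st; have e : lR t = (lR (t * s^-1)%g + lR s)%N by rewrite -st (normC lP t) addnC.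
split=> //; rewrite -{2}[t](mulgVK s); apply: nle_mulr.
by rewrite mulgVK.
Qed.

(** Left and right divisors agree in W, so the same joins provide lcms on the other side. *)
Lemma dual_lubs_op a b : exists j d f, germ_lub (fun d f => dmul f d) a b j d f.
Proof.
have [j [jc aj bj jmin]] := joins (div_nle a) (div_nle b).
have [la ja] := nle_left aj; have [lb jb] := nle_left bj.
exists (mkdiv jc), (mkdiv (nle_trans lP ja jc)), (mkdiv (nle_trans lP jb jc)).
split; [by split=> /=; rewrite ?mulgVK | by split=> /=; rewrite ?mulgVK |].
move=> k x' y' [kx lx] [ky ly].
have jk : nle lR j (val k).
  apply: jmin; first exact: div_nle.
    by rewrite kx; apply: (nle_mull lP); rewrite -kx.
  by rewrite ky; apply: (nle_mull lP); rewrite -ky.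
have [lk jk'] := nle_left jk.
by exists (mkdiv (nle_trans lP jk' (div_nle k))); split=> /=; rewrite ?mulgVK.
Qed.

(** Reversing words passes to the opposite germ, which turns results on left divisibility into
    results on right divisibility. *)
Lemma cls_rev u v : cls u = cls v <->
  pres_cong (germ_rel dunit (fun d f => dmul f d)) (rev u) (rev v).
Proof.
rewrite clsP; split.
  apply: pres_cong_rev => u' v' [|a b d e]; rewrite /rev /=.
    exact: (PresRel [::] [::] (GermOne _ _)).
  by apply: cong_mul.
rewrite -{2}[u]revK -{2}[v]revK.
apply: pres_cong_rev => u' v' [|a b d e]; rewrite /rev /=.
  exact: (PresRel [::] [::] (GermOne _ _)).
by apply: cong_mul.
Qed.

Lemma ldiv_joins x y : exists z, is_join (@ldiv M) x y z.
Proof.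
have [u ->] := cls_ex x; have [v ->] := cls_ex y.
have [u' [v' [/clsP e h]]] := word_lcm_ex dual_germ dual_lubs u v.
exists (cls (u ++ u')) => t; split=> [[z ->]|[[z tz] [z' tz']]].
  by split; [|rewrite e]; rewrite cls_cat -mulgA; eexists.
have [w zE] := cls_ex z; have [w' zE'] := cls_ex z'; subst z z'.
rewrite -!cls_cat in tz tz'; rewrite tz in tz' *; have [w'' /clsP wE _] := h _ _ ((clsP _ _).1 tz').
by exists (cls w''); rewrite cls_cat wE !cls_cat mulgA.
Qed.

Lemma rdiv_joins x y : exists z, is_join (@rdiv M) x y z.
Proof.
have [u ->] := cls_ex x; have [v ->] := cls_ex y.
have [u' [v' [e h]]] := word_lcm_ex (germ_op dual_germ) dual_lubs_op (rev u) (rev v).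
rewrite -[u']revK -[v']revK -!rev_cat in e h; move/cls_rev: e => e.
exists (cls (rev u' ++ u)) => t; split=> [[z ->]|[[z tz] [z' tz']]].
  by split; [|rewrite e]; rewrite cls_cat mulgA; eexists.
have [w zE] := cls_ex z; have [w' zE'] := cls_ex z'; subst z z'.
rewrite -!cls_cat in tz tz'; rewrite tz in tz' *.
have := (cls_rev _ _).1 tz'; rewrite !rev_cat => /h[w'' wE _].
rewrite -[w'']revK -rev_cat in wE; move/cls_rev: wE => wE.
by exists (cls (rev w'')); rewrite cls_cat wE !cls_cat mulgA.
Qed.

Lemma dual_cancel : cancellative M.
Proof.
split=> x y z.
  have [u ->] := cls_ex x; have [v ->] := cls_ex y; have [w ->] := cls_ex z.
  by rewrite -!cls_cat => /clsP/(word_cancel dual_germ dual_lubs)/clsP.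
have [u ->] := cls_ex x; have [v ->] := cls_ex y; have [w ->] := cls_ex z.
rewrite -!cls_cat => /cls_rev; rewrite !rev_cat.
by move/(word_cancel (germ_op dual_germ) dual_lubs_op)/cls_rev.
Qed.

Lemma dual_lattices : divisibility_lattices M.
Proof.
split.
- apply: (lattice_of_joins (rk := mwt) (bot := 1)) ldiv_joins.
  + by move=> x; exists 1; rewrite mulg1.
  + by move=> x y z [s ->] [t ->]; exists (s * t); rewrite mulgA.
  + by move=> x; exists x; rewrite mul1g.
  + by move=> x y [s ->]; rewrite mwtM leq_addr.
  + move=> x y [s ->]; rewrite mwtM => h; have /mwt_eq0 -> : mwt s = 0%N by lia.
    by rewrite mulg1.
- apply: (lattice_of_joins (rk := mwt) (bot := 1)) rdiv_joins.
  + by move=> x; exists 1; rewrite mul1g.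
  + by move=> x y z [s ->] [t ->]; exists (t * s); rewrite mulgA.
  + by move=> x; exists x; rewrite mulg1.
  + by move=> x y [s ->]; rewrite mwtM leq_addl.
  + move=> x y [s ->]; rewrite mwtM => h; have /mwt_eq0 -> : mwt s = 0%N by lia.
    by rewrite mul1g.
Qed.

Lemma dual_quasi_garside : quasi_garside M.
Proof.
by split; [exact: mono_bounded | exact: dual_cancel | exact: dual_lattices | exact: mono_garside].
Qed.
End Lattice.
End DualMonoid.

(** * Both directions of the criterion *)

Section Main.
Variables (n : nat) (hn : (1 < n)%N) (c : affine_perm n).

Lemma single_joins (B : int -> bool) : cox_data c B ->
    (exists2 x, ~~ B x & forall y, ~~ B y -> cong n y x) ->
  forall s t, nle (@lR n) s c -> nle (@lR n) t c -> join_below (@lR n) c s t.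
Proof. by move=> cB [x Bx h] s t; exact: (lR_joins hn cB Bx h). Qed.

Lemma single_joins_inv (B : int -> bool) : cox_data c B ->
    (exists2 x, B x & forall y, B y -> cong n y x) ->
  forall s t, nle (@lR n) s c -> nle (@lR n) t c -> join_below (@lR n) c s t.
Proof.
move=> cB [x Bx h] s t sc tc; have ln := lR_norm hn.
apply: (join_belowV ln); apply: (lR_joins hn (cox_inv cB) (alpha := x)).
- by rewrite negbK.
- by move=> y; rewrite negbK; exact: h.
- exact: nleV.
- exact: nleV.
Qed.

Lemma joins_single (B : int -> bool) : cox_data c B ->
    (forall s t, nle (@lR n) s c -> nle (@lR n) t c -> join_below (@lR n) c s t) ->
  (exists2 x, ~~ B x & forall y, ~~ B y -> cong n y x) \/
  (exists2 x, B x & forall y, B y -> cong n y x).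
Proof.
move=> cB joins; apply: contrapT => /not_orP[h1 h2].
have other (P : int -> Prop) : (exists x, P x) ->
    ~ (exists2 x, P x & forall y, P y -> cong n y x) ->
    exists x y, [/\ P x, P y & ~~ cong n y x].
  move=> [x Px] h; apply: contrapT => h'; apply: h; exists x => // y Py.
  by apply/negPn/negP => yx; apply: h'; exists x, y.
have [z1 [z2 [Bz1 Bz2 z21]]] := other _ (cox_exXi cB) h1.
have [a [a' [Ba Ba' aa']]] := other _ (cox_exX cB) h2.
have z12 : ~~ cong n z1 z2 by rewrite cong_sym.
(* The second class of X has a point strictly between a and a + n, and c a is not beyond it. *)
have ca : c a < a + n%:Z.
  have [k k1 k2] := cong_window hn aa'; have [_ _ h] := cox_up cB Ba.
  by apply: le_lt_trans k2; apply: h => //; rewrite (cox_periodic cB).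
have ln := lR_norm hn; have [_ _ top] := rot_top hn cB Ba ca Bz1.
apply: (no_join hn cB Ba ca Bz1 Bz2 z12); apply: joins; apply: (nle_trans ln) top.
  exact: (rot_left hn cB Ba ca Bz1).
exact: (rot_right hn cB Ba ca Bz1).
Qed.
End Main.

Theorem proposition5p5 (n : nat) (hn : (2 <= n)%N) (c : affine_perm n)
    (hc : coxeter_element c) (X Xi : set int) (hX : associated_sets c X Xi) :
  (divisibility_lattices (dual_monoid c) <-> single_mod n Xi \/ single_mod n X)
  /\ (divisibility_lattices (dual_monoid c) -> quasi_garside (dual_monoid c)).
Proof.
have [B [cB XB XiB]] := associated_cox hn hX.
have singleE : single_mod n Xi \/ single_mod n X <->
    (exists2 x, ~~ B x & forall y, ~~ B y -> cong n y x) \/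
    (exists2 x, B x & forall y, B y -> cong n y x).
  split=> -[[x /XiB xP h]|[x /XB xP h]]; [left|right|left|right]; exists x => //.
  - by move=> y /XiB; exact: h.
  - by move=> y /XB; exact: h.
  - by move=> y /XiB; exact: h.
  - by move=> y /XB; exact: h.
have joins : single_mod n Xi \/ single_mod n X ->
    forall s t, nle (@lR n) s c -> nle (@lR n) t c -> join_below (@lR n) c s t.
  by move/singleE => [h|h]; [exact: single_joins h | exact: single_joins_inv h].
have single : divisibility_lattices (dual_monoid c) -> single_mod n Xi \/ single_mod n X.
  by move=> [left_lattice _]; apply/singleE/(joins_single hn cB)/(lattice_joins hn).
split; first split=> //.
  by move/joins; exact: dual_lattices.
by move/single/joins; exact: dual_quasi_garside.
Qed.
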